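(* Let $N\ge1$ be an integer. For every $k>0$, the set of functions $\Theta_{\alpha,\beta}:\mathbb{R}^+\to\mathbb{R}^+$, $t\mapsto\alpha\exp\left(-\beta t^{\frac{k}{k+1}}\right)$, where $(\alpha,\beta)$ runs over all pairs of positive real numbers, is a degree of the best uniform $N$-polynomial approximation of the Gevrey class $H_N^k(D)$. That is, for every continuous $f:\overline D\to\mathbb{C}$, one has $f\in H_N^k(D)$ if and only if there exist $\alpha,\beta>0$ such that $\mathcal{E}_{N,n}(f)\le\alpha\exp\left(-\beta n^{\frac{k}{k+1}}\right)$ for all $n\in\mathbb{N}$.
   Context: $D=\{z\in\mathbb{C}:|z|<1\}$, $\overline D$ is its closure, $\mathbb{N}$ contains $0$, and $C(\overline D)$ is the set of continuous functions $\overline D\to\mathbb{C}$. For a function $h$ on a nonempty set $E\subset\mathbb{C}$, $\|h\|_{\infty,E}=\sup_{u\in E}|h(u)|$. With $z=x+iy$, $\frac{\partial}{\partial\overline z}=\frac12\left(\frac{\partial}{\partial x}+i\frac{\partial}{\partial y}\right)$, and for $\alpha=(\alpha_1,\alpha_2)\in\mathbb{N}^2$, $|\alpha|=\alpha_1+\alpha_2$ and $D^\alpha=\frac{\partial^{|\alpha|}}{\partial x^{\alpha_1}\partial y^{\alpha_2}}$. $H_N(D)$ (polyanalytic functions of order $N$ on $D$) is the set of functions $F:D\to\mathbb{C}$ of class $C^N$ with $\left(\frac{\partial}{\partial\overline z}\right)^NF=0$ on $D$; such functions are automatically $C^\infty$. The Gevrey polyanalytic class $H_N^k(D)$ is the set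 of $f\in H_N(D)$ for which there is a constant $B>0$ with $\|D^\alpha f\|_{\infty,D}\le B^{|\alpha|+1}|\alpha|^{(1+\frac1k)|\alpha|}$ for all $\alpha\in\mathbb{N}^2$ (convention $0^0=1$). Functions in $H_N^k(D)$ extend uniquely to continuous functions on $\overline D$, and $H_N^k(D)$ is regarded in this way as a subset of $C(\overline D)$; thus for $f\in C(\overline D)$, ''$f\in H_N^k(D)$'' means $f|_D\in H_N^k(D)$. An $N$-analytic polynomial is a function $P:\mathbb{C}\to\mathbb{C}$ of the form $P(z)=\sum_{p=0}^{N-1}Q_p(z)\overline z^{\,p}$ with $Q_0,\dots,Q_{N-1}$ holomorphic polynomials (uniquely determined by $P$); its degree is $d^\circ(P)=\max\{\deg Q_p:0\le p\le N-1,\ Q_p\neq0\}$ if $P\ne0$, and $d^\circ(0)=-\infty$. $\Pi_{N,n}$ is the vector space of $N$-analytic polynomials with $d^\circ(P)\le n$. For $f\in C(\overline D)$, $\mathcal{E}_{N,n}(f)=\inf_{P\in\Pi_{N,n}}\|f-P\|_{\infty,\overline D}$. For a nonempty $\mathfrak{X}\subset C(\overline D)$, a degree of the best uniform $N$-polynomial approximation of functions of $\mathfrak{X}$ is a set $\{\mathfrak{m}_\mu:\mu\in\Lambda\}$ of functions $\mathfrak{m}_\mu:\mathbb{R}^+\to\mathbb{R}^+$ ($\Lambda$ nonempty, $\mathbb{R}^+=[0,+\infty[$) such that for every $f\in C(\overline D)$: $f\in\mathfrak{X}$ if and only if there is $\mu\in\Lambda$ with $\mathcal{E}_{N,n}(f)\le\mathfrak{m}_\mu(n)$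 for all $n\in\mathbb{N}$. *)

(* Defs.v *)
(* Complex numbers are Coquelicot's C = R * R with the product topology. *)
From Stdlib Require Import Reals.
From Coquelicot Require Import Coquelicot.
Open Scope R_scope.

(* A function on a set E is a total function C -> C considered only on E.
   The disc is open, so derivatives at its points only see values on it. *)

Definition disc (z : C) : Prop := Cmod z < 1.
Definition cdisc (z : C) : Prop := Cmod z <= 1.

Definition sup_norm (E : C -> Prop) (h : C -> C) : Rbar :=
  Lub_Rbar (fun r => exists u, E u /\ r = Cmod (h u)).

(* Rpower 0 a = 1 for every a (since ln 0 = 0), hence the case distinction:
   here 0^0 = 1 and 0^a = 0 for a <> 0. *)
Definition rpow (x a : R) : R :=
  if Req_EM_T x 0 then (if Req_EM_T a 0 then 1 else 0) else Rpower x a.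

Definition dx (f : C -> C) (z : C) : C :=
  (Derive (fun t => Re (f (t, Im z))) (Re z),
   Derive (fun t => Im (f (t, Im z))) (Re z)).
Definition dy (f : C -> C) (z : C) : C :=
  (Derive (fun t => Re (f (Re z, t))) (Im z),
   Derive (fun t => Im (f (Re z, t))) (Im z)).

(* Derive is total; these say that the partial derivatives really exist. *)
Definition ex_dx (f : C -> C) (z : C) : Prop :=
  ex_derive (fun t => Re (f (t, Im z))) (Re z) /\
  ex_derive (fun t => Im (f (t, Im z))) (Re z).
Definition ex_dy (f : C -> C) (z : C) : Prop :=
  ex_derive (fun t => Re (f (Re z, t))) (Im z) /\
  ex_derive (fun t => Im (f (Re z, t))) (Im z).

Fixpoint class_C (n : nat) (f : C -> C) : Prop :=
  continuous_on disc f /\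
  match n with
  | O => True
  | S m => (forall z, disc z -> ex_dx f z /\ ex_dy f z) /\
           class_C m (dx f) /\ class_C m (dy f)
  end.

Definition dbar (f : C -> C) (z : C) : C :=
  (RtoC (1 / 2) * (dx f z + Ci * dy f z))%C.

Definition Dpart (a1 a2 : nat) (f : C -> C) : C -> C :=
  Nat.iter a1 dx (Nat.iter a2 dy f).

Definition polyanalytic (N : nat) (F : C -> C) : Prop :=
  class_C N F /\ (forall z, disc z -> Nat.iter N dbar F z = RtoC 0).

Definition gevrey_polyanalytic (N : nat) (k : R) (f : C -> C) : Prop :=
  polyanalytic N f /\
  exists B, 0 < B /\ forall a1 a2 : nat,
    Rbar_le (sup_norm disc (Dpart a1 a2 f))
      (Finite (B ^ (a1 + a2 + 1)
               * rpow (INR (a1 + a2)) ((1 + 1 / k) * INR (a1 + a2)))).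

(* The Gevrey class as a subset of the continuous functions on the closed
   disc, through restriction to the open disc. *)
Definition gevrey_cdisc (N : nat) (k : R) (f : C -> C) : Prop :=
  continuous_on cdisc f /\ gevrey_polyanalytic N k f.

Definition poly_eval (a : nat -> C) (m : nat) (z : C) : C :=
  sum_n (fun j => (a j * z ^ j)%C) m.

Definition is_poly (Q : C -> C) : Prop :=
  exists (m : nat) (a : nat -> C), forall z, Q z = poly_eval a m z.

(* The zero polynomial has no degree in this sense. *)
Definition has_degree (Q : C -> C) (d : nat) : Prop :=
  exists a : nat -> C, a d <> RtoC 0 /\ forall z, Q z = poly_eval a d z.

(* Meant for N >= 1: the sum runs over p = 0, ..., N - 1. *)
Definition nanalytic_decomposition (N : nat) (Q : nat -> C -> C) (P : C -> C)
    : Prop :=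
  (forall p, (p < N)%nat -> is_poly (Q p)) /\
  forall z, P z = sum_n (fun p => (Q p z * Cconj z ^ p)%C) (N - 1).

(* The Q p are determined by P; the maximum of the degrees of the nonzero ones
   is at most n exactly when each of these degrees is. *)
Definition Pi_space (N n : nat) (P : C -> C) : Prop :=
  exists Q : nat -> C -> C, nanalytic_decomposition N Q P /\
    forall p d, (p < N)%nat -> has_degree (Q p) d -> (d <= n)%nat.

Definition best_approx (N n : nat) (f : C -> C) : Rbar :=
  Glb_Rbar (fun r => exists P, Pi_space N n P /\
    Finite r = sup_norm cdisc (fun z => (f z - P z)%C)).

(* X is a set of functions on the closed disc; M is a set of functions from
   [0, +oo[ to itself, represented by functions R -> R. *)
Definition degree_of_best_approx (N : nat) (X : (C -> C) -> Prop)
    (M : (R -> R) -> Prop) : Prop :=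
  (exists f, X f) /\
  (forall f, X f -> continuous_on cdisc f) /\
  (exists m, M m) /\
  (forall m, M m -> forall t, 0 <= t -> 0 <= m t) /\
  (forall f, continuous_on cdisc f ->
     (X f <-> exists m, M m /\
        forall n : nat, Rbar_le (best_approx N n f) (Finite (m (INR n))))).

Definition Theta (k alpha beta t : R) : R :=
  alpha * exp (- beta * rpow t (k / (k + 1))).

(* Main.v *)
From Stdlib Require Import Reals Lra Lia Compare_dec FunctionalExtensionality Classical
  IndefiniteDescription.
From Coquelicot Require Import Coquelicot.
Require Import Defs.
Open Scope R_scope.

(** The class is characterized by coefficients. With K = N - 1, a function f on
    the disc is polyanalytic of order N exactly when it is a sum
    f(z) = sum over p <= K and j >= 0 of a p j * z^j * (conj z)^p whose rows are
    power series of radius at least one. Writing g = k / (k + 1), so that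
    1 / g = 1 + 1 / k, both the Gevrey condition and the decay
    alpha * exp (- beta * n^g) of the best approximation are equivalent to
    |a p j| <= A * exp (- b * (j + 1)^g) for some A, b > 0.

    The tool that makes this possible is [polyseries_coef_bound]: if the sum above
    is bounded by M in the disc, then |a p j| <= C * (j + 1)^N * M with C depending
    on N only. On the circle of radius rho one has conj z = rho^2 / z, so a Fourier
    coefficient of the sum is a combination of at most N monomials in rho, one for
    each p; since it is bounded for all rho in (0, 1), the monomials can be
    eliminated one after the other by comparing the values at rho and lam * rho,
    where lam = exp (- 1 / (J + 1)). The loss is polynomial and occurs only once,
    so it is absorbed by the stretched exponential; a Markov inequality for
    N-analytic polynomials would instead lose a factor for each derivative.

    From Gevrey to decay ([gevrey_decays]): the derivative of order m in z has the
    coefficients (j + 1) ... (j + m) * a p (j + m) and is bounded by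
    B^(m+1) * m^(m/g); the bound on coefficients and the choice of m of the order of
    J^g give the decay. Truncating the rows then yields the approximation
    ([best_approx_decay]). From approximation to decay
    ([decays_of_best_approx]): the differences of consecutive near-best
    approximants are N-analytic polynomials with stretched exponentially small
    norm, hence with stretched exponentially small coefficients. From decay to
    Gevrey ([decays_gevrey]): differentiation is a pair of explicit shifts on the
    coefficients, and the maximum of x^m * exp (- b * x^g) is at most
    C^m * m^(m/g) ([pow_exp_bound]).

    That polyanalytic functions are such sums ([polyanalytic_series]) follows by
    induction on the order from the case of holomorphic functions, where Cauchy's
    formula is obtained by shrinking a circle onto the point w: the mean of
    H (w + t * (zeta - w)) * zeta / (zeta - w) over the circle has derivative zero
    in t, because the derivative of the integrand is, up to the factor i t, the
    angular derivative of H along a circle. *)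

(** * Finite sums and limits of complex numbers *)

(** The sum of [u j] over [j < n]. *)
Fixpoint csum (u : nat -> C) (n : nat) : C :=
  match n with O => RtoC 0 | S m => (csum u m + u m)%C end.

Lemma csum_S (u : nat -> C) (n : nat) : csum u (S n) = (csum u n + u n)%C.
Proof. reflexivity. Qed.

Lemma sum_n_csum (u : nat -> C) (n : nat) : sum_n u n = csum u (S n).
Proof.
  induction n as [|n IH]; [rewrite sum_O; simpl; ring|].
  rewrite sum_Sn, IH. reflexivity.
Qed.

Lemma csum_ext (u v : nat -> C) (n : nat) :
  (forall j, (j < n)%nat -> u j = v j) -> csum u n = csum v n.
Proof.
  induction n as [|n IH]; intros H; simpl; [reflexivity|].
  rewrite IH by (intros; apply H; lia). rewrite H by lia. reflexivity.
Qed.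

Lemma csum_plus (u v : nat -> C) (n : nat) :
  csum (fun j => (u j + v j)%C) n = (csum u n + csum v n)%C.
Proof. induction n as [|n IH]; simpl; [ring|rewrite IH; ring]. Qed.

Lemma csum_scal (c : C) (u : nat -> C) (n : nat) :
  csum (fun j => (c * u j)%C) n = (c * csum u n)%C.
Proof. induction n as [|n IH]; simpl; [ring|rewrite IH; ring]. Qed.

Lemma csum_zero (n : nat) : csum (fun _ => RtoC 0) n = RtoC 0.
Proof. induction n as [|n IH]; simpl; [reflexivity|rewrite IH; ring]. Qed.

Lemma csum_single (u : nat -> C) (n i : nat) : (i < n)%nat ->
  (forall j, (j < n)%nat -> j <> i -> u j = RtoC 0) -> csum u n = u i.
Proof.
  induction n as [|n IH]; intros Hi H; [lia|simpl].
  destruct (Nat.eq_dec i n) as [->|Hne].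
  - rewrite (csum_ext u (fun _ => RtoC 0)) by (intros; apply H; lia).
    rewrite csum_zero. ring.
  - rewrite IH by (try lia; intros; apply H; lia). rewrite (H n) by lia. ring.
Qed.

Lemma csum_shift (u : nat -> C) (n : nat) :
  csum u (S n) = (u O + csum (fun j => u (S j)) n)%C.
Proof.
  induction n as [|n IH]; [simpl; ring|].
  replace (csum u (S (S n))) with (csum u (S n) + u (S n))%C by reflexivity.
  rewrite IH. simpl. ring.
Qed.

Lemma Cmod_minus_sym (a b : C) : Cmod (a - b) = Cmod (b - a).
Proof. rewrite <- Cmod_opp. f_equal. ring. Qed.

Lemma Cmod_triangle3 (a b c : C) : Cmod (a - c) <= Cmod (a - b) + Cmod (b - c).
Proof.
  replace (a - c)%C with ((a - b) + (b - c))%C by ring. apply Cmod_triangle.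
Qed.

Lemma Cmod_triangle_rev (a b : C) : Cmod a <= Cmod b + Cmod (a - b).
Proof.
  replace a with (b + (a - b))%C at 1 by ring. apply Cmod_triangle.
Qed.

Lemma im_le_Cmod (c : C) : Rabs (Im c) <= Cmod c.
Proof.
  eapply Rle_trans; [|apply Rmax_Cmod]. apply Rmax_r.
Qed.

Lemma Cmod_le_re_im (c : C) : Cmod c <= Rabs (Re c) + Rabs (Im c).
Proof.
  destruct c as [a b]; simpl.
  replace (a, b) with (RtoC a + Ci * RtoC b)%C
    by (unfold RtoC, Ci, Cplus, Cmult; simpl; f_equal; ring).
  eapply Rle_trans; [apply Cmod_triangle|].
  rewrite Cmod_mult, Cmod_Ci, !Cmod_R. lra.
Qed.

Lemma csum_le_const (u : nat -> C) (M : R) (n : nat) :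
  (forall j, (j < n)%nat -> Cmod (u j) <= M) -> Cmod (csum u n) <= INR n * M.
Proof.
  induction n as [|n IH]; intros H.
  - simpl. rewrite Cmod_0. lra.
  - rewrite S_INR. simpl csum.
    eapply Rle_trans; [apply Cmod_triangle|].
    assert (H1 := IH (fun j Hj => H j (Nat.lt_lt_succ_r _ _ Hj))).
    assert (H2 := H n (Nat.lt_succ_diag_r n)). lra.
Qed.

Lemma csum_telescope (u : nat -> C) (tau : nat -> R) :
  (forall j, Cmod (u j) <= tau j - tau (S j)) ->
  forall n d, Cmod (csum u (n + d) - csum u n) <= tau n - tau (n + d)%nat.
Proof.
  intros H n d. induction d as [|d IH].
  - rewrite Nat.add_0_r. replace (csum u n - csum u n)%C with (RtoC 0) by ring.
    rewrite Cmod_0. lra.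
  - rewrite Nat.add_succ_r. simpl csum.
    replace (csum u (n + d) + u (n + d)%nat - csum u n)%C
      with ((csum u (n + d) - csum u n) + u (n + d)%nat)%C by ring.
    eapply Rle_trans; [apply Cmod_triangle|].
    specialize (H (n + d)%nat). lra.
Qed.

(** [l] is the limit of the complex sequence [v]. *)
Definition clim (v : nat -> C) (l : C) : Prop :=
  is_lim_seq (fun n => Cmod (v n - l)) 0.

Lemma clim_of_bound (v : nat -> C) (l : C) (tau : nat -> R) :
  (forall n, Cmod (v n - l) <= tau n) -> is_lim_seq tau 0 -> clim v l.
Proof.
  intros H Ht.
  apply is_lim_seq_le_le with (u := fun _ => 0) (w := tau).
  - intros n. split; [apply Cmod_ge_0|apply H].
  - apply is_lim_seq_const.
  - exact Ht.
Qed.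

Lemma clim_le (v : nat -> C) (l c : C) (M : nat -> R) (m : R) : clim v l ->
  is_lim_seq M m -> (forall n, Cmod (v n - c) <= M n) -> Cmod (l - c) <= m.
Proof.
  intros Hv HM H.
  assert (Hs : is_lim_seq (fun n => Cmod (v n - l) + M n) (0 + m)).
  { apply is_lim_seq_plus'; [exact Hv|exact HM]. }
  rewrite Rplus_0_l in Hs.
  assert (Hle := is_lim_seq_le (fun _ => Cmod (l - c)) _ _ _
    (fun n => Rle_trans _ _ _ (Cmod_triangle3 l (v n) c)
       (Rplus_le_compat _ _ _ _
          (Req_le _ _ (Cmod_minus_sym l (v n))) (H n)))
    (is_lim_seq_const _) Hs).
  exact Hle.
Qed.

Lemma clim_le_const (v : nat -> C) (l c : C) (m : R) : clim v l ->
  (forall n, Cmod (v n - c) <= m) -> Cmod (l - c) <= m.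
Proof.
  intros Hv H. apply clim_le with (v := v) (M := fun _ => m); auto.
  apply is_lim_seq_const.
Qed.

Lemma clim_unique (v : nat -> C) (l l' : C) : clim v l -> clim v l' -> l = l'.
Proof.
  intros H H'. assert (Hle := clim_le v l l' _ _ H H' (fun n => Rle_refl _)).
  assert (E : Cmod (l - l') = 0) by (apply Rle_antisym; [exact Hle|apply Cmod_ge_0]).
  apply Cmod_eq_0 in E. apply Ceq_minus. exact E.
Qed.

Lemma clim_plus (u v : nat -> C) (l m : C) : clim u l -> clim v m ->
  clim (fun n => (u n + v n)%C) (l + m)%C.
Proof.
  intros Hu Hv.
  apply clim_of_bound with (tau := fun n => Cmod (u n - l) + Cmod (v n - m)).
  - intros n. replace (u n + v n - (l + m))%C with ((u n - l) + (v n - m))%C by ring.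
    apply Cmod_triangle.
  - replace (Finite 0) with (Finite (0 + 0)) by (f_equal; ring).
    apply is_lim_seq_plus'; assumption.
Qed.

Lemma clim_scal (c : C) (u : nat -> C) (l : C) : clim u l ->
  clim (fun n => (c * u n)%C) (c * l)%C.
Proof.
  intros Hu.
  apply clim_of_bound with (tau := fun n => Cmod c * Cmod (u n - l)).
  - intros n. replace (c * u n - c * l)%C with (c * (u n - l))%C by ring.
    rewrite Cmod_mult. lra.
  - replace (Finite 0) with (Rbar_mult (Cmod c) 0) by (simpl; f_equal; ring).
    apply is_lim_seq_scal_l. exact Hu.
Qed.

Lemma clim_incr (u : nat -> C) (l : C) : clim u l -> clim (fun n => u (S n)) l.
Proof. intros H. unfold clim. apply (is_lim_seq_incr_1 (fun n => Cmod (u n - l))). exact H. Qed.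

Lemma clim_re_im (v : nat -> C) (a b : R) :
  is_lim_seq (fun n => Re (v n)) a -> is_lim_seq (fun n => Im (v n)) b ->
  clim v (a, b).
Proof.
  intros Ha Hb.
  apply clim_of_bound with
    (tau := fun n => Rabs (Re (v n) - a) + Rabs (Im (v n) - b)).
  - intros n. eapply Rle_trans; [apply Cmod_le_re_im|]. apply Rle_refl.
  - replace (Finite 0) with (Finite (0 + 0)) by (f_equal; ring).
    apply is_lim_seq_plus'.
    + apply is_lim_seq_abs_0 with (u := fun n => Re (v n) - a).
      replace (Finite 0) with (Finite (a - a)) by (f_equal; ring).
      apply is_lim_seq_minus'; [exact Ha|apply is_lim_seq_const].
    + apply is_lim_seq_abs_0 with (u := fun n => Im (v n) - b).
      replace (Finite 0) with (Finite (b - b)) by (f_equal; ring).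
      apply is_lim_seq_minus'; [exact Hb|apply is_lim_seq_const].
Qed.

Lemma clim_part (P : C -> R) (v : nat -> C) (l : C) :
  (forall a b, Rabs (P a - P b) <= Cmod (a - b)) -> clim v l ->
  is_lim_seq (fun n => P (v n)) (P l).
Proof.
  intros HP H. apply is_lim_seq_ext with (fun n => P (v n) - P l + P l); [intros; ring|].
  replace (Finite (P l)) with (Finite (0 + P l)) by (f_equal; ring).
  apply is_lim_seq_plus'; [|apply is_lim_seq_const].
  apply is_lim_seq_abs_0.
  apply is_lim_seq_le_le with (u := fun _ => 0) (w := fun n => Cmod (v n - l)).
  - intros n. split; [apply Rabs_pos|apply HP].
  - apply is_lim_seq_const.
  - exact H.
Qed.

Lemma clim_exists (v : nat -> C) (tau : nat -> R) : is_lim_seq tau 0 ->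
  (forall n d, Cmod (v (n + d)%nat - v n) <= tau n) -> exists l, clim v l.
Proof.
  intros Ht H.
  assert (HC : forall P : C -> R, (forall a b, Rabs (P a - P b) <= Cmod (a - b)) ->
    exists x : R, is_lim_seq (fun n => P (v n)) x).
  { intros P HP. apply ex_lim_seq_cauchy_corr. intros eps.
    apply is_lim_seq_spec in Ht.
    destruct (Ht (mkposreal (eps / 2) ltac:(destruct eps; simpl; lra))) as [N HN].
    exists N. intros n m Hn Hm. simpl in HN.
    assert (HNN := HN N (Nat.le_refl _)). rewrite Rminus_0_r in HNN.
    assert (Ha := Rle_abs (tau N)).
    eapply Rle_lt_trans; [apply HP|].
    eapply Rle_lt_trans; [apply (Cmod_triangle3 _ (v N))|].
    assert (H1 := H N (n - N)%nat). assert (H2 := H N (m - N)%nat).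
    replace (N + (n - N))%nat with n in H1 by lia.
    replace (N + (m - N))%nat with m in H2 by lia.
    rewrite Cmod_minus_sym in H2. lra. }
  destruct (HC Re) as [a Ha].
  { intros x y. exact (re_le_Cmod (x - y)). }
  destruct (HC Im) as [b Hb].
  { intros x y. exact (im_le_Cmod (x - y)). }
  exists (a, b). apply clim_re_im; assumption.
Qed.

(** A series whose terms are dominated by the decrements of a sequence [tau]
    with limit zero converges, and [tau n] bounds its [n]-th remainder. *)
Lemma csum_clim (u : nat -> C) (tau : nat -> R) : is_lim_seq tau 0 ->
  (forall j, Cmod (u j) <= tau j - tau (S j)) ->
  exists l, clim (csum u) l /\ forall n, Cmod (csum u n - l) <= tau n.
Proof.
  intros Ht H.
  assert (Hdec : forall n d, tau (n + d)%nat <= tau n).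
  { intros n d. assert (H1 := csum_telescope u tau H n d).
    assert (H2 := Cmod_ge_0 (csum u (n + d) - csum u n)). lra. }
  assert (Hpos : forall n, 0 <= tau n).
  { intros n. apply (is_lim_seq_incr_n tau n) in Ht.
    exact (is_lim_seq_le _ (fun _ => tau n) 0 (tau n)
      (fun d => eq_ind _ (fun k => tau k <= tau n) (Hdec n d) _ (Nat.add_comm n d))
      Ht (is_lim_seq_const _)). }
  assert (Hc : forall n d, Cmod (csum u (n + d) - csum u n) <= tau n).
  { intros n d. assert (H1 := csum_telescope u tau H n d).
    assert (H2 := Hpos (n + d)%nat). lra. }
  destruct (clim_exists (csum u) tau Ht Hc) as [l Hl].
  exists l. split; [exact Hl|]. intros n.
  rewrite Cmod_minus_sym.
  apply clim_le_const with (v := fun d => csum u (n + d)).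
  - apply (is_lim_seq_incr_n (fun k => Cmod (csum u k - l)) n) in Hl.
    eapply is_lim_seq_ext; [|exact Hl]. intros k. simpl. rewrite Nat.add_comm. reflexivity.
  - intros d. apply Hc.
Qed.

(** * Power series in the unit disc *)

(** The sum of the power series with coefficients [b]; the real and imaginary
    parts of the partial sums have a limit in the extended reals whenever the
    series converges, and the value is meaningless otherwise. *)
Definition PS (b : nat -> C) (z : C) : C :=
  (real (Lim_seq (fun n => Re (csum (fun j => (b j * z ^ j)%C) n))),
   real (Lim_seq (fun n => Im (csum (fun j => (b j * z ^ j)%C) n)))).

Lemma PS_unique (b : nat -> C) (z l : C) :
  clim (csum (fun j => (b j * z ^ j)%C)) l -> PS b z = l.
Proof.
  intros H. unfold PS.
  rewrite (is_lim_seq_unique _ _ (clim_part Re _ _ (fun a b => re_le_Cmod (a - b)) H)).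
  rewrite (is_lim_seq_unique _ _ (clim_part Im _ _ (fun a b => im_le_Cmod (a - b)) H)).
  destruct l; reflexivity.
Qed.

(** The coefficients [b] define a power series of radius at least one. *)
Definition rad1 (b : nat -> C) : Prop :=
  forall r, 0 < r < 1 -> exists M, 0 <= M /\ forall j, Cmod (b j) * r ^ j <= M.

Lemma is_lim_seq_geom_scal (K q : R) : 0 <= q < 1 -> is_lim_seq (fun n => K * q ^ n) 0.
Proof.
  intros Hq. replace (Finite 0) with (Rbar_mult K 0) by (simpl; f_equal; ring).
  apply is_lim_seq_scal_l. apply is_lim_seq_geom. rewrite Rabs_pos_eq; lra.
Qed.

Lemma PS_tail (b : nat -> C) (z : C) (r M : R) : 0 < r -> Cmod z < r ->
  (forall j, Cmod (b j) * r ^ j <= M) ->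
  clim (csum (fun j => (b j * z ^ j)%C)) (PS b z) /\
  forall n, Cmod (csum (fun j => (b j * z ^ j)%C) n - PS b z)
    <= M / (1 - Cmod z / r) * (Cmod z / r) ^ n.
Proof.
  intros Hr Hz Hb. set (q := Cmod z / r).
  assert (Hq : 0 <= q < 1).
  { unfold q; split.
    - apply Rmult_le_pos; [apply Cmod_ge_0|left; apply Rinv_0_lt_compat; lra].
    - apply Rmult_lt_reg_r with r; [lra|]. unfold Rdiv. rewrite Rmult_assoc, Rinv_l; lra. }
  destruct (csum_clim (fun j => (b j * z ^ j)%C) (fun n => M / (1 - q) * q ^ n)) as [l [Hl Hn]].
  - apply is_lim_seq_geom_scal; exact Hq.
  - intros j. replace (M / (1 - q) * q ^ j - M / (1 - q) * q ^ S j) with (M * q ^ j)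
      by (simpl; field; lra).
    rewrite Cmod_mult, Cmod_pow.
    replace (Cmod (b j) * Cmod z ^ j) with (Cmod (b j) * r ^ j * q ^ j).
    + apply Rmult_le_compat_r; [apply pow_le; lra|apply Hb].
    + rewrite Rmult_assoc, <- Rpow_mult_distr. do 2 f_equal. unfold q. field. lra.
  - rewrite (PS_unique b z l Hl). split; assumption.
Qed.

Lemma PS_clim (b : nat -> C) (z : C) : rad1 b -> disc z ->
  clim (csum (fun j => (b j * z ^ j)%C)) (PS b z).
Proof.
  intros Hb Hz. assert (Hz0 := Cmod_ge_0 z). unfold disc in Hz.
  destruct (Hb ((1 + Cmod z) / 2) ltac:(lra)) as [M [_ HM]].
  apply (PS_tail b z ((1 + Cmod z) / 2) M); try lra. exact HM.
Qed.

Lemma PS_bound (b : nat -> C) (z : C) (r M : R) : 0 < r -> Cmod z < r ->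
  (forall j, Cmod (b j) * r ^ j <= M) -> Cmod (PS b z) <= M / (1 - Cmod z / r).
Proof.
  intros Hr Hz Hb. destruct (PS_tail b z r M Hr Hz Hb) as [_ H].
  specialize (H O). simpl in H. rewrite Cmod_minus_sym in H.
  replace (PS b z - 0)%C with (PS b z) in H by ring. lra.
Qed.

Lemma PS_zero (z : C) : PS (fun _ => RtoC 0) z = RtoC 0.
Proof.
  apply PS_unique.
  apply clim_of_bound with (tau := fun _ => 0); [|apply is_lim_seq_const].
  intros n. rewrite (csum_ext _ (fun _ => RtoC 0)) by (intros; ring).
  rewrite csum_zero. replace (RtoC 0 - RtoC 0)%C with (RtoC 0) by ring.
  rewrite Cmod_0. lra.
Qed.

Lemma PS_plus (b c : nat -> C) (z : C) : rad1 b -> rad1 c -> disc z ->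
  PS (fun j => (b j + c j)%C) z = (PS b z + PS c z)%C.
Proof.
  intros Hb Hc Hz. apply PS_unique.
  assert (H := clim_plus _ _ _ _ (PS_clim b z Hb Hz) (PS_clim c z Hc Hz)).
  eapply is_lim_seq_ext; [|exact H]. intros n. simpl. rewrite <- csum_plus.
  do 2 f_equal. apply csum_ext. intros; ring.
Qed.

Lemma PS_scal (a : C) (b : nat -> C) (z : C) : rad1 b -> disc z ->
  PS (fun j => (a * b j)%C) z = (a * PS b z)%C.
Proof.
  intros Hb Hz. apply PS_unique.
  assert (H := clim_scal a _ _ (PS_clim b z Hb Hz)).
  eapply is_lim_seq_ext; [|exact H]. intros n. simpl. rewrite <- csum_scal.
  do 2 f_equal. apply csum_ext. intros; ring.
Qed.

(** A power series with finitely many nonzero coefficients is a polynomial. *)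
Lemma PS_finite (b : nat -> C) (z : C) (n : nat) :
  (forall j, (n <= j)%nat -> b j = RtoC 0) ->
  PS b z = csum (fun j => (b j * z ^ j)%C) n.
Proof.
  intros H. apply PS_unique.
  assert (E : forall d, csum (fun j => (b j * z ^ j)%C) (d + n)
                 = csum (fun j => (b j * z ^ j)%C) n).
  { induction d as [|d IH]; [reflexivity|].
    simpl. rewrite IH, H by lia. ring. }
  unfold clim. apply (is_lim_seq_incr_n _ n).
  eapply is_lim_seq_ext; [|apply (is_lim_seq_const 0)].
  intros d. simpl. rewrite E.
  match goal with |- _ = Cmod (?x - ?x) => replace (x - x)%C with (RtoC 0) by ring end.
  rewrite Cmod_0. reflexivity.
Qed.

Lemma rad1_plus (b c : nat -> C) : rad1 b -> rad1 c -> rad1 (fun j => (b j + c j)%C).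
Proof.
  intros Hb Hc r Hr. destruct (Hb r Hr) as [M [HM HM']]. destruct (Hc r Hr) as [L [HL HL']].
  exists (M + L). split; [lra|]. intros j.
  assert (H := Cmod_triangle (b j) (c j)).
  assert (Hp : 0 <= r ^ j) by (apply pow_le; lra).
  apply Rle_trans with ((Cmod (b j) + Cmod (c j)) * r ^ j).
  - apply Rmult_le_compat_r; assumption.
  - specialize (HM' j). specialize (HL' j). lra.
Qed.

Lemma rad1_scal (a : C) (b : nat -> C) : rad1 b -> rad1 (fun j => (a * b j)%C).
Proof.
  intros Hb r Hr. destruct (Hb r Hr) as [M [HM HM']].
  exists (Cmod a * M). split; [apply Rmult_le_pos; [apply Cmod_ge_0|lra]|]. intros j.
  rewrite Cmod_mult, Rmult_assoc. apply Rmult_le_compat_l; [apply Cmod_ge_0|apply HM'].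
Qed.

Lemma rad1_zero : rad1 (fun _ => RtoC 0).
Proof. intros r _. exists 0. split; [lra|]. intros j. rewrite Cmod_0. lra. Qed.

Lemma pow_le_one (r : R) (j : nat) : 0 <= r <= 1 -> r ^ j <= 1.
Proof. intros H. rewrite <- (pow1 j). apply pow_incr. exact H. Qed.

Lemma rad1_bounded (b : nat -> C) (M : R) : (forall j, Cmod (b j) <= M) -> rad1 b.
Proof.
  intros H r Hr. exists M. split.
  - apply Rle_trans with (Cmod (b O)); [apply Cmod_ge_0|apply H].
  - intros j. assert (H1 := pow_le_one r j ltac:(lra)).
    assert (H2 : 0 <= r ^ j) by (apply pow_le; lra).
    assert (H3 := Cmod_ge_0 (b j)). specialize (H j).
    apply Rle_trans with (Cmod (b j) * 1); [apply Rmult_le_compat_l; lra|lra].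
Qed.

Lemma rad1_finite (b : nat -> C) (n : nat) :
  (forall j, (n <= j)%nat -> b j = RtoC 0) -> rad1 b.
Proof.
  revert b. induction n as [|n IH]; intros b H.
  - apply rad1_bounded with 0. intros j. rewrite H by lia. rewrite Cmod_0. lra.
  - assert (E : b = (fun j => ((if Nat.eqb j n then RtoC 0 else b j)
                         + (if Nat.eqb j n then b n else RtoC 0))%C)).
    { apply functional_extensionality. intros j.
      destruct (Nat.eqb_spec j n) as [->|]; ring. }
    rewrite E. apply rad1_plus.
    + apply IH. intros j Hj. destruct (Nat.eqb_spec j n); [reflexivity|]. apply H. lia.
    + apply rad1_bounded with (Cmod (b n)). intros j.
      destruct (Nat.eqb j n); [lra|]. rewrite Cmod_0. apply Cmod_ge_0.
Qed.

Lemma INR_mul_pow_le (q : R) (j : nat) : 0 < q < 1 -> INR j * q ^ j <= q / (1 - q).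
Proof.
  intros Hq. assert (Hqj : 0 < q ^ j) by (apply pow_lt; lra).
  assert (Hb := poly j (/ q - 1) ltac:(rewrite <- Rinv_1 at 1; assert (/ 1 < / q) by (apply Rinv_lt_contravar; lra); lra)).
  replace (1 + (/ q - 1)) with (/ q) in Hb by ring.
  rewrite pow_inv in Hb.
  assert (H1 : (1 + INR j * (/ q - 1)) * q ^ j <= 1).
  { apply Rmult_le_reg_r with (/ q ^ j); [apply Rinv_0_lt_compat; exact Hqj|].
    rewrite Rmult_assoc, Rinv_r by lra. lra. }
  apply Rmult_le_reg_r with ((1 - q) / q).
  - apply Rmult_lt_0_compat; [lra|apply Rinv_0_lt_compat; lra].
  - replace (q / (1 - q) * ((1 - q) / q)) with 1 by (field; lra).
    replace (INR j * q ^ j * ((1 - q) / q)) with (INR j * (/ q - 1) * q ^ j) by (field; lra).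
    lra.
Qed.

Lemma rad1_mul_INR (b : nat -> C) : rad1 b -> rad1 (fun j => (RtoC (INR j) * b j)%C).
Proof.
  intros Hb r Hr. set (r' := (1 + r) / 2).
  destruct (Hb r' ltac:(unfold r'; lra)) as [M [HM HM']].
  set (q := r / r').
  assert (Hr' : r < r' < 1) by (unfold r'; lra).
  assert (Hq : 0 < q < 1).
  { unfold q; split; [apply Rdiv_lt_0_compat; lra|].
    apply Rmult_lt_reg_r with r'; [lra|]. unfold Rdiv. rewrite Rmult_assoc, Rinv_l; lra. }
  assert (Hqq : 0 <= q / (1 - q)) by (apply Rlt_le, Rdiv_lt_0_compat; lra).
  exists (q / (1 - q) * M). split; [apply Rmult_le_pos; lra|].
  intros j. rewrite Cmod_mult, Cmod_R, Rabs_pos_eq by apply pos_INR.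
  replace (r ^ j) with (q ^ j * r' ^ j).
  - replace (INR j * Cmod (b j) * (q ^ j * r' ^ j))
      with ((INR j * q ^ j) * (Cmod (b j) * r' ^ j)) by ring.
    apply Rmult_le_compat.
    + apply Rmult_le_pos; [apply pos_INR|apply pow_le; lra].
    + apply Rmult_le_pos; [apply Cmod_ge_0|apply pow_le; lra].
    + apply INR_mul_pow_le; exact Hq.
    + apply HM'.
  - rewrite <- Rpow_mult_distr. f_equal. unfold q. field. lra.
Qed.

Lemma rad1_shift (b : nat -> C) : rad1 b -> rad1 (fun j => b (S j)).
Proof.
  intros Hb r Hr. destruct (Hb r Hr) as [M [HM HM']].
  exists (M / r). split; [apply Rmult_le_pos; [lra|left; apply Rinv_0_lt_compat; lra]|].
  intros j. specialize (HM' (S j)). simpl in HM'.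
  apply Rmult_le_reg_r with r; [lra|].
  replace (M / r * r) with M by (field; lra). lra.
Qed.

(** The coefficients of the derivative of a power series. *)
Definition dcoef (b : nat -> C) : nat -> C := fun j => (RtoC (INR (S j)) * b (S j))%C.

Lemma rad1_dcoef (b : nat -> C) : rad1 b -> rad1 (dcoef b).
Proof. intros Hb. exact (rad1_shift _ (rad1_mul_INR b Hb)). Qed.

(** * Differentiability in terms of the Wirtinger derivatives *)

(** [F] is real-differentiable at [z], and its Wirtinger derivatives there are
    [A] (with respect to z) and [B] (with respect to the conjugate of z). *)
Definition wirtinger (F : C -> C) (z A B : C) : Prop :=
  forall eps, 0 < eps -> exists delta, 0 < delta /\ forall h : C, Cmod h < delta ->
    Cmod (F (z + h)%C - F z - (A * h + B * Cconj h))%C <= eps * Cmod h.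

(** The curve [g] has velocity [l] at the time [t]. *)
Definition velocity (g : R -> C) (t : R) (l : C) : Prop :=
  forall eps, 0 < eps -> exists delta, 0 < delta /\ forall s : R, Rabs s < delta ->
    Cmod (g (t + s)%R - g t - l * RtoC s)%C <= eps * Rabs s.

Lemma disc_shift (z h : C) : Cmod h < 1 - Cmod z -> disc (z + h)%C.
Proof. intros H. unfold disc. assert (H1 := Cmod_triangle z h). lra. Qed.

Lemma disc_radius_pos (z : C) : disc z -> 0 < 1 - Cmod z.
Proof. unfold disc. lra. Qed.

Lemma wirtinger_const (c z : C) : wirtinger (fun _ => c) z 0 0.
Proof.
  intros eps Heps. exists 1. split; [lra|]. intros h _.
  replace (c - c - (0 * h + 0 * Cconj h))%C with (RtoC 0) by ring.
  rewrite Cmod_0. apply Rmult_le_pos; [lra|apply Cmod_ge_0].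
Qed.

Lemma wirtinger_conj (z : C) : wirtinger Cconj z 0 1.
Proof.
  intros eps Heps. exists 1. split; [lra|]. intros h _.
  rewrite Cplus_conj.
  replace (Cconj z + Cconj h - Cconj z - (0 * h + 1 * Cconj h))%C with (RtoC 0) by ring.
  rewrite Cmod_0. apply Rmult_le_pos; [lra|apply Cmod_ge_0].
Qed.

Lemma wirtinger_plus (F G : C -> C) (z A B A' B' : C) :
  wirtinger F z A B -> wirtinger G z A' B' ->
  wirtinger (fun w => (F w + G w)%C) z (A + A') (B + B').
Proof.
  intros HF HG eps Heps.
  destruct (HF (eps / 2) ltac:(lra)) as [d [Hd Hd']].
  destruct (HG (eps / 2) ltac:(lra)) as [e [He He']].
  exists (Rmin d e). split; [apply Rmin_pos; lra|]. intros h Hh.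
  assert (H1 := Rmin_l d e). assert (H2 := Rmin_r d e).
  specialize (Hd' h ltac:(lra)). specialize (He' h ltac:(lra)).
  replace (F (z + h)%C + G (z + h)%C - (F z + G z) - ((A + A') * h + (B + B') * Cconj h))%C
    with ((F (z + h)%C - F z - (A * h + B * Cconj h))
          + (G (z + h)%C - G z - (A' * h + B' * Cconj h)))%C by ring.
  eapply Rle_trans; [apply Cmod_triangle|]. lra.
Qed.

Lemma wirtinger_lip (F : C -> C) (z A B : C) : wirtinger F z A B ->
  exists delta K, 0 < delta /\ 0 <= K /\ forall h : C, Cmod h < delta ->
    Cmod (F (z + h)%C - F z)%C <= K * Cmod h.
Proof.
  intros H. destruct (H 1 ltac:(lra)) as [d [Hd Hd']].
  assert (HA := Cmod_ge_0 A). assert (HB := Cmod_ge_0 B).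
  exists d, (Cmod A + Cmod B + 1). split; [lra|split; [lra|]]. intros h Hh.
  specialize (Hd' h Hh).
  assert (H1 := Cmod_triangle_rev (F (z + h)%C - F z) (A * h + B * Cconj h)).
  assert (H2 := Cmod_triangle (A * h) (B * Cconj h)).
  rewrite !Cmod_mult, Cmod_conj in H2. lra.
Qed.

Lemma wirtinger_mult (F G : C -> C) (z A B A' B' : C) :
  wirtinger F z A B -> wirtinger G z A' B' ->
  wirtinger (fun w => (F w * G w)%C) z (A * G z + F z * A') (B * G z + F z * B').
Proof.
  intros HF HG eps Heps.
  destruct (wirtinger_lip F z A B HF) as [d1 [K [Hd1 [HK HK']]]].
  destruct (wirtinger_lip G z A' B' HG) as [d2 [L [Hd2 [HL HL']]]].
  assert (HFz := Cmod_ge_0 (F z)). assert (HGz := Cmod_ge_0 (G z)).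
  set (e1 := eps / (3 * (Cmod (G z) + 1))). set (e2 := eps / (3 * (Cmod (F z) + 1))).
  assert (He1 : 0 < e1) by (apply Rdiv_lt_0_compat; lra).
  assert (He2 : 0 < e2) by (apply Rdiv_lt_0_compat; lra).
  assert (He1' : e1 * Cmod (G z) <= eps / 3).
  { replace (eps / 3) with (e1 * (Cmod (G z) + 1)) by (unfold e1; field; lra).
    apply Rmult_le_compat_l; lra. }
  assert (He2' : e2 * Cmod (F z) <= eps / 3).
  { replace (eps / 3) with (e2 * (Cmod (F z) + 1)) by (unfold e2; field; lra).
    apply Rmult_le_compat_l; lra. }
  destruct (HF e1 He1) as [d3 [Hd3 Hd3']]. destruct (HG e2 He2) as [d4 [Hd4 Hd4']].
  set (d5 := eps / (3 * (K * L + 1))).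
  assert (HKL : 0 <= K * L) by (apply Rmult_le_pos; lra).
  assert (Hd5 : 0 < d5) by (apply Rdiv_lt_0_compat; lra).
  assert (Hd5' : K * L * d5 <= eps / 3).
  { replace (eps / 3) with ((K * L + 1) * d5) by (unfold d5; field; lra).
    apply Rmult_le_compat_r; lra. }
  exists (Rmin (Rmin d1 d2) (Rmin (Rmin d3 d4) d5)).
  split; [repeat apply Rmin_pos; lra|]. intros h Hh.
  assert (Hh0 := Cmod_ge_0 h).
  apply Rmin_Rgt_l in Hh as [Ha Hb]. apply Rmin_Rgt_l in Ha as [Ha1 Ha2].
  apply Rmin_Rgt_l in Hb as [Hb Hb3]. apply Rmin_Rgt_l in Hb as [Hb1 Hb2].
  apply Rgt_lt in Ha1, Ha2, Hb1, Hb2, Hb3.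
  specialize (HK' h Ha1). specialize (HL' h Ha2).
  specialize (Hd3' h Hb1). specialize (Hd4' h Hb2).
  replace (F (z + h)%C * G (z + h)%C - F z * G z
           - ((A * G z + F z * A') * h + (B * G z + F z * B') * Cconj h))%C
    with ((F (z + h)%C - F z - (A * h + B * Cconj h)) * G z
          + F z * (G (z + h)%C - G z - (A' * h + B' * Cconj h))
          + (F (z + h)%C - F z) * (G (z + h)%C - G z))%C by ring.
  eapply Rle_trans; [apply Cmod_triangle|].
  eapply Rle_trans; [apply Rplus_le_compat_r, Cmod_triangle|].
  rewrite !Cmod_mult.
  assert (X1 : Cmod (F (z + h)%C - F z - (A * h + B * Cconj h)) * Cmod (G z)
     <= eps / 3 * Cmod h).
  { apply Rle_trans with (e1 * Cmod h * Cmod (G z)); [apply Rmult_le_compat_r; lra|].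
    replace (e1 * Cmod h * Cmod (G z)) with (e1 * Cmod (G z) * Cmod h) by ring.
    apply Rmult_le_compat_r; lra. }
  assert (X2 : Cmod (F z) * Cmod (G (z + h)%C - G z - (A' * h + B' * Cconj h))
     <= eps / 3 * Cmod h).
  { apply Rle_trans with (Cmod (F z) * (e2 * Cmod h)); [apply Rmult_le_compat_l; lra|].
    replace (Cmod (F z) * (e2 * Cmod h)) with (e2 * Cmod (F z) * Cmod h) by ring.
    apply Rmult_le_compat_r; lra. }
  assert (X3 : Cmod (F (z + h)%C - F z) * Cmod (G (z + h)%C - G z) <= eps / 3 * Cmod h).
  { apply Rle_trans with ((K * Cmod h) * (L * Cmod h)).
    - apply Rmult_le_compat; try apply Cmod_ge_0; assumption.
    - replace (K * Cmod h * (L * Cmod h)) with (K * L * Cmod h * Cmod h) by ring.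
      apply Rmult_le_compat_r; [lra|].
      apply Rle_trans with (K * L * d5); [apply Rmult_le_compat_l; lra|lra]. }
  lra.
Qed.

Lemma wirtinger_scal (c : C) (F : C -> C) (z A B : C) : wirtinger F z A B ->
  wirtinger (fun w => (c * F w)%C) z (c * A) (c * B).
Proof.
  intros H. assert (H1 := wirtinger_mult _ _ _ _ _ _ _ (wirtinger_const c z) H).
  replace (c * A)%C with (0 * F z + c * A)%C by ring.
  replace (c * B)%C with (0 * F z + c * B)%C by ring. exact H1.
Qed.

Lemma wirtinger_csum (n : nat) (F A B : nat -> C -> C) (z : C) :
  (forall p, (p < n)%nat -> wirtinger (F p) z (A p z) (B p z)) ->
  wirtinger (fun w => csum (fun p => F p w) n) z
    (csum (fun p => A p z) n) (csum (fun p => B p z) n).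
Proof.
  induction n as [|n IH]; intros H; simpl; [apply wirtinger_const|].
  apply wirtinger_plus; [apply IH; intros; apply H; lia|apply H; lia].
Qed.

Lemma wirtinger_conj_pow (z : C) (p : nat) :
  wirtinger (fun w => (Cconj w ^ p)%C) z 0 (RtoC (INR p) * Cconj z ^ pred p).
Proof.
  induction p as [|p IH].
  - replace (RtoC (INR 0) * Cconj z ^ pred 0)%C with (RtoC 0) by (simpl; ring).
    exact (wirtinger_const 1 z).
  - assert (H := wirtinger_mult _ _ _ _ _ _ _ (wirtinger_conj z) IH).
    replace (RtoC (INR (S p)) * Cconj z ^ pred (S p))%C
      with (1 * Cconj z ^ p + Cconj z * (RtoC (INR p) * Cconj z ^ pred p))%C.
    + replace (RtoC 0) with (0 * Cconj z ^ p + Cconj z * 0)%C by ring. exact H.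
    + rewrite S_INR, RtoC_plus. simpl pred. destruct p as [|p]; [simpl; ring|].
      simpl pred. rewrite (Cpow_S _ p). ring.
Qed.

(** The chain rule along a curve. *)
Lemma velocity_comp (F : C -> C) (g : R -> C) (t : R) (l A B : C) :
  wirtinger F (g t) A B -> velocity g t l ->
  velocity (fun s => F (g s)) t (A * l + B * Cconj l).
Proof.
  intros HF Hg eps Heps.
  assert (HA := Cmod_ge_0 A). assert (HB := Cmod_ge_0 B). assert (Hl := Cmod_ge_0 l).
  set (e1 := eps / (2 * (Cmod A + Cmod B + 1))).
  assert (He1 : 0 < e1) by (apply Rdiv_lt_0_compat; lra).
  assert (He1' : (Cmod A + Cmod B) * e1 <= eps / 2).
  { replace (eps / 2) with ((Cmod A + Cmod B + 1) * e1) by (unfold e1; field; lra).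
    apply Rmult_le_compat_r; lra. }
  set (e2 := eps / (2 * (Cmod l + 1))).
  assert (He2 : 0 < e2) by (apply Rdiv_lt_0_compat; lra).
  destruct (HF e2 He2) as [d [Hd Hd']].
  destruct (Hg 1 ltac:(lra)) as [d1 [Hd1 Hd1']].
  destruct (Hg e1 He1) as [d2 [Hd2 Hd2']].
  set (d3 := d / (Cmod l + 1)).
  assert (Hd3 : 0 < d3) by (apply Rdiv_lt_0_compat; lra).
  exists (Rmin (Rmin d1 d2) d3). split; [repeat apply Rmin_pos; lra|]. intros s Hs.
  apply Rmin_Rgt_l in Hs as [Ha Hc]. apply Rmin_Rgt_l in Ha as [Ha Hb].
  apply Rgt_lt in Ha, Hb, Hc. assert (Hs0 := Rabs_pos s).
  specialize (Hd1' s Ha). specialize (Hd2' s Hb).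
  set (h := (g (t + s)%R - g t)%C) in *.
  assert (Hh : Cmod h <= (Cmod l + 1) * Rabs s).
  { assert (X := Cmod_triangle_rev h (l * RtoC s)). rewrite Cmod_mult, Cmod_R in X. lra. }
  assert (Hh' : Cmod h < d).
  { replace d with ((Cmod l + 1) * d3) by (unfold d3; field; lra).
    apply Rle_lt_trans with (1 := Hh). apply Rmult_lt_compat_l; lra. }
  specialize (Hd' h Hh').
  replace (g t + h)%C with (g (t + s)%R) in Hd' by (unfold h; ring).
  replace (F (g (t + s)%R) - F (g t) - (A * l + B * Cconj l) * RtoC s)%C
    with ((F (g (t + s)%R) - F (g t) - (A * h + B * Cconj h))
          + (A * (h - l * RtoC s) + B * Cconj (h - l * RtoC s)))%C.
  2: { rewrite Cminus_conj, Cmult_conj.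
       replace (Cconj (RtoC s)) with (RtoC s)
         by (unfold Cconj, RtoC; simpl; f_equal; ring). ring. }
  eapply Rle_trans; [apply Cmod_triangle|].
  assert (X1 : e2 * Cmod h <= eps / 2 * Rabs s).
  { apply Rle_trans with (e2 * ((Cmod l + 1) * Rabs s)); [apply Rmult_le_compat_l; lra|].
    right. unfold e2. field. lra. }
  assert (X2 := Cmod_triangle (A * (h - l * RtoC s)) (B * Cconj (h - l * RtoC s))).
  rewrite !Cmod_mult, Cmod_conj in X2.
  assert (X3 : (Cmod A + Cmod B) * Cmod (h - l * RtoC s) <= eps / 2 * Rabs s).
  { apply Rle_trans with ((Cmod A + Cmod B) * (e1 * Rabs s)); [apply Rmult_le_compat_l; lra|].
    rewrite <- Rmult_assoc. apply Rmult_le_compat_r; lra. }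
  lra.
Qed.

Lemma velocity_affine (a b : C) (t : R) : velocity (fun s => (a + RtoC s * b)%C) t b.
Proof.
  intros eps Heps. exists 1. split; [lra|]. intros s _. rewrite RtoC_plus.
  replace (a + (RtoC t + RtoC s) * b - (a + RtoC t * b) - b * RtoC s)%C with (RtoC 0) by ring.
  rewrite Cmod_0. apply Rmult_le_pos; [lra|apply Rabs_pos].
Qed.

Lemma velocity_scal_r (g : R -> C) (t : R) (l c : C) : velocity g t l ->
  velocity (fun s => (g s * c)%C) t (l * c).
Proof.
  intros H eps Heps. assert (Hc := Cmod_ge_0 c).
  destruct (H (eps / (Cmod c + 1))) as [d [Hd Hd']]; [apply Rdiv_lt_0_compat; lra|].
  exists d. split; [exact Hd|]. intros s Hs. specialize (Hd' s Hs).
  replace (g (t + s)%R * c - g t * c - l * c * RtoC s)%C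
    with ((g (t + s)%R - g t - l * RtoC s) * c)%C by ring.
  rewrite Cmod_mult.
  apply Rle_trans with (eps / (Cmod c + 1) * Rabs s * (Cmod c + 1)).
  - apply Rmult_le_compat; try apply Cmod_ge_0; lra.
  - right. field. lra.
Qed.

Lemma velocity_add_const (g : R -> C) (t : R) (l c : C) : velocity g t l ->
  velocity (fun s => (c + g s)%C) t l.
Proof.
  intros H eps Heps. destruct (H eps Heps) as [d [Hd Hd']].
  exists d. split; [exact Hd|]. intros s Hs.
  replace (c + g (t + s)%R - (c + g t) - l * RtoC s)%C
    with (g (t + s)%R - g t - l * RtoC s)%C by ring. apply Hd'; exact Hs.
Qed.

Lemma is_derive_of_expansion (f : R -> R) (t l : R) :
  (forall eps, 0 < eps -> exists delta, 0 < delta /\ forall s, Rabs s < delta ->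
     Rabs (f (t + s) - f t - l * s) <= eps * Rabs s) -> is_derive f t l.
Proof.
  intros H. apply is_derive_Reals. intros eps Heps.
  destruct (H (eps / 2) ltac:(lra)) as [d [Hd Hd']].
  exists (mkposreal d Hd). intros s Hs Hsd. simpl in Hsd. specialize (Hd' s Hsd).
  replace ((f (t + s) - f t) / s - l) with ((f (t + s) - f t - l * s) / s) by (field; exact Hs).
  assert (Hs' := Rabs_pos_lt s Hs).
  rewrite Rabs_div by exact Hs.
  apply Rmult_lt_reg_r with (Rabs s); [exact Hs'|].
  replace (Rabs (f (t + s) - f t - l * s) / Rabs s * Rabs s)
    with (Rabs (f (t + s) - f t - l * s)) by (field; lra).
  apply Rle_lt_trans with (1 := Hd'). apply Rmult_lt_compat_r; lra.
Qed.

Lemma velocity_re (g : R -> C) (t : R) (l : C) : velocity g t l ->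
  is_derive (fun s => Re (g s)) t (Re l).
Proof.
  intros H. apply is_derive_of_expansion. intros eps Heps.
  destruct (H eps Heps) as [d [Hd Hd']]. exists d. split; [exact Hd|]. intros s Hs.
  eapply Rle_trans; [|apply (Hd' s Hs)].
  eapply Rle_trans; [|apply re_le_Cmod]. right. f_equal.
  destruct (g (t + s)), (g t), l. simpl. ring.
Qed.

Lemma velocity_im (g : R -> C) (t : R) (l : C) : velocity g t l ->
  is_derive (fun s => Im (g s)) t (Im l).
Proof.
  intros H. apply is_derive_of_expansion. intros eps Heps.
  destruct (H eps Heps) as [d [Hd Hd']]. exists d. split; [exact Hd|]. intros s Hs.
  eapply Rle_trans; [|apply (Hd' s Hs)].
  eapply Rle_trans; [|apply im_le_Cmod]. right. f_equal.
  destruct (g (t + s)), (g t), l. simpl. ring.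
Qed.

Lemma Cpair (x y : R) : ((x, y) : C) = (RtoC 0 + RtoC x * 1 + RtoC y * Ci)%C.
Proof. unfold RtoC, Ci, Cplus, Cmult; simpl; f_equal; ring. Qed.

Lemma wirtinger_dx (F : C -> C) (z A B : C) : wirtinger F z A B ->
  is_derive (fun t => Re (F (t, Im z))) (Re z) (Re (A + B)) /\
  is_derive (fun t => Im (F (t, Im z))) (Re z) (Im (A + B)).
Proof.
  intros H.
  assert (Hv : velocity (fun s => F (s, Im z)) (Re z) (A * 1 + B * Cconj 1)).
  { apply velocity_comp.
    - destruct z; exact H.
    - match goal with |- velocity ?g _ _ => replace g with (fun s => (RtoC (Im z) * Ci + RtoC s * 1)%C) end;
        [apply velocity_affine|].
      apply functional_extensionality. intros s. rewrite Cpair. ring. }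
  replace (A * 1 + B * Cconj 1)%C with (A + B)%C in Hv.
  - split; [apply velocity_re in Hv|apply velocity_im in Hv]; exact Hv.
  - replace (Cconj 1) with (RtoC 1) by (unfold Cconj, RtoC; simpl; f_equal; ring). ring.
Qed.

Lemma wirtinger_dy (F : C -> C) (z A B : C) : wirtinger F z A B ->
  is_derive (fun t => Re (F (Re z, t))) (Im z) (Re (Ci * (A - B))) /\
  is_derive (fun t => Im (F (Re z, t))) (Im z) (Im (Ci * (A - B))).
Proof.
  intros H.
  assert (Hv : velocity (fun s => F (Re z, s)) (Im z) (A * Ci + B * Cconj Ci)).
  { apply velocity_comp.
    - destruct z; exact H.
    - match goal with |- velocity ?g _ _ => replace g with (fun s => (RtoC (Re z) + RtoC s * Ci)%C) end;
        [apply velocity_affine|].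
      apply functional_extensionality. intros s. rewrite Cpair. ring. }
  replace (A * Ci + B * Cconj Ci)%C with (Ci * (A - B))%C in Hv.
  - split; [apply velocity_re in Hv|apply velocity_im in Hv]; exact Hv.
  - replace (Cconj Ci) with (- Ci)%C by (unfold Cconj, Ci, Copp; simpl; f_equal; ring). ring.
Qed.

Lemma dx_wirtinger (F : C -> C) (z A B : C) : wirtinger F z A B -> dx F z = (A + B)%C.
Proof.
  intros H. destruct (wirtinger_dx F z A B H) as [H1 H2]. unfold dx.
  apply injective_projections; [exact (is_derive_unique _ _ _ H1)|].
  exact (is_derive_unique _ _ _ H2).
Qed.

Lemma dy_wirtinger (F : C -> C) (z A B : C) : wirtinger F z A B ->
  dy F z = (Ci * (A - B))%C.
Proof.
  intros H. destruct (wirtinger_dy F z A B H) as [H1 H2]. unfold dy.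
  apply injective_projections; [exact (is_derive_unique _ _ _ H1)|].
  exact (is_derive_unique _ _ _ H2).
Qed.

Lemma ex_dx_wirtinger (F : C -> C) (z A B : C) : wirtinger F z A B -> ex_dx F z.
Proof. intros H. destruct (wirtinger_dx F z A B H). split; eexists; eassumption. Qed.

Lemma ex_dy_wirtinger (F : C -> C) (z A B : C) : wirtinger F z A B -> ex_dy F z.
Proof. intros H. destruct (wirtinger_dy F z A B H). split; eexists; eassumption. Qed.

Lemma RtoC_m1 : RtoC (-1) = (- (1))%C.
Proof. unfold RtoC, Copp; simpl; f_equal; ring. Qed.

Lemma Ci_sqr : (Ci * Ci)%C = (- (1))%C.
Proof. unfold Ci, RtoC, Cmult, Copp; simpl; f_equal; ring. Qed.

Lemma dbar_wirtinger (F : C -> C) (z A B : C) : wirtinger F z A B -> dbar F z = B.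
Proof.
  intros H. unfold dbar. rewrite (dx_wirtinger F z A B H), (dy_wirtinger F z A B H).
  replace (RtoC (1 / 2) * (A + B + Ci * (Ci * (A - B))))%C
    with (RtoC (1 / 2) * (A + B + (Ci * Ci) * (A - B)))%C by ring.
  rewrite Ci_sqr. replace (RtoC (1 / 2)) with (/ 2)%C.
  - field. 
  - rewrite RtoC_div by lra. unfold Cdiv. ring.
Qed.

(** * Continuity in terms of the modulus *)

Lemma ball_Cmod (z w : C) (e : R) : Cmod (w - z) < e -> ball z e w.
Proof. apply C_NormedModule_mixin_compat1. Qed.

Lemma Cmod_ball (z w : C) (e : R) : ball z e w -> Cmod (w - z) < 2 * e.
Proof.
  intros [H1 H2]. change (Rabs (fst w - fst z) < e) in H1. change (Rabs (snd w - snd z) < e) in H2.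
  eapply Rle_lt_trans; [apply Cmod_le_re_im|].
  change (Rabs (fst w - fst z) + Rabs (snd w - snd z) < 2 * e). lra.
Qed.

Lemma continuous_on_Cmod (D : C -> Prop) (f : C -> C) :
  continuous_on D f <->
  (forall z, D z -> forall eps, 0 < eps -> exists delta, 0 < delta /\
     forall w, D w -> Cmod (w - z) < delta -> Cmod (f w - f z) < eps).
Proof.
  split.
  - intros H z Hz eps Heps.
    assert (H1 := H z Hz (fun y => Cmod (y - f z) < eps)).
    destruct H1 as [d Hd].
    + exists (mkposreal (eps / 2) ltac:(lra)). intros y Hy. simpl in Hy.
      apply Cmod_ball in Hy. lra.
    + exists d. split; [apply cond_pos|]. intros w Hw Hwz.
      apply (Hd w); [apply ball_Cmod; exact Hwz|exact Hw].
  - intros H z Hz P [e He].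
    destruct (H z Hz e (cond_pos e)) as [d [Hd Hd']].
    exists (mkposreal (d / 2) ltac:(lra)). intros w Hw HDw. simpl in Hw.
    apply He. apply ball_Cmod. apply Hd'; [exact HDw|].
    apply Cmod_ball in Hw. lra.
Qed.

Lemma wirtinger_cont (F : C -> C) (z A B : C) : wirtinger F z A B ->
  forall eps, 0 < eps -> exists delta, 0 < delta /\
    forall w, Cmod (w - z) < delta -> Cmod (F w - F z) < eps.
Proof.
  intros H eps Heps. destruct (wirtinger_lip F z A B H) as [d [K [Hd [HK HK']]]].
  assert (Hp : 0 < eps / (K + 1)) by (apply Rdiv_lt_0_compat; lra).
  exists (Rmin d (eps / (K + 1))). split; [apply Rmin_pos; assumption|]. intros w Hw.
  apply Rmin_Rgt_l in Hw as [H1 H2]. apply Rgt_lt in H1, H2.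
  specialize (HK' (w - z)%C H1). replace (z + (w - z))%C with w in HK' by ring.
  apply Rle_lt_trans with (1 := HK').
  apply Rle_lt_trans with ((K + 1) * Cmod (w - z)).
  - apply Rmult_le_compat_r; [apply Cmod_ge_0|lra].
  - replace eps with ((K + 1) * (eps / (K + 1))) by (field; lra).
    apply Rmult_lt_compat_l; lra.
Qed.

Lemma continuous_on_disc_wirtinger (F : C -> C) (A B : C -> C) :
  (forall z, disc z -> wirtinger F z (A z) (B z)) -> continuous_on disc F.
Proof.
  intros H. apply continuous_on_Cmod. intros z Hz eps Heps.
  destruct (wirtinger_cont F z _ _ (H z Hz) eps Heps) as [d [Hd Hd']].
  exists d. split; [exact Hd|]. intros w _ Hw. apply Hd'; exact Hw.
Qed.

Lemma continuous_on_disc_at (F : C -> C) (z : C) : continuous_on disc F -> disc z ->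
  forall eps, 0 < eps -> exists delta, 0 < delta /\
    forall w, Cmod (w - z) < delta -> Cmod (F w - F z) < eps.
Proof.
  intros H Hz eps Heps. assert (Hp := disc_radius_pos z Hz).
  destruct (proj1 (continuous_on_Cmod disc F) H z Hz eps Heps) as [d [Hd Hd']].
  exists (Rmin d (1 - Cmod z)). split; [apply Rmin_pos; lra|]. intros w Hw.
  apply Rmin_Rgt_l in Hw as [H1 H2]. apply Hd'; [|lra].
  replace w with (z + (w - z))%C by ring. apply disc_shift. lra.
Qed.

(** * Power series are differentiable *)

Lemma Cpow_expansion (z h : C) (Q : R) (j : nat) : 0 < Q -> Cmod z <= Q -> Cmod (z + h) <= Q ->
  Q ^ 2 * Cmod ((z + h) ^ j - z ^ j - RtoC (INR j) * z ^ pred j * h)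
    <= INR j ^ 2 * Q ^ j * Cmod h ^ 2.
Proof.
  intros HQ Hz Hzh. assert (Hh := Cmod_ge_0 h).
  assert (Hh2 : 0 <= Cmod h ^ 2) by (apply pow_le; exact Hh).
  assert (HQ2 : 0 < Q ^ 2) by (apply pow_lt; exact HQ).
  induction j as [|j IH].
  - simpl INR. replace ((z + h) ^ 0 - z ^ 0 - RtoC 0 * z ^ pred 0 * h)%C with (RtoC 0)
      by (simpl; ring).
    rewrite Cmod_0. simpl. lra.
  - replace ((z + h) ^ S j - z ^ S j - RtoC (INR (S j)) * z ^ pred (S j) * h)%C
      with ((z + h) * ((z + h) ^ j - z ^ j - RtoC (INR j) * z ^ pred j * h)
            + RtoC (INR j) * z ^ pred j * h ^ 2)%C.
    2: { rewrite S_INR, RtoC_plus. destruct j as [|j]; simpl pred; rewrite ?Cpow_S; simpl; ring. }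
    assert (HQj : 0 < Q ^ j) by (apply pow_lt; exact HQ).
    assert (Hj := pos_INR j).
    apply Rle_trans with (Q * (INR j ^ 2 * Q ^ j * Cmod h ^ 2) + INR j * (Q ^ S j) * Cmod h ^ 2).
    + apply Rle_trans with (Q ^ 2 * (Q * Cmod ((z + h) ^ j - z ^ j - RtoC (INR j) * z ^ pred j * h)
         + INR j * Q ^ pred j * Cmod h ^ 2)).
      * apply Rmult_le_compat_l; [lra|]. eapply Rle_trans; [apply Cmod_triangle|].
        rewrite !Cmod_mult, !Cmod_pow, Cmod_R, (Rabs_pos_eq _ Hj).
        apply Rplus_le_compat.
        -- apply Rmult_le_compat_r; [apply Cmod_ge_0|exact Hzh].
        -- apply Rmult_le_compat_r; [exact Hh2|]. apply Rmult_le_compat_l; [exact Hj|].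
           apply pow_incr. split; [apply Cmod_ge_0|exact Hz].
      * rewrite Rmult_plus_distr_l. apply Rplus_le_compat.
        -- replace (Q ^ 2 * (Q * Cmod ((z + h) ^ j - z ^ j - RtoC (INR j) * z ^ pred j * h)))
             with (Q * (Q ^ 2 * Cmod ((z + h) ^ j - z ^ j - RtoC (INR j) * z ^ pred j * h))) by ring.
           apply Rmult_le_compat_l; [lra|exact IH].
        -- right. destruct j as [|j]; simpl; ring.
    + rewrite S_INR. simpl (Q ^ S j).
      assert (X : 0 <= Q * Q ^ j * Cmod h ^ 2).
      { apply Rmult_le_pos; [|exact Hh2]. apply Rmult_le_pos; lra. }
      replace (Q * (INR j ^ 2 * Q ^ j * Cmod h ^ 2) + INR j * (Q * Q ^ j) * Cmod h ^ 2)
        with ((INR j ^ 2 + INR j) * (Q * Q ^ j * Cmod h ^ 2)) by ring.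
      replace ((INR j + 1) ^ 2 * (Q * Q ^ j) * Cmod h ^ 2)
        with ((INR j + 1) ^ 2 * (Q * Q ^ j * Cmod h ^ 2)) by ring.
      apply Rmult_le_compat_r; [exact X|]. nra.
Qed.

Lemma csum_geom_le (u : nat -> C) (K q : R) (n : nat) : 0 <= q < 1 ->
  (forall j, Cmod (u j) <= K * q ^ j) -> Cmod (csum u n) <= K / (1 - q).
Proof.
  intros Hq H.
  assert (HK : 0 <= K).
  { specialize (H O). simpl in H. assert (X := Cmod_ge_0 (u O)). lra. }
  assert (T := csum_telescope u (fun j => K / (1 - q) * q ^ j)).
  assert (T' : forall j, Cmod (u j) <= K / (1 - q) * q ^ j - K / (1 - q) * q ^ S j).
  { intros j. replace (K / (1 - q) * q ^ j - K / (1 - q) * q ^ S j) with (K * q ^ j)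
      by (simpl; field; lra). apply H. }
  specialize (T T' O n). simpl in T.
  replace (csum u n - 0)%C with (csum u n) in T by ring.
  assert (0 <= K / (1 - q) * q ^ n).
  { apply Rmult_le_pos; [|apply pow_le; lra].
    apply Rmult_le_pos; [lra|left; apply Rinv_0_lt_compat; lra]. }
  lra.
Qed.

Lemma wirtinger_PS (b : nat -> C) (z : C) : rad1 b -> disc z ->
  wirtinger (PS b) z (PS (dcoef b) z) 0.
Proof.
  intros Hb Hz eps Heps. unfold disc in Hz. assert (Hz0 := Cmod_ge_0 z).
  set (Q := (1 + Cmod z) / 2). set (r := (1 + Q) / 2).
  assert (HQ : 0 < Q < 1 /\ Cmod z < Q) by (unfold Q; lra).
  assert (Hr : Q < r < 1) by (unfold r; lra).
  destruct (rad1_mul_INR _ (rad1_mul_INR b Hb) r ltac:(lra)) as [M [HM HM']].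
  set (q := Q / r).
  assert (Hq : 0 <= q < 1).
  { unfold q; split; [apply Rlt_le, Rdiv_lt_0_compat; lra|].
    apply Rmult_lt_reg_r with r; [lra|]. unfold Rdiv. rewrite Rmult_assoc, Rinv_l; lra. }
  set (K := M / Q ^ 2 / (1 - q)).
  assert (HQ2 : 0 < Q ^ 2) by (apply pow_lt; lra).
  assert (HK : 0 <= K).
  { unfold K, Rdiv. repeat apply Rmult_le_pos; try lra; left; apply Rinv_0_lt_compat; lra. }
  assert (Hmain : forall h, Cmod h < Q - Cmod z ->
    Cmod (PS b (z + h)%C - PS b z - (PS (dcoef b) z * h + 0 * Cconj h)) <= K * Cmod h ^ 2).
  { intros h Hh.
    assert (Hzh : Cmod (z + h) <= Q) by (assert (X := Cmod_triangle z h); lra).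
    assert (H1 := clim_incr _ _ (PS_clim b (z + h)%C Hb ltac:(unfold disc; lra))).
    assert (H2 := clim_incr _ _ (PS_clim b z Hb ltac:(unfold disc; lra))).
    assert (H3 := PS_clim _ z (rad1_dcoef b Hb) ltac:(unfold disc; lra)).
    assert (H4 := clim_plus _ _ _ _ (clim_plus _ _ _ _ H1 (clim_scal (-1) _ _ H2)) (clim_scal (- h) _ _ H3)).
    assert (H5 := clim_le_const _ _ (RtoC 0) (K * Cmod h ^ 2) H4).
    replace (PS b (z + h)%C - PS b z - (PS (dcoef b) z * h + 0 * Cconj h))%C
      with (PS b (z + h)%C + -1 * PS b z + - h * PS (dcoef b) z - 0)%C.
    2: { rewrite RtoC_m1. ring. }
    apply H5. intros n.
    replace (csum (fun j => (b j * (z + h) ^ j)%C) (S n) + -1 * csum (fun j => (b j * z ^ j)%C) (S n)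
             + - h * csum (fun j => (dcoef b j * z ^ j)%C) n - 0)%C
      with (csum (fun j => (b j * ((z + h) ^ j - z ^ j - RtoC (INR j) * z ^ pred j * h))%C) (S n)).
    2: { replace (csum (fun j => (dcoef b j * z ^ j)%C) n)
           with (csum (fun j => (RtoC (INR j) * b j * z ^ pred j)%C) (S n)).
         - rewrite <- !csum_scal, <- !csum_plus.
           rewrite (csum_ext _ (fun j => (b j * (z + h) ^ j + -1 * (b j * z ^ j) + - h * (RtoC (INR j) * b j * z ^ pred j))%C)).
           + ring.
           + intros j _. rewrite RtoC_m1. ring.
         - rewrite csum_shift. simpl INR. simpl pred.
           replace (RtoC 0 * b O * z ^ 0)%C with (RtoC 0) by ring. rewrite Cplus_0_l.
           reflexivity. }
    replace (K * Cmod h ^ 2) with (M / Q ^ 2 * Cmod h ^ 2 / (1 - q)) by (unfold K; field; lra).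
    apply csum_geom_le; [exact Hq|]. intros j.
    assert (E := Cpow_expansion z h Q j ltac:(lra) ltac:(lra) Hzh).
    specialize (HM' j). rewrite !Cmod_mult, !Cmod_R, (Rabs_pos_eq _ (pos_INR j)) in HM'.
    rewrite Cmod_mult.
    apply Rmult_le_reg_l with (Q ^ 2); [exact HQ2|].
    apply Rle_trans with (Cmod (b j) * (INR j ^ 2 * Q ^ j * Cmod h ^ 2)).
    - rewrite <- Rmult_assoc, (Rmult_comm (Q ^ 2)), Rmult_assoc.
      apply Rmult_le_compat_l; [apply Cmod_ge_0|exact E].
    - replace (Q ^ 2 * (M / Q ^ 2 * Cmod h ^ 2 * q ^ j)) with (M * (q ^ j * Cmod h ^ 2)) by (field; lra).
      assert (Eq : Q ^ j = q ^ j * r ^ j).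
      { rewrite <- Rpow_mult_distr. f_equal. unfold q. field. lra. }
      rewrite Eq.
      replace (Cmod (b j) * (INR j ^ 2 * (q ^ j * r ^ j) * Cmod h ^ 2))
        with (INR j * (INR j * Cmod (b j)) * r ^ j * (q ^ j * Cmod h ^ 2)) by ring.
      apply Rmult_le_compat_r; [|exact HM'].
      apply Rmult_le_pos; apply pow_le; [lra|apply Cmod_ge_0]. }
  assert (Hp : 0 < eps / (K + 1)) by (apply Rdiv_lt_0_compat; lra).
  exists (Rmin (Q - Cmod z) (eps / (K + 1))). split; [apply Rmin_pos; lra|].
  intros h Hh. apply Rmin_Rgt_l in Hh as [Ha Hb']. assert (Hh0 := Cmod_ge_0 h).
  eapply Rle_trans; [apply Hmain; lra|].
  simpl (Cmod h ^ 2). rewrite Rmult_1_r, <- Rmult_assoc. apply Rmult_le_compat_r; [exact Hh0|].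
  apply Rle_trans with ((K + 1) * (eps / (K + 1))).
  - apply Rmult_le_compat; lra.
  - right. field. lra.
Qed.

(** * Polyanalytic series *)

(** An array [a p j] of coefficients stands for the polyanalytic series with
    terms [a p j * z ^ j * (conj z) ^ p], for [p <= K]; it is admissible when
    each of its rows defines a power series of radius at least one and the rows
    after the [K]-th one vanish. *)
Definition admissible (K : nat) (a : nat -> nat -> C) : Prop :=
  (forall p, rad1 (a p)) /\ forall p j, (K < p)%nat -> a p j = RtoC 0.

(** The sum of the polyanalytic series. *)
Definition polyseries (K : nat) (a : nat -> nat -> C) (z : C) : C :=
  csum (fun p => (Cconj z ^ p * PS (a p) z)%C) (S K).

Definition arr_add (a b : nat -> nat -> C) : nat -> nat -> C :=
  fun p j => (a p j + b p j)%C.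
Definition arr_scal (c : C) (a : nat -> nat -> C) : nat -> nat -> C :=
  fun p j => (c * a p j)%C.

(** The derivatives with respect to z and to the conjugate of z, and the partial
    derivatives in x and y, as operators on arrays of coefficients. *)
Definition arr_dz (a : nat -> nat -> C) : nat -> nat -> C := fun p => dcoef (a p).
Definition arr_dzbar (a : nat -> nat -> C) : nat -> nat -> C :=
  fun p j => (RtoC (INR (S p)) * a (S p) j)%C.
Definition arr_dx (a : nat -> nat -> C) : nat -> nat -> C :=
  arr_add (arr_dz a) (arr_dzbar a).
Definition arr_dy (a : nat -> nat -> C) : nat -> nat -> C :=
  arr_scal Ci (arr_add (arr_dz a) (arr_scal (-1) (arr_dzbar a))).

Lemma arr_ext (a b : nat -> nat -> C) : (forall p j, a p j = b p j) -> a = b.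
Proof.
  intros H. apply functional_extensionality. intros p.
  apply functional_extensionality. intros j. apply H.
Qed.

Lemma admissible_add (K : nat) (a b : nat -> nat -> C) :
  admissible K a -> admissible K b -> admissible K (arr_add a b).
Proof.
  intros [Ha Ha'] [Hb Hb']. split.
  - intros p. apply rad1_plus; auto.
  - intros p j Hp. unfold arr_add. rewrite Ha', Hb' by exact Hp. ring.
Qed.

Lemma admissible_scal (K : nat) (c : C) (a : nat -> nat -> C) :
  admissible K a -> admissible K (arr_scal c a).
Proof.
  intros [Ha Ha']. split.
  - intros p. apply rad1_scal; auto.
  - intros p j Hp. unfold arr_scal. rewrite Ha' by exact Hp. ring.
Qed.

Lemma admissible_dz (K : nat) (a : nat -> nat -> C) :
  admissible K a -> admissible K (arr_dz a).
Proof.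
  intros [Ha Ha']. split.
  - intros p. apply rad1_dcoef; auto.
  - intros p j Hp. unfold arr_dz, dcoef. rewrite Ha' by exact Hp. ring.
Qed.

Lemma admissible_dzbar (K : nat) (a : nat -> nat -> C) :
  admissible K a -> admissible K (arr_dzbar a).
Proof.
  intros [Ha Ha']. split.
  - intros p. apply (rad1_scal (RtoC (INR (S p))) (a (S p))). apply Ha.
  - intros p j Hp. unfold arr_dzbar. rewrite Ha' by lia. ring.
Qed.

Lemma admissible_dx (K : nat) (a : nat -> nat -> C) :
  admissible K a -> admissible K (arr_dx a).
Proof.
  intros H. apply admissible_add; [apply admissible_dz|apply admissible_dzbar]; exact H.
Qed.

Lemma admissible_dy (K : nat) (a : nat -> nat -> C) :
  admissible K a -> admissible K (arr_dy a).
Proof.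
  intros H. apply admissible_scal, admissible_add; [apply admissible_dz; exact H|].
  apply admissible_scal, admissible_dzbar. exact H.
Qed.

Lemma admissible_iter (K : nat) (o : (nat -> nat -> C) -> nat -> nat -> C) (n : nat)
  (a : nat -> nat -> C) : (forall b, admissible K b -> admissible K (o b)) ->
  admissible K a -> admissible K (Nat.iter n o a).
Proof. intros Ho Ha. induction n as [|n IH]; simpl; auto. Qed.

Lemma polyseries_add (K : nat) (a b : nat -> nat -> C) (z : C) :
  admissible K a -> admissible K b -> disc z ->
  polyseries K (arr_add a b) z = (polyseries K a z + polyseries K b z)%C.
Proof.
  intros [Ha _] [Hb _] Hz. unfold polyseries. rewrite <- csum_plus.
  apply csum_ext. intros p _. unfold arr_add.
  rewrite (PS_plus (a p) (b p) z (Ha p) (Hb p) Hz). ring.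
Qed.

Lemma polyseries_scal (K : nat) (c : C) (a : nat -> nat -> C) (z : C) :
  admissible K a -> disc z ->
  polyseries K (arr_scal c a) z = (c * polyseries K a z)%C.
Proof.
  intros [Ha _] Hz. unfold polyseries. rewrite <- csum_scal.
  apply csum_ext. intros p _. unfold arr_scal.
  rewrite (PS_scal c (a p) z (Ha p) Hz). ring.
Qed.

Lemma polyseries_zero (K : nat) (z : C) : polyseries K (fun _ _ => RtoC 0) z = RtoC 0.
Proof.
  unfold polyseries. rewrite (csum_ext _ (fun _ => RtoC 0)).
  - apply csum_zero.
  - intros p _. rewrite PS_zero. ring.
Qed.

(** The summation by parts behind the formula for the derivative with respect to
    the conjugate of z. *)
Lemma csum_conj_shift (z : C) (g : nat -> C) (n : nat) :
  csum (fun p => (RtoC (INR p) * Cconj z ^ pred p * g p)%C) n =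
  (csum (fun p => (Cconj z ^ p * (RtoC (INR (S p)) * g (S p)))%C) n
   - RtoC (INR n) * Cconj z ^ pred n * g n)%C.
Proof.
  induction n as [|n IH].
  - simpl. ring.
  - rewrite !csum_S, IH. cbn [Nat.pred]. ring.
Qed.

Lemma wirtinger_polyseries (K : nat) (a : nat -> nat -> C) (z : C) :
  admissible K a -> disc z ->
  wirtinger (polyseries K a) z (polyseries K (arr_dz a) z) (polyseries K (arr_dzbar a) z).
Proof.
  intros [Ha Ha'] Hz.
  assert (H : wirtinger (polyseries K a) z
    (csum (fun p => (0 * PS (a p) z + Cconj z ^ p * PS (dcoef (a p)) z)%C) (S K))
    (csum (fun p => (RtoC (INR p) * Cconj z ^ pred p * PS (a p) z + Cconj z ^ p * 0)%C) (S K))).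
  { apply (wirtinger_csum (S K) (fun p w => (Cconj w ^ p * PS (a p) w)%C)
      (fun p z => (0 * PS (a p) z + Cconj z ^ p * PS (dcoef (a p)) z)%C)
      (fun p z => (RtoC (INR p) * Cconj z ^ pred p * PS (a p) z + Cconj z ^ p * 0)%C)).
    intros p _. apply wirtinger_mult; [apply wirtinger_conj_pow|].
    apply wirtinger_PS; auto. }
  replace (polyseries K (arr_dz a) z) with
    (csum (fun p => (0 * PS (a p) z + Cconj z ^ p * PS (dcoef (a p)) z)%C) (S K)).
  2: { apply csum_ext. intros p _. unfold arr_dz. ring. }
  replace (polyseries K (arr_dzbar a) z) with
    (csum (fun p => (RtoC (INR p) * Cconj z ^ pred p * PS (a p) z + Cconj z ^ p * 0)%C) (S K)).
  - exact H.
  - rewrite (csum_ext _ (fun p => (RtoC (INR p) * Cconj z ^ pred p * PS (a p) z)%C))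
      by (intros; ring).
    rewrite (csum_conj_shift z (fun p => PS (a p) z)).
    replace (PS (a (S K)) z) with (RtoC 0).
    + replace (RtoC (INR (S K)) * Cconj z ^ pred (S K) * 0)%C with (RtoC 0) by ring.
      unfold polyseries.
      rewrite (csum_ext _ (fun p => (Cconj z ^ p * PS (arr_dzbar a p) z)%C)).
      * ring.
      * intros p _. unfold arr_dzbar. rewrite (PS_scal _ (a (S p)) z); auto.
    + rewrite <- (PS_zero z). f_equal. apply functional_extensionality. intros j.
      symmetry. apply Ha'. lia.
Qed.

Lemma dx_polyseries (K : nat) (a : nat -> nat -> C) (z : C) : admissible K a -> disc z ->
  dx (polyseries K a) z = polyseries K (arr_dx a) z.
Proof.
  intros Ha Hz. rewrite (dx_wirtinger _ _ _ _ (wirtinger_polyseries K a z Ha Hz)).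
  unfold arr_dx. rewrite polyseries_add; auto using admissible_dz, admissible_dzbar.
Qed.

Lemma dy_polyseries (K : nat) (a : nat -> nat -> C) (z : C) : admissible K a -> disc z ->
  dy (polyseries K a) z = polyseries K (arr_dy a) z.
Proof.
  intros Ha Hz. rewrite (dy_wirtinger _ _ _ _ (wirtinger_polyseries K a z Ha Hz)).
  unfold arr_dy. assert (H1 := admissible_dz K a Ha). assert (H2 := admissible_dzbar K a Ha).
  rewrite polyseries_scal, polyseries_add, polyseries_scal;
    auto using admissible_add, admissible_scal.
  rewrite RtoC_m1. ring.
Qed.

Lemma dbar_polyseries (K : nat) (a : nat -> nat -> C) (z : C) : admissible K a -> disc z ->
  dbar (polyseries K a) z = polyseries K (arr_dzbar a) z.
Proof.
  intros Ha Hz. apply (dbar_wirtinger _ _ _ _ (wirtinger_polyseries K a z Ha Hz)).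
Qed.

(** * Locality of the derivatives *)

Lemma ball_disc_re (z : C) : disc z -> locally (Re z) (fun t => disc (t, Im z)).
Proof.
  intros Hz. exists (mkposreal _ (disc_radius_pos z Hz)). intros t Ht.
  change (Rabs (t - Re z) < 1 - Cmod z) in Ht.
  replace ((t, Im z) : C) with (z + RtoC (t - Re z))%C
    by (destruct z; unfold Cplus, RtoC; simpl; f_equal; ring).
  apply disc_shift. rewrite Cmod_R. exact Ht.
Qed.

Lemma ball_disc_im (z : C) : disc z -> locally (Im z) (fun t => disc (Re z, t)).
Proof.
  intros Hz. exists (mkposreal _ (disc_radius_pos z Hz)). intros t Ht.
  change (Rabs (t - Im z) < 1 - Cmod z) in Ht.
  replace ((Re z, t) : C) with (z + RtoC (t - Im z) * Ci)%C
    by (destruct z; unfold Cplus, Cmult, Ci, RtoC; simpl; f_equal; ring).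
  apply disc_shift. rewrite Cmod_mult, Cmod_Ci, Cmod_R. lra.
Qed.

Section Locality.
Variables F G : C -> C.
Hypothesis FG : forall w, disc w -> F w = G w.

Lemma dx_ext_disc (z : C) : disc z -> dx F z = dx G z.
Proof.
  intros Hz. unfold dx. f_equal; apply Derive_ext_loc;
    (eapply filter_imp; [|apply ball_disc_re, Hz]); intros t Ht; rewrite FG by exact Ht; reflexivity.
Qed.

Lemma dy_ext_disc (z : C) : disc z -> dy F z = dy G z.
Proof.
  intros Hz. unfold dy. f_equal; apply Derive_ext_loc;
    (eapply filter_imp; [|apply ball_disc_im, Hz]); intros t Ht; rewrite FG by exact Ht; reflexivity.
Qed.

Lemma dbar_ext_disc (z : C) : disc z -> dbar F z = dbar G z.
Proof. intros Hz. unfold dbar. rewrite dx_ext_disc, dy_ext_disc by exact Hz. reflexivity. Qed.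

Lemma ex_dx_ext_disc (z : C) : disc z -> ex_dx F z -> ex_dx G z.
Proof.
  intros Hz [H1 H2]. split; [eapply ex_derive_ext_loc; [|exact H1]|eapply ex_derive_ext_loc; [|exact H2]];
    (eapply filter_imp; [|apply ball_disc_re, Hz]); intros t Ht; simpl; rewrite FG by exact Ht; reflexivity.
Qed.

Lemma ex_dy_ext_disc (z : C) : disc z -> ex_dy F z -> ex_dy G z.
Proof.
  intros Hz [H1 H2]. split; [eapply ex_derive_ext_loc; [|exact H1]|eapply ex_derive_ext_loc; [|exact H2]];
    (eapply filter_imp; [|apply ball_disc_im, Hz]); intros t Ht; simpl; rewrite FG by exact Ht; reflexivity.
Qed.

Lemma continuous_on_ext_disc : continuous_on disc F -> continuous_on disc G.
Proof.
  intros H. apply continuous_on_Cmod. intros z Hz eps Heps.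
  destruct (proj1 (continuous_on_Cmod disc F) H z Hz eps Heps) as [d [Hd Hd']].
  exists d. split; [exact Hd|]. intros w Hw Hwz. rewrite <- !FG by assumption.
  apply Hd'; assumption.
Qed.
End Locality.

Lemma class_C_ext_disc (n : nat) : forall F G : C -> C,
  (forall w, disc w -> F w = G w) -> class_C n F -> class_C n G.
Proof.
  induction n as [|n IH]; intros F G H [Hc Hd].
  - split; [apply (continuous_on_ext_disc F G H Hc)|exact I].
  - destruct Hd as [Hd [Hx Hy]].
    split; [apply (continuous_on_ext_disc F G H Hc)|split; [|split]].
    + intros z Hz. destruct (Hd z Hz) as [H1 H2].
      split; [apply (ex_dx_ext_disc F G H z Hz H1)|apply (ex_dy_ext_disc F G H z Hz H2)].
    + apply (IH (dx F)); [|exact Hx]. intros w Hw. apply (dx_ext_disc F G H w Hw).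
    + apply (IH (dy F)); [|exact Hy]. intros w Hw. apply (dy_ext_disc F G H w Hw).
Qed.

(** A differential operator that acts on polyanalytic series through their
    arrays of coefficients can be iterated. *)
Lemma iter_polyseries (K : nat) (op : (C -> C) -> C -> C)
  (o : (nat -> nat -> C) -> nat -> nat -> C) :
  (forall F G, (forall w, disc w -> F w = G w) -> forall z, disc z -> op F z = op G z) ->
  (forall a, admissible K a -> admissible K (o a)) ->
  (forall a z, admissible K a -> disc z -> op (polyseries K a) z = polyseries K (o a) z) ->
  forall n a F, admissible K a -> (forall w, disc w -> F w = polyseries K a w) ->
  forall z, disc z -> Nat.iter n op F z = polyseries K (Nat.iter n o a) z.
Proof.
  intros Hext Hadm Hop n. induction n as [|n IH]; intros a F Ha HF z Hz; simpl; [auto|].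
  rewrite (Hext _ (polyseries K (Nat.iter n o a))); [|intros; apply IH; assumption|exact Hz].
  apply Hop; [apply admissible_iter; assumption|exact Hz].
Qed.

Lemma Dpart_polyseries (K a1 a2 : nat) (a : nat -> nat -> C) (F : C -> C) :
  admissible K a -> (forall w, disc w -> F w = polyseries K a w) ->
  forall z, disc z ->
  Dpart a1 a2 F z = polyseries K (Nat.iter a1 arr_dx (Nat.iter a2 arr_dy a)) z.
Proof.
  intros Ha HF. unfold Dpart.
  apply (iter_polyseries K dx arr_dx dx_ext_disc (admissible_dx K)).
  - intros; apply dx_polyseries; assumption.
  - apply admissible_iter; [apply admissible_dy|exact Ha].
  - apply (iter_polyseries K dy arr_dy dy_ext_disc (admissible_dy K)); try assumption.
    intros; apply dy_polyseries; assumption.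
Qed.

Lemma class_C_polyseries (K n : nat) : forall a, admissible K a -> class_C n (polyseries K a).
Proof.
  induction n as [|n IH]; intros a Ha.
  - split; [|exact I].
    apply (continuous_on_disc_wirtinger _ (polyseries K (arr_dz a)) (polyseries K (arr_dzbar a))).
    intros z Hz. apply wirtinger_polyseries; assumption.
  - split; [|split; [|split]].
    + apply (continuous_on_disc_wirtinger _ (polyseries K (arr_dz a)) (polyseries K (arr_dzbar a))).
      intros z Hz. apply wirtinger_polyseries; assumption.
    + intros z Hz. assert (H := wirtinger_polyseries K a z Ha Hz).
      split; [eapply ex_dx_wirtinger|eapply ex_dy_wirtinger]; exact H.
    + apply (class_C_ext_disc n (polyseries K (arr_dx a))).
      * intros w Hw. symmetry. apply dx_polyseries; assumption.
      * apply IH, admissible_dx, Ha.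
    + apply (class_C_ext_disc n (polyseries K (arr_dy a))).
      * intros w Hw. symmetry. apply dy_polyseries; assumption.
      * apply IH, admissible_dy, Ha.
Qed.

Lemma iter_arr_dzbar_zero (K n : nat) (a : nat -> nat -> C) : admissible K a ->
  forall p j, (K < p + n)%nat -> Nat.iter n arr_dzbar a p j = RtoC 0.
Proof.
  intros [_ Ha]. induction n as [|n IH]; intros p j Hp; simpl.
  - apply Ha. lia.
  - unfold arr_dzbar at 1. rewrite IH by lia. ring.
Qed.

Lemma polyanalytic_polyseries (K : nat) (a : nat -> nat -> C) (F : C -> C) :
  admissible K a -> (forall w, disc w -> F w = polyseries K a w) -> polyanalytic (S K) F.
Proof.
  intros Ha HF. split.
  - apply (class_C_ext_disc _ (polyseries K a)); [intros; symmetry; auto|].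
    apply class_C_polyseries; exact Ha.
  - intros z Hz.
    rewrite (iter_polyseries K dbar arr_dzbar dbar_ext_disc (admissible_dzbar K)
      (fun b w Hb Hw => dbar_polyseries K b w Hb Hw) (S K) a F Ha HF z Hz).
    replace (Nat.iter (S K) arr_dzbar a) with (fun _ _ : nat => RtoC 0).
    + apply polyseries_zero.
    + apply arr_ext. intros p j. symmetry. apply (iter_arr_dzbar_zero K); [exact Ha|lia].
Qed.

Lemma polyseries_bound (K : nat) (a : nat -> nat -> C) (z : C) (r M : R) :
  disc z -> 0 < r -> Cmod z < r -> (forall p j, Cmod (a p j) * r ^ j <= M) ->
  Cmod (polyseries K a z) <= INR (S K) * (M / (1 - Cmod z / r)).
Proof.
  intros Hz Hr Hzr H. apply csum_le_const. intros p _.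
  rewrite Cmod_mult, Cmod_pow, Cmod_conj.
  assert (H1 := PS_bound (a p) z r M Hr Hzr (H p)).
  assert (H2 := pow_le_one (Cmod z) p (conj (Cmod_ge_0 z) (Rlt_le _ _ Hz))).
  assert (H3 : 0 <= Cmod z ^ p) by (apply pow_le, Cmod_ge_0).
  assert (H4 := Cmod_ge_0 (PS (a p) z)).
  apply Rle_trans with (1 * Cmod (PS (a p) z)); [apply Rmult_le_compat_r; lra|lra].
Qed.

(** * Integrals of complex functions over a circle *)

(** A continuous complex-valued function of a real variable. *)
Definition ccurve (f : R -> C) : Prop :=
  forall t, continuous (fun s => Re (f s)) t /\ continuous (fun s => Im (f s)) t.

(** The integral over a period of the angle. *)
Definition cint (f : R -> C) : C :=
  (RInt (fun t => Re (f t)) 0 (2 * PI), RInt (fun t => Im (f t)) 0 (2 * PI)).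

Lemma ccurve_of_eps (f : R -> C) :
  (forall t eps, 0 < eps -> exists delta, 0 < delta /\
     forall s, Rabs (s - t) < delta -> Cmod (f s - f t) < eps) -> ccurve f.
Proof.
  intros H t. split; intros P [e He]; destruct (H t e (cond_pos e)) as [d [Hd Hd']];
    exists (mkposreal d Hd); intros s Hs; apply He; specialize (Hd' s Hs).
  - change (Rabs (Re (f s) - Re (f t)) < e). eapply Rle_lt_trans; [|exact Hd'].
    exact (re_le_Cmod (f s - f t)).
  - change (Rabs (Im (f s) - Im (f t)) < e). eapply Rle_lt_trans; [|exact Hd'].
    exact (im_le_Cmod (f s - f t)).
Qed.

Lemma ccurve_eps (f : R -> C) : ccurve f ->
  forall t eps, 0 < eps -> exists delta, 0 < delta /\
     forall s, Rabs (s - t) < delta -> Cmod (f s - f t) < eps.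
Proof.
  intros H t eps Heps. destruct (H t) as [H1 H2].
  assert (X : forall g : R -> R, continuous g t -> exists delta, 0 < delta /\
     forall s, Rabs (s - t) < delta -> Rabs (g s - g t) < eps / 2).
  { intros g Hg. destruct (Hg (fun y => Rabs (y - g t) < eps / 2)) as [d Hd].
    - exists (mkposreal (eps / 2) ltac:(lra)). intros y Hy. exact Hy.
    - exists d. split; [apply cond_pos|]. intros s Hs. apply (Hd s Hs). }
  destruct (X _ H1) as [d1 [Hd1 Hd1']]. destruct (X _ H2) as [d2 [Hd2 Hd2']].
  exists (Rmin d1 d2). split; [apply Rmin_pos; assumption|]. intros s Hs.
  apply Rmin_Rgt_l in Hs as [Ha Hb]. specialize (Hd1' s Ha). specialize (Hd2' s Hb).
  eapply Rle_lt_trans; [apply Cmod_le_re_im|].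
  change (Rabs (Re (f s) - Re (f t)) + Rabs (Im (f s) - Im (f t)) < eps). lra.
Qed.

Lemma ccurve_comp (F : C -> C) (g : R -> C) : ccurve g ->
  (forall t eps, 0 < eps -> exists delta, 0 < delta /\
    forall w, Cmod (w - g t) < delta -> Cmod (F w - F (g t)) < eps) ->
  ccurve (fun t => F (g t)).
Proof.
  intros Hg HF. apply ccurve_of_eps. intros t eps Heps.
  destruct (HF t eps Heps) as [d [Hd Hd']].
  destruct (ccurve_eps g Hg t d Hd) as [e [He He']].
  exists e. split; [exact He|]. intros s Hs. apply Hd', He', Hs.
Qed.

Lemma ccurve_velocity (g l : R -> C) : (forall t, velocity g t (l t)) -> ccurve g.
Proof.
  intros H t. split.
  - apply (ex_derive_continuous (fun s => Re (g s))).
    eexists. apply velocity_re, H.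
  - apply (ex_derive_continuous (fun s => Im (g s))).
    eexists. apply velocity_im, H.
Qed.

Lemma ccurve_const (c : C) : ccurve (fun _ => c).
Proof. intros t. split; apply continuous_const. Qed.

Lemma ccurve_plus (f g : R -> C) : ccurve f -> ccurve g -> ccurve (fun t => (f t + g t)%C).
Proof.
  intros Hf Hg t. destruct (Hf t), (Hg t). split.
  - apply (continuous_plus (fun s => Re (f s)) (fun s => Re (g s))); assumption.
  - apply (continuous_plus (fun s => Im (f s)) (fun s => Im (g s))); assumption.
Qed.

Lemma ccurve_mult (f g : R -> C) : ccurve f -> ccurve g -> ccurve (fun t => (f t * g t)%C).
Proof.
  intros Hf Hg t. destruct (Hf t), (Hg t). split.
  - apply (continuous_minus (fun s => Re (f s) * Re (g s)) (fun s => Im (f s) * Im (g s)));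
      [apply (continuous_mult (fun s => Re (f s)) (fun s => Re (g s)))
      |apply (continuous_mult (fun s => Im (f s)) (fun s => Im (g s)))]; assumption.
  - apply (continuous_plus (fun s => Re (f s) * Im (g s)) (fun s => Im (f s) * Re (g s)));
      [apply (continuous_mult (fun s => Re (f s)) (fun s => Im (g s)))
      |apply (continuous_mult (fun s => Im (f s)) (fun s => Re (g s)))]; assumption.
Qed.

Lemma ccurve_csum (f : nat -> R -> C) (n : nat) : (forall j, ccurve (f j)) ->
  ccurve (fun t => csum (fun j => f j t) n).
Proof.
  intros H. induction n as [|n IH]; simpl; [apply ccurve_const|].
  apply ccurve_plus; auto.
Qed.

Lemma ccurve_ex_RInt (f : R -> C) (a b : R) : ccurve f ->
  ex_RInt (fun t => Re (f t)) a b /\ ex_RInt (fun t => Im (f t)) a b.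
Proof.
  intros H. split; apply (ex_RInt_continuous (V := R_CompleteNormedModule));
    intros t _; apply H.
Qed.

Lemma cint_ext (f g : R -> C) : (forall t, f t = g t) -> cint f = cint g.
Proof. intros H. f_equal. apply functional_extensionality. exact H. Qed.

Lemma cint_plus (f g : R -> C) : ccurve f -> ccurve g ->
  cint (fun t => (f t + g t)%C) = (cint f + cint g)%C.
Proof.
  intros Hf Hg.
  destruct (ccurve_ex_RInt f 0 (2 * PI) Hf), (ccurve_ex_RInt g 0 (2 * PI) Hg).
  apply injective_projections; apply (RInt_plus (V := R_CompleteNormedModule)); assumption.
Qed.

Lemma cint_scal (c : C) (f : R -> C) : ccurve f ->
  cint (fun t => (c * f t)%C) = (c * cint f)%C.
Proof.
  intros Hf. destruct (ccurve_ex_RInt f 0 (2 * PI) Hf) as [H1 H2].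
  assert (X : forall (k : R) (g : R -> R), ex_RInt g 0 (2 * PI) ->
    ex_RInt (fun t => k * g t) 0 (2 * PI)).
  { intros k g Hg. apply (ex_RInt_scal (V := R_NormedModule) g 0 (2 * PI) k Hg). }
  assert (Y : forall (k : R) (g : R -> R), ex_RInt g 0 (2 * PI) ->
    RInt (fun t => k * g t) 0 (2 * PI) = k * RInt g 0 (2 * PI)).
  { intros k g Hg. apply (RInt_scal (V := R_CompleteNormedModule) g 0 (2 * PI) k Hg). }
  apply injective_projections; unfold cint; simpl.
  - rewrite <- !Y by assumption.
    apply (RInt_minus (V := R_CompleteNormedModule)
      (fun t => fst c * Re (f t)) (fun t => snd c * Im (f t))); apply X; assumption.
  - rewrite <- !Y by assumption.
    apply (RInt_plus (V := R_CompleteNormedModule)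
      (fun t => fst c * Im (f t)) (fun t => snd c * Re (f t))); apply X; assumption.
Qed.

Lemma cint_zero : cint (fun _ => RtoC 0) = RtoC 0.
Proof.
  rewrite (cint_ext _ (fun _ => (0 * 0)%C)) by (intros; ring).
  rewrite (cint_scal 0 (fun _ => RtoC 0)) by apply ccurve_const. ring.
Qed.

Lemma cint_csum (f : nat -> R -> C) (n : nat) : (forall j, ccurve (f j)) ->
  cint (fun t => csum (fun j => f j t) n) = csum (fun j => cint (f j)) n.
Proof.
  intros H. induction n as [|n IH]; simpl; [apply cint_zero|].
  rewrite cint_plus by (try apply ccurve_csum; apply H). rewrite IH. reflexivity.
Qed.

Lemma cint_const (c : C) : cint (fun _ => c) = (RtoC (2 * PI) * c)%C.
Proof.
  unfold cint. rewrite !RInt_const. apply injective_projections; simpl;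
    unfold scal; simpl; unfold mult, Re, Im; simpl; ring.
Qed.

Lemma cint_bound (f : R -> C) (M : R) : ccurve f ->
  (forall t, 0 <= t <= 2 * PI -> Cmod (f t) <= M) -> Cmod (cint f) <= 4 * PI * M.
Proof.
  intros Hf H. destruct (ccurve_ex_RInt f 0 (2 * PI) Hf) as [H1 H2].
  assert (HPI := PI_RGT_0).
  eapply Rle_trans; [apply Cmod_le_re_im|]. unfold cint. simpl.
  assert (X1 := abs_RInt_le_const _ 0 (2 * PI) M ltac:(lra) H1
    (fun t Ht => Rle_trans _ _ _ (re_le_Cmod (f t)) (H t Ht))).
  assert (X2 := abs_RInt_le_const _ 0 (2 * PI) M ltac:(lra) H2
    (fun t Ht => Rle_trans _ _ _ (im_le_Cmod (f t)) (H t Ht))).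
  simpl in X1, X2. lra.
Qed.

Lemma cint_dist (f g : R -> C) (M : R) : ccurve f -> ccurve g ->
  (forall t, 0 <= t <= 2 * PI -> Cmod (f t - g t) <= M) ->
  Cmod (cint f - cint g) <= 4 * PI * M.
Proof.
  intros Hf Hg H.
  assert (Hg' : ccurve (fun t => (-1 * g t)%C)) by (apply ccurve_mult; [apply ccurve_const|exact Hg]).
  replace (cint f - cint g)%C with (cint (fun t => (f t + -1 * g t)%C))
    by (rewrite cint_plus, cint_scal, RtoC_m1 by assumption; ring).
  apply cint_bound; [apply ccurve_plus; assumption|]. intros t Ht. rewrite RtoC_m1.
  replace (f t + - (1) * g t)%C with (f t - g t)%C by ring. apply H, Ht.
Qed.

Lemma cint_velocity (g l : R -> C) : (forall t, velocity g t (l t)) -> ccurve l ->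
  cint l = (g (2 * PI)%R - g 0%R)%C.
Proof.
  intros Hg Hl. unfold cint. apply injective_projections; simpl.
  - apply is_RInt_unique. apply (is_RInt_derive (fun t => Re (g t)) (fun t => Re (l t))).
    + intros t _. apply velocity_re, Hg.
    + intros t _. apply Hl.
  - apply is_RInt_unique. apply (is_RInt_derive (fun t => Im (g t)) (fun t => Im (l t))).
    + intros t _. apply velocity_im, Hg.
    + intros t _. apply Hl.
Qed.

(** The point of the unit circle with angle [t]. *)
Definition circ (t : R) : C := (cos t, sin t).

Lemma circ_plus (s t : R) : circ (s + t) = (circ s * circ t)%C.
Proof.
  unfold circ, Cmult; simpl. rewrite cos_plus, sin_plus. f_equal; ring.
Qed.

Lemma circ_0 : circ 0 = RtoC 1.
Proof. unfold circ. rewrite cos_0, sin_0. reflexivity. Qed.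

Lemma Cmod_circ (t : R) : Cmod (circ t) = 1.
Proof.
  unfold Cmod, circ; simpl.
  replace (cos t * (cos t * 1) + sin t * (sin t * 1)) with 1.
  - apply sqrt_1.
  - assert (H := sin2_cos2 t). unfold Rsqr in H. lra.
Qed.

Lemma circ_neq_0 (t : R) : circ t <> RtoC 0.
Proof.
  intros E. assert (H := Cmod_circ t). rewrite E, Cmod_0 in H. lra.
Qed.

Lemma circ_opp (t : R) : circ (- t) = Cconj (circ t).
Proof. unfold circ, Cconj; simpl. rewrite cos_neg, sin_neg. reflexivity. Qed.

Lemma circ_pow (t : R) (n : nat) : (circ t ^ n)%C = circ (INR n * t).
Proof.
  induction n as [|n IH].
  - rewrite Rmult_0_l, circ_0. reflexivity.
  - rewrite Cpow_S, IH, <- circ_plus, S_INR. f_equal. ring.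
Qed.

Lemma circ_period (n : nat) : circ (INR n * (2 * PI)) = RtoC 1.
Proof.
  unfold circ. replace (INR n * (2 * PI)) with (0 + 2 * INR n * PI) by ring.
  rewrite cos_period, sin_period, cos_0, sin_0. reflexivity.
Qed.

Lemma velocity_circ (k t : R) :
  velocity (fun s => circ (k * s)) t (RtoC k * Ci * circ (k * t)).
Proof.
  intros eps Heps.
  assert (X : forall f : R -> R, forall l, is_derive f t l -> exists delta, 0 < delta /\
    forall s, Rabs s < delta -> Rabs (f (t + s) - f t - l * s) <= eps / 2 * Rabs s).
  { intros f l Hf. apply is_derive_Reals in Hf.
    destruct (Hf (eps / 2) ltac:(lra)) as [d Hd].
    exists d. split; [apply cond_pos|]. intros s Hs.
    destruct (Req_dec s 0) as [->|Hs0].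
    - rewrite Rplus_0_r, Rabs_R0. replace (f t - f t - l * 0) with 0 by ring.
      rewrite Rabs_R0. lra.
    - specialize (Hd s Hs0 Hs).
      replace (f (t + s) - f t - l * s) with (((f (t + s) - f t) / s - l) * s) by (field; exact Hs0).
      rewrite Rabs_mult. apply Rmult_le_compat_r; [apply Rabs_pos|lra]. }
  destruct (X (fun s => cos (k * s)) (- k * sin (k * t))) as [d1 [Hd1 Hd1']].
  { auto_derive; [exact I|ring]. }
  destruct (X (fun s => sin (k * s)) (k * cos (k * t))) as [d2 [Hd2 Hd2']].
  { auto_derive; [exact I|ring]. }
  exists (Rmin d1 d2). split; [apply Rmin_pos; assumption|]. intros s Hs.
  apply Rmin_Rgt_l in Hs as [Ha Hb]. specialize (Hd1' s Ha). specialize (Hd2' s Hb).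
  eapply Rle_trans; [apply Cmod_le_re_im|].
  replace (Re (circ (k * (t + s)) - circ (k * t) - RtoC k * Ci * circ (k * t) * RtoC s))
    with (cos (k * (t + s)) - cos (k * t) - - k * sin (k * t) * s)
    by (unfold circ, RtoC, Ci; simpl; ring).
  replace (Im (circ (k * (t + s)) - circ (k * t) - RtoC k * Ci * circ (k * t) * RtoC s))
    with (sin (k * (t + s)) - sin (k * t) - k * cos (k * t) * s)
    by (unfold circ, RtoC, Ci; simpl; ring).
  lra.
Qed.

Lemma ccurve_circ (k : R) : ccurve (fun t => circ (k * t)).
Proof. eapply ccurve_velocity. intros t. apply velocity_circ. Qed.

Lemma ccurve_circ1 : ccurve circ.
Proof.
  rewrite (functional_extensionality circ (fun t => circ (1 * t))); [apply ccurve_circ|].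
  intros t. rewrite Rmult_1_l. reflexivity.
Qed.

Lemma cint_circ (i q : nat) :
  cint (fun t => circ ((INR i - INR q) * t)) =
  if Nat.eqb i q then RtoC (2 * PI) else RtoC 0.
Proof.
  destruct (Nat.eqb_spec i q) as [->|Hne].
  - rewrite (cint_ext _ (fun _ => RtoC 1)).
    + rewrite cint_const. ring.
    + intros t. replace ((INR q - INR q) * t) with 0 by ring. apply circ_0.
  - set (k := INR i - INR q).
    assert (Hk : k <> 0).
    { unfold k. intros E. apply Hne, INR_eq. lra. }
    assert (H := cint_velocity _ _ (velocity_circ k)
      (ccurve_mult _ _ (ccurve_const (RtoC k * Ci)) (ccurve_circ k))).
    rewrite (cint_scal (RtoC k * Ci) (fun t => circ (k * t)) (ccurve_circ k)) in H.
    rewrite Rmult_0_r, circ_0 in H.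
    assert (E : circ (k * (2 * PI)) = RtoC 1).
    { assert (E1 := circ_period i).
      replace (INR i * (2 * PI)) with (k * (2 * PI) + INR q * (2 * PI)) in E1 by (unfold k; ring).
      rewrite circ_plus, circ_period in E1. rewrite <- E1. ring. }
    rewrite E in H. replace (1 - 1)%C with (RtoC 0) in H by ring.
    destruct (Ceq_dec (cint (fun t => circ (k * t))) 0) as [Hz|Hz]; [exact Hz|].
    exfalso. apply (Cmult_neq_0 (RtoC k * Ci) (cint (fun t => circ (k * t)))); auto.
    apply Cmult_neq_0; [|apply Ci_nz]. intros E0. apply Hk. exact (f_equal fst E0).
Qed.

(** * Fourier coefficients of a polyanalytic series on a circle *)

Lemma disc_scal_circ (rho t : R) : 0 <= rho < 1 -> disc (RtoC rho * circ t)%C.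
Proof. intros H. unfold disc. rewrite Cmod_mult, Cmod_circ, Cmod_R, Rabs_pos_eq; lra. Qed.

Lemma ccurve_PS_circ (b : nat -> C) (rho : R) : rad1 b -> 0 <= rho < 1 ->
  ccurve (fun t => PS b (RtoC rho * circ t)%C).
Proof.
  intros Hb Hr. apply (ccurve_comp (PS b) (fun t => (RtoC rho * circ t)%C)).
  - apply ccurve_mult; [apply ccurve_const|apply ccurve_circ1].
  - intros t eps Heps.
    exact (wirtinger_cont _ _ _ _ (wirtinger_PS b _ Hb (disc_scal_circ rho t Hr)) eps Heps).
Qed.

Lemma fourier_PS (b : nat -> C) (rho : R) (s q : nat) : rad1 b -> 0 < rho < 1 ->
  cint (fun t => (PS b (RtoC rho * circ t) * circ ((INR s - INR q) * t))%C) =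
  (RtoC (2 * PI) * (if Nat.leb s q then b (q - s)%nat * RtoC rho ^ (q - s) else 0))%C.
Proof.
  intros Hb Hr. set (v := (if Nat.leb s q then b (q - s)%nat * RtoC rho ^ (q - s) else 0)%C).
  set (r := (1 + rho) / 2).
  destruct (Hb r ltac:(unfold r; lra)) as [M [HM HM']].
  assert (Hmod : forall t, Cmod (RtoC rho * circ t) = rho).
  { intros t. rewrite Cmod_mult, Cmod_circ, Cmod_R, Rabs_pos_eq; lra. }
  set (tau := fun n => M / (1 - rho / r) * (rho / r) ^ n).
  assert (Hq : 0 <= rho / r < 1).
  { split; [apply Rlt_le, Rdiv_lt_0_compat; unfold r; lra|].
    apply Rmult_lt_reg_r with r; [unfold r; lra|]. unfold Rdiv at 1.
    rewrite Rmult_assoc, Rinv_l; unfold r; lra. }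
  assert (Htau : is_lim_seq tau 0) by (apply is_lim_seq_geom_scal; exact Hq).
  set (Sn := fun (n : nat) (t : R) => csum (fun j => (b j * (RtoC rho * circ t) ^ j)%C) n).
  assert (Hc : forall n t, Cmod (Sn n t - PS b (RtoC rho * circ t)) <= tau n).
  { intros n t. destruct (PS_tail b (RtoC rho * circ t)%C r M ltac:(unfold r; lra)
      ltac:(rewrite Hmod; unfold r; lra) HM') as [_ H].
    specialize (H n). rewrite Hmod in H. exact H. }
  assert (HcS : forall n, ccurve (Sn n)).
  { intros n. apply (ccurve_csum (fun j t => (b j * (RtoC rho * circ t) ^ j)%C)). intros j.
    apply ccurve_mult; [apply ccurve_const|].
    induction j as [|j IH]; [exact (ccurve_const 1)|].
    apply (ccurve_mult (fun t => (RtoC rho * circ t)%C)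
      (fun t => ((RtoC rho * circ t) ^ j)%C)); [|exact IH].
    apply ccurve_mult; [apply ccurve_const|exact ccurve_circ1]. }
  assert (HcE := ccurve_circ (INR s - INR q)).
  assert (HcP := ccurve_PS_circ b rho Hb ltac:(lra)).
  assert (Hint : forall n, (q < n)%nat ->
    cint (fun t => (Sn n t * circ ((INR s - INR q) * t))%C) = (RtoC (2 * PI) * v)%C).
  { intros n Hn.
    rewrite (cint_ext _ (fun t => csum (fun j => (b j * RtoC rho ^ j
        * circ ((INR (j + s) - INR q) * t))%C) n)).
    2: { intros t. unfold Sn. rewrite Cmult_comm, <- csum_scal. apply csum_ext. intros j _.
         rewrite Cpow_mult_l, circ_pow, plus_INR.
         replace ((INR j + INR s - INR q) * t) with (INR j * t + (INR s - INR q) * t) by ring.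
         rewrite circ_plus. ring. }
    rewrite (cint_csum (fun j t => (b j * RtoC rho ^ j * circ ((INR (j + s) - INR q) * t))%C)).
    2: { intros j. apply ccurve_mult; [apply ccurve_const|apply ccurve_circ]. }
    rewrite (csum_ext _ (fun j => (b j * RtoC rho ^ j
       * (if Nat.eqb (j + s) q then RtoC (2 * PI) else RtoC 0))%C)).
    2: { intros j _. rewrite (cint_scal (b j * RtoC rho ^ j)
           (fun t => circ ((INR (j + s) - INR q) * t)) (ccurve_circ _)).
         rewrite cint_circ. reflexivity. }
    unfold v. destruct (Nat.leb_spec s q) as [Hsq|Hsq].
    - rewrite (csum_single _ n (q - s)).
      + replace (q - s + s)%nat with q by lia. rewrite Nat.eqb_refl. ring.
      + lia.
      + intros j _ Hj. destruct (Nat.eqb_spec (j + s) q); [lia|ring].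
    - rewrite (csum_ext _ (fun _ => RtoC 0)).
      + rewrite csum_zero. ring.
      + intros j _. destruct (Nat.eqb_spec (j + s) q); [lia|ring]. }
  apply (clim_unique (fun n => cint (fun t => (Sn (S q + n)%nat t * circ ((INR s - INR q) * t))%C))).
  - apply clim_of_bound with (tau := fun n => 4 * PI * tau (S q + n)%nat).
    + intros n. apply cint_dist; [apply ccurve_mult; [apply HcS|exact HcE]|
        apply ccurve_mult; assumption|].
      intros t _. replace (Sn (S q + n)%nat t * circ ((INR s - INR q) * t)
          - PS b (RtoC rho * circ t) * circ ((INR s - INR q) * t))%C
        with ((Sn (S q + n)%nat t - PS b (RtoC rho * circ t)) * circ ((INR s - INR q) * t))%C by ring.
      rewrite Cmod_mult, Cmod_circ, Rmult_1_r. apply Hc.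
    + replace (Finite 0) with (Rbar_mult (4 * PI) 0) by (simpl; f_equal; ring).
      apply is_lim_seq_scal_l.
      apply (is_lim_seq_incr_n tau (S q)) in Htau.
      eapply is_lim_seq_ext; [|exact Htau]. intros n. simpl. f_equal. f_equal. lia.
  - apply clim_of_bound with (tau := fun _ => 0); [|apply is_lim_seq_const].
    intros n. rewrite Hint by lia.
    match goal with |- Cmod (?x - ?x) <= _ => replace (x - x)%C with (RtoC 0) by ring end.
    rewrite Cmod_0. lra.
Qed.

Lemma Cmod_scal_circ (rho t : R) : 0 <= rho -> Cmod (RtoC rho * circ t) = rho.
Proof. intros H. rewrite Cmod_mult, Cmod_circ, Cmod_R, Rabs_pos_eq; lra. Qed.

(** A power series bounded on a circle has its terms bounded there. *)
Lemma PS_coef_bound (b : nat -> C) (rho M : R) (q : nat) : rad1 b -> 0 < rho < 1 ->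
  (forall z, Cmod z = rho -> Cmod (PS b z) <= M) -> Cmod (b q) * rho ^ q <= 2 * M.
Proof.
  intros Hb Hr H. assert (HPI := PI_RGT_0).
  assert (E := fourier_PS b rho 0 q Hb Hr). simpl Nat.leb in E. rewrite Nat.sub_0_r in E.
  assert (B : Cmod (cint (fun t => (PS b (RtoC rho * circ t) * circ ((INR 0 - INR q) * t))%C))
     <= 4 * PI * M).
  { apply cint_bound.
    - apply ccurve_mult; [apply ccurve_PS_circ; [exact Hb|lra]|apply ccurve_circ].
    - intros t _. rewrite Cmod_mult, Cmod_circ, Rmult_1_r. apply H, Cmod_scal_circ. lra. }
  rewrite E, !Cmod_mult, Cmod_pow, !Cmod_R, (Rabs_pos_eq rho), (Rabs_pos_eq (2 * PI)) in B by lra.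
  apply Rmult_le_reg_l with (2 * PI); lra.
Qed.

(** The Fourier coefficients of a polyanalytic series on the circle of radius
    [rho] mix the rows of the array along its diagonals: the coefficient of
    index [J - K] is, up to a power of [rho], a polynomial in [rho ^ 2]. *)
Definition diag (K : nat) (a : nat -> nat -> C) (J p : nat) : C :=
  if Nat.leb K (J + p) then a p (J + p - K)%nat else RtoC 0.

Lemma polyseries_fourier_bound (K : nat) (a : nat -> nat -> C) (M : R) (J : nat) :
  admissible K a -> (forall z, disc z -> Cmod (polyseries K a z) <= M) ->
  forall rho, 0 < rho < 1 ->
  Cmod (csum (fun p => (diag K a J p * RtoC rho ^ (J + 2 * p))%C) (S K)) <= 2 * M.
Proof.
  intros [Ha Ha'] HM rho Hr. assert (HPI := PI_RGT_0).
  assert (HMp : 0 <= M).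
  { apply Rle_trans with (1 := Cmod_ge_0 (polyseries K a 0)). apply (HM 0). unfold disc. rewrite Cmod_0. lra. }
  set (f := fun t => (polyseries K a (RtoC rho * circ t) * circ ((INR K - INR J) * t))%C).
  set (h := fun (p : nat) (t : R) =>
    (PS (a p) (RtoC rho * circ t) * circ ((INR K - INR (J + p)) * t))%C).
  assert (Ef : forall t, f t = csum (fun p => (RtoC rho ^ p * h p t)%C) (S K)).
  { intros t. unfold f, h, polyseries. rewrite Cmult_comm, <- csum_scal. apply csum_ext. intros p _.
    rewrite Cmult_conj, Cpow_mult_l, <- circ_opp, circ_pow, plus_INR.
    replace (Cconj (RtoC rho)) with (RtoC rho)
      by (unfold Cconj, RtoC; simpl; f_equal; ring).
    replace ((INR K - (INR J + INR p)) * t) with ((INR K - INR J) * t + INR p * - t) by ring.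
    rewrite circ_plus. ring. }
  assert (Hcp : forall p, ccurve (fun t => (RtoC rho ^ p * h p t)%C)).
  { intros p. apply ccurve_mult; [apply ccurve_const|].
    apply ccurve_mult; [apply ccurve_PS_circ; [apply Ha|lra]|apply ccurve_circ]. }
  assert (Hf : ccurve f).
  { rewrite (functional_extensionality _ _ Ef). apply (ccurve_csum (fun p t => (RtoC rho ^ p * h p t)%C)). exact Hcp. }
  assert (B : Cmod (cint f) <= 4 * PI * M).
  { apply cint_bound; [exact Hf|]. intros t _. unfold f. rewrite Cmod_mult, Cmod_circ, Rmult_1_r.
    apply HM, disc_scal_circ. lra. }
  rewrite (cint_ext _ _ Ef) in B.
  rewrite (cint_csum (fun p t => (RtoC rho ^ p * h p t)%C)) in B by exact Hcp.
  rewrite (csum_ext _ (fun p => (RtoC (2 * PI) * (RtoC rho ^ p * (if Nat.leb K (J + p)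
     then a p (J + p - K)%nat * RtoC rho ^ (J + p - K) else 0)))%C)) in B.
  2: { intros p _. rewrite (cint_scal (RtoC rho ^ p) (h p)).
       - unfold h. rewrite fourier_PS; [ring|apply Ha|exact Hr].
       - apply ccurve_mult; [apply ccurve_PS_circ; [apply Ha|lra]|apply ccurve_circ]. }
  rewrite csum_scal, Cmod_mult, Cmod_R, (Rabs_pos_eq (2 * PI)) in B by lra.
  rewrite (csum_ext _ (fun p => (RtoC rho ^ K * (RtoC rho ^ p * (if Nat.leb K (J + p)
     then a p (J + p - K)%nat * RtoC rho ^ (J + p - K) else 0)))%C)).
  - rewrite csum_scal, Cmod_mult, Cmod_pow, Cmod_R, (Rabs_pos_eq rho) by lra.
    assert (HK := pow_le_one rho K ltac:(lra)).
    set (X := Cmod (csum _ (S K))) in *.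
    assert (HX : X <= 2 * M) by (apply Rmult_le_reg_l with (2 * PI); lra).
    assert (HX0 : 0 <= X) by apply Cmod_ge_0.
    apply Rle_trans with (1 * X); [apply Rmult_le_compat_r; lra|lra].
  - intros p _. unfold diag. destruct (Nat.leb_spec K (J + p)) as [H|H]; [|ring].
    replace (J + 2 * p)%nat with (K + (p + (J + p - K)))%nat by lia.
    rewrite !Cpow_add_r. ring.
Qed.

(** * Coefficients of a bounded polyanalytic series *)

(** The product of [mu p - mu i] over the [i < n] other than [p0]. *)
Fixpoint elim_factor (mu : nat -> R) (p0 n p : nat) : R :=
  match n with
  | O => 1
  | S m => if Nat.eqb m p0 then elim_factor mu p0 m p
           else (mu p - mu m) * elim_factor mu p0 m p
  end.

Lemma elim_factor_zero (mu : nat -> R) (p0 n p : nat) : (p < n)%nat -> p <> p0 ->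
  elim_factor mu p0 n p = 0.
Proof.
  intros Hp Hne. induction n as [|n IH]; [lia|]. simpl.
  destruct (Nat.eqb_spec n p0) as [->|H].
  - apply IH. lia.
  - destruct (Nat.eq_dec p n) as [->|]; [ring|]. rewrite IH by lia. ring.
Qed.

Lemma elim_factor_lower (mu : nat -> R) (p0 n : nat) (d : R) : 0 < d <= 1 ->
  (forall i, (i < n)%nat -> i <> p0 -> d <= Rabs (mu p0 - mu i)) ->
  d ^ n <= Rabs (elim_factor mu p0 n p0).
Proof.
  intros Hd. induction n as [|n IH]; intros H; simpl.
  - rewrite Rabs_R1. lra.
  - assert (IH' := IH (fun i Hi => H i (Nat.lt_lt_succ_r _ _ Hi))).
    assert (Hp : 0 <= d ^ n) by (apply pow_le; lra).
    destruct (Nat.eqb_spec n p0) as [->|Hne].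
    + apply Rle_trans with (1 * d ^ p0); [apply Rmult_le_compat_r; lra|lra].
    + rewrite Rabs_mult. apply Rmult_le_compat; try lra. apply H; [lia|exact Hne].
Qed.

(** Replacing a function [u] of [rho] by [u (lam * rho) - lam ^ (J + 2 * i) * u rho]
    removes its monomial of degree [J + 2 * i], at the cost of doubling its bound. *)
Lemma elim_bound (K J p0 : nat) (c : nat -> C) (M lam : R) : 0 < lam < 1 ->
  (forall rho, 0 < rho < 1 ->
     Cmod (csum (fun p => (c p * RtoC rho ^ (J + 2 * p))%C) (S K)) <= M) ->
  forall n rho, 0 < rho < 1 ->
    Cmod (csum (fun p => (RtoC (elim_factor (fun i => lam ^ (J + 2 * i))%R p0 n p) * c p
                * RtoC rho ^ (J + 2 * p))%C) (S K)) <= 2 ^ n * M.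
Proof.
  intros Hl H n. set (mu := fun i => lam ^ (J + 2 * i)).
  assert (HMp : 0 <= M) by (eapply Rle_trans; [apply Cmod_ge_0|apply (H lam Hl)]).
  induction n as [|n IH]; intros rho Hr.
  - rewrite (csum_ext _ (fun p => (c p * RtoC rho ^ (J + 2 * p))%C))
      by (intros; simpl elim_factor; ring).
    rewrite Rmult_1_l. apply H, Hr.
  - assert (Hlr : 0 < lam * rho < 1).
    { split; [apply Rmult_lt_0_compat; lra|].
      apply Rlt_trans with (1 * rho); [apply Rmult_lt_compat_r; lra|lra]. }
    assert (H2 : 0 <= 2 ^ n * M) by (apply Rmult_le_pos; [apply pow_le; lra|exact HMp]).
    simpl elim_factor. destruct (Nat.eqb_spec n p0) as [E|Hne].
    + apply Rle_trans with (1 := IH rho Hr). simpl. lra.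
    + rewrite (csum_ext _ (fun p =>
         (RtoC (elim_factor mu p0 n p) * c p * RtoC (lam * rho) ^ (J + 2 * p)
          + - RtoC (mu n) * (RtoC (elim_factor mu p0 n p) * c p * RtoC rho ^ (J + 2 * p)))%C)).
      * rewrite csum_plus, csum_scal. eapply Rle_trans; [apply Cmod_triangle|].
        rewrite Cmod_mult, Cmod_opp, Cmod_R.
        assert (Hmu : 0 <= mu n <= 1).
        { unfold mu. split; [apply pow_le; lra|apply pow_le_one; lra]. }
        rewrite Rabs_pos_eq by lra.
        assert (X1 := IH (lam * rho) Hlr). assert (X2 := IH rho Hr).
        set (Y := Cmod (csum (fun p => (RtoC (elim_factor mu p0 n p) * c p * RtoC rho ^ (J + 2 * p))%C) (S K))) in *.
        assert (HY : 0 <= Y) by apply Cmod_ge_0.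
        assert (X3 : mu n * Y <= 1 * Y) by (apply Rmult_le_compat_r; lra).
        simpl (2 ^ S n). lra.
      * intros p _. rewrite RtoC_mult, RtoC_minus. unfold mu at 1.
        rewrite RtoC_pow, RtoC_mult, Cpow_mult_l. ring.
Qed.

Lemma one_minus_exp_opp (x : R) : 0 < x <= 1 -> x / 2 <= 1 - exp (- x).
Proof.
  intros Hx. rewrite exp_Ropp. assert (H := exp_ineq1 x ltac:(lra)).
  assert (H1 : / exp x <= / (1 + x)) by (apply Rinv_le_contravar; lra).
  assert (H2 : / (1 + x) <= 1 - x / 2).
  { apply Rmult_le_reg_r with (1 + x); [lra|]. rewrite Rinv_l by lra. nra. }
  lra.
Qed.

(** The coefficients of a sum of monomials of degrees [J], [J + 2], ...,
    [J + 2 * K] in [rho] are controlled by its supremum over the interval from 0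
    to 1, with a constant of polynomial growth in [J]. *)
Lemma coef_bound_monomials (K : nat) : exists Cst, 0 < Cst /\
  forall (J : nat) (c : nat -> C) (M : R),
  (forall rho, 0 < rho < 1 ->
     Cmod (csum (fun p => (c p * RtoC rho ^ (J + 2 * p))%C) (S K)) <= M) ->
  forall p, (p <= K)%nat -> Cmod (c p) <= Cst * INR (S J) ^ S K * M.
Proof.
  set (g := exp (- (1 + 2 * INR K))).
  assert (Hg : 0 < g <= 1).
  { split; [apply exp_pos|]. rewrite <- exp_0. unfold g. assert (H := pos_INR K).
    apply Rlt_le, exp_increasing. lra. }
  exists (2 ^ S K * (/ (g / 2)) ^ S K * / g). split.
  { repeat apply Rmult_lt_0_compat; try apply pow_lt; try apply Rinv_0_lt_compat; lra. }
  intros J c M H p0 Hp0.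
  assert (HJ : 1 <= INR (S J)) by (rewrite S_INR; assert (X := pos_INR J); lra).
  set (eta := / INR (S J)).
  assert (Heta : 0 < eta <= 1).
  { unfold eta; split; [apply Rinv_0_lt_compat; lra|].
    rewrite <- Rinv_1. apply Rinv_le_contravar; lra. }
  set (lam := exp (- eta)).
  assert (Hl : 0 < lam < 1).
  { split; [apply exp_pos|]. rewrite <- exp_0. apply exp_increasing. lra. }
  set (mu := fun i => lam ^ (J + 2 * i)).
  assert (Hpow : forall n, lam ^ n = exp (- (INR n * eta))).
  { intros n. unfold lam. induction n as [|n IH].
    - simpl. rewrite Rmult_0_l, Ropp_0, exp_0. reflexivity.
    - rewrite S_INR. simpl. rewrite IH, <- exp_plus. f_equal. ring. }
  assert (Hmu : forall i, (i <= K)%nat -> g <= mu i).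
  { intros i Hi. unfold mu. rewrite Hpow. unfold g.
    assert (X : - (1 + 2 * INR K) <= - (INR (J + 2 * i) * eta)).
    { apply Ropp_le_contravar. rewrite plus_INR, mult_INR, Rmult_plus_distr_r.
      assert (X1 : INR J * eta <= 1).
      { unfold eta. apply Rmult_le_reg_r with (INR (S J)); [lra|].
        rewrite Rmult_assoc, Rinv_l by lra. rewrite S_INR. lra. }
      assert (X2 := le_INR i K Hi). assert (X3 := pos_INR i). simpl (INR 2).
      assert (X4 : (1 + 1) * INR i * eta <= (1 + 1) * INR i * 1) by (apply Rmult_le_compat_l; lra).
      lra. }
    destruct X as [X|X]; [left; apply exp_increasing; exact X|rewrite X; lra]. }
  assert (Hgap : forall i j, (i < j)%nat -> (i <= K)%nat -> g * (eta / 2) <= mu i - mu j).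
  { intros i j Hij Hi. replace (mu j) with (mu i * lam ^ (2 * (j - i)))
      by (unfold mu; rewrite <- pow_add; f_equal; lia).
    replace (mu i - mu i * lam ^ (2 * (j - i))) with (mu i * (1 - lam ^ (2 * (j - i)))) by ring.
    assert (X := one_minus_exp_opp eta Heta). fold lam in X.
    assert (Y : lam ^ (2 * (j - i)) <= lam).
    { replace (2 * (j - i))%nat with (S (2 * (j - i) - 1)) by lia. rewrite <- tech_pow_Rmult.
      assert (Z := pow_le_one lam (2 * (j - i) - 1) ltac:(lra)).
      apply Rle_trans with (lam * 1); [apply Rmult_le_compat_l; lra|lra]. }
    apply Rmult_le_compat; try lra. apply Hmu; exact Hi. }
  set (d := g * (eta / 2)).
  assert (Hd : 0 < d <= 1).
  { unfold d. split; [apply Rmult_lt_0_compat; lra|].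
    apply Rle_trans with (1 * 1); [apply Rmult_le_compat; lra|lra]. }
  assert (Hlow : d ^ S K <= Rabs (elim_factor mu p0 (S K) p0)).
  { apply elim_factor_lower; [exact Hd|]. intros i Hi Hne.
    destruct (Nat.lt_ge_cases i p0) as [Hlt|Hge].
    - assert (X := Hgap i p0 Hlt ltac:(lia)). rewrite Rabs_minus_sym.
      eapply Rle_trans; [exact X|apply Rle_abs].
    - assert (X := Hgap p0 i ltac:(lia) Hp0).
      eapply Rle_trans; [exact X|apply Rle_abs]. }
  (* After eliminating the other monomials, the remaining one is evaluated at lam. *)
  assert (B := elim_bound K J p0 c M lam Hl H (S K) lam Hl). fold mu in B.
  rewrite (csum_single _ (S K) p0) in B.
  2: lia.
  2: { intros j Hj Hne. rewrite elim_factor_zero by lia. ring. }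
  rewrite !Cmod_mult, Cmod_pow, !Cmod_R, (Rabs_pos_eq lam) in B by lra.
  change (lam ^ (J + 2 * p0)) with (mu p0) in B.
  assert (HdK : 0 < d ^ S K) by (apply pow_lt; lra).
  assert (Hc0 := Cmod_ge_0 (c p0)).
  assert (B2 : d ^ S K * Cmod (c p0) * g <= 2 ^ S K * M).
  { apply Rle_trans with (2 := B). apply Rmult_le_compat; try lra.
    - apply Rmult_le_pos; lra.
    - apply Rmult_le_compat_r; lra.
    - apply Hmu; exact Hp0. }
  assert (Ed : d ^ S K = (g / 2) ^ S K * / INR (S J) ^ S K).
  { unfold d. replace (g * (eta / 2)) with (g / 2 * eta) by field.
    rewrite Rpow_mult_distr. unfold eta. rewrite pow_inv. reflexivity. }
  assert (HgK : 0 < (g / 2) ^ S K) by (apply pow_lt; lra).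
  assert (HJK : 0 < INR (S J) ^ S K) by (apply pow_lt; lra).
  rewrite pow_inv.
  apply Rmult_le_reg_r with (d ^ S K * g); [apply Rmult_lt_0_compat; lra|].
  apply Rle_trans with (2 ^ S K * M); [lra|]. right.
  rewrite Ed. field. repeat split; lra.
Qed.

(** A polyanalytic series bounded in the disc has coefficients of polynomial
    growth, with a bound proportional to its supremum. *)
Lemma polyseries_coef_bound (K : nat) : exists Cst, 0 < Cst /\
  forall (a : nat -> nat -> C) (M : R), admissible K a ->
  (forall z, disc z -> Cmod (polyseries K a z) <= M) ->
  forall p j, Cmod (a p j) <= Cst * INR (S j) ^ S K * M.
Proof.
  destruct (coef_bound_monomials K) as [C0 [HC0 H]].
  assert (HSK : 0 < INR (S K)) by (apply lt_0_INR; lia).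
  exists (C0 * INR (S K) ^ S K * 2). split.
  { repeat apply Rmult_lt_0_compat; try lra. apply pow_lt; lra. }
  intros a M Ha HM p j.
  assert (HMp : 0 <= M).
  { apply Rle_trans with (1 := Cmod_ge_0 (polyseries K a 0)). apply (HM 0). unfold disc. rewrite Cmod_0. lra. }
  assert (Hj : 0 < INR (S j)) by (apply lt_0_INR; lia).
  destruct (Nat.lt_ge_cases K p) as [Hp|Hp].
  - rewrite (proj2 Ha) by exact Hp. rewrite Cmod_0.
    repeat apply Rmult_le_pos; try lra; apply pow_le; lra.
  - set (J := (K - p + j)%nat).
    assert (X := H J (diag K a J) (2 * M) (polyseries_fourier_bound K a M J Ha HM) p Hp).
    unfold diag in X. replace (Nat.leb K (J + p)) with true in X
      by (symmetry; apply Nat.leb_le; unfold J; lia).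
    replace (J + p - K)%nat with j in X by (unfold J; lia).
    apply Rle_trans with (1 := X).
    assert (HJ : INR (S J) <= INR (S K) * INR (S j)).
    { rewrite <- mult_INR. apply le_INR. unfold J. nia. }
    assert (Y : INR (S J) ^ S K <= INR (S K) ^ S K * INR (S j) ^ S K).
    { rewrite <- Rpow_mult_distr. apply pow_incr. split; [apply pos_INR|exact HJ]. }
    replace (C0 * INR (S K) ^ S K * 2 * INR (S j) ^ S K * M)
      with (C0 * (INR (S K) ^ S K * INR (S j) ^ S K) * (2 * M)) by ring.
    apply Rmult_le_compat_r; [lra|]. apply Rmult_le_compat_l; [lra|exact Y].
Qed.

(** * From continuous partial derivatives to differentiability *)

Lemma locally_disc (z : C) : disc z -> locally (Re z, Im z) (fun u => disc u).
Proof.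
  intros Hz. assert (Hp := disc_radius_pos z Hz).
  exists (mkposreal ((1 - Cmod z) / 2) ltac:(lra)). intros u Hu. simpl in Hu.
  assert (E : ((Re z, Im z) : C) = z) by (symmetry; apply surjective_pairing).
  rewrite E in Hu. apply Cmod_ball in Hu.
  replace u with (z + (u - z))%C by ring. apply disc_shift. simpl in Hu. lra.
Qed.

(** The first-order expansion of [F] at [z], for one of its two real components:
    [P] stands for the real or for the imaginary part. *)
Lemma part_expansion (P : C -> R) (F : C -> C) (z : C) :
  (forall a b, Rabs (P a - P b) <= Cmod (a - b)) -> disc z ->
  (forall w, disc w -> ex_derive (fun t => P (F (t, Im w))) (Re w)) ->
  ex_derive (fun t => P (F (Re z, t))) (Im z) ->
  (forall eps, 0 < eps -> exists delta, 0 < delta /\ forall w, Cmod (w - z) < delta ->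
     Rabs (Derive (fun t => P (F (t, Im w))) (Re w)
           - Derive (fun t => P (F (t, Im z))) (Re z)) < eps) ->
  forall eps, 0 < eps -> exists delta, 0 < delta /\ forall h : C, Cmod h < delta ->
    Rabs (P (F (z + h)%C) - P (F z) - (Re h * Derive (fun t => P (F (t, Im z))) (Re z)
          + Im h * Derive (fun t => P (F (Re z, t))) (Im z))) <= eps * Cmod h.
Proof.
  intros HP Hz Hx Hy Hc eps Heps.
  assert (Ez : ((Re z, Im z) : C) = z) by (symmetry; apply surjective_pairing).
  assert (D := is_derive_filterdiff (fun x y => P (F (x, y))) (Re z) (Im z)
    (fun x y => Derive (fun t => P (F (t, y))) x) (Derive (fun t => P (F (Re z, t))) (Im z))).
  destruct D as [_ D].
  - eapply filter_imp; [|apply (locally_disc z Hz)]. intros u Hu.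
    apply Derive_correct. exact (Hx u Hu).
  - apply Derive_correct. exact Hy.
  - intros Q [e He]. destruct (Hc e (cond_pos e)) as [d [Hd Hd']].
    exists (mkposreal (d / 2) ltac:(lra)). intros u Hu. apply He.
    assert (Hu' : Cmod (u - z) < d).
    { rewrite <- Ez. apply Cmod_ball in Hu. simpl in Hu. lra. }
    exact (Hd' u Hu').
  - specialize (D (Re z, Im z) (fun Q HQ => HQ) (mkposreal eps Heps)).
    destruct D as [d Hd]. exists d. split; [apply cond_pos|]. intros h Hh.
    assert (Hb : ball ((Re z, Im z) : C) d (z + h)%C).
    { apply ball_Cmod. rewrite Ez. replace (z + h - z)%C with h by ring. exact Hh. }
    specialize (Hd (z + h)%C Hb). simpl in Hd.
    assert (Eh : minus ((z + h)%C : R * R) (Re z, Im z) = h).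
    { destruct z, h. unfold minus, plus, opp; simpl. unfold plus, opp; simpl.
      unfold prod_plus, prod_opp; simpl. unfold plus, opp; simpl. f_equal; ring. }
    match type of Hd with _ <= _ * ?n => assert (En : Cmod h = n) end.
    { exact (eq_trans (f_equal Cmod (eq_sym Eh)) (Cmod_norm _)). }
    rewrite <- En in Hd. eapply Rle_trans; [|exact Hd]. right.
    unfold norm, minus, plus, opp, scal; simpl. unfold abs; simpl. unfold mult; simpl.
    f_equal.
    replace (F (fst z + fst h, snd z + snd h)) with (F (z + h)%C) by reflexivity.
    replace (F (Re z, Im z)) with (F z) by (f_equal; symmetry; exact Ez).
    unfold Re, Im. ring.
Qed.

Lemma wirtinger_of_partials (F : C -> C) (z : C) :
  (forall w, disc w -> ex_dx F w /\ ex_dy F w) ->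
  continuous_on disc (dx F) -> disc z ->
  wirtinger F z (/ 2 * (dx F z - Ci * dy F z)) (dbar F z).
Proof.
  intros Hex Hc Hz eps Heps.
  assert (Hcz := continuous_on_disc_at (dx F) z Hc Hz).
  destruct (part_expansion Re F z (fun a b => re_le_Cmod (a - b)) Hz
    (fun w Hw => proj1 (proj1 (Hex w Hw))) (proj1 (proj2 (Hex z Hz)))) with (eps := eps / 2)
    as [d1 [Hd1 Hd1']]; [|lra|].
  { intros e He. destruct (Hcz e He) as [d [Hd Hd']]. exists d. split; [exact Hd|].
    intros w Hw. eapply Rle_lt_trans; [|apply (Hd' w Hw)].
    exact (re_le_Cmod (dx F w - dx F z)). }
  destruct (part_expansion Im F z (fun a b => im_le_Cmod (a - b)) Hz
    (fun w Hw => proj2 (proj1 (Hex w Hw))) (proj2 (proj2 (Hex z Hz)))) with (eps := eps / 2)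
    as [d2 [Hd2 Hd2']]; [|lra|].
  { intros e He. destruct (Hcz e He) as [d [Hd Hd']]. exists d. split; [exact Hd|].
    intros w Hw. eapply Rle_lt_trans; [|apply (Hd' w Hw)].
    exact (im_le_Cmod (dx F w - dx F z)). }
  exists (Rmin d1 d2). split; [apply Rmin_pos; assumption|]. intros h Hh.
  apply Rmin_Rgt_l in Hh as [Ha Hb]. specialize (Hd1' h Ha). specialize (Hd2' h Hb).
  replace (/ 2 * (dx F z - Ci * dy F z) * h + dbar F z * Cconj h)%C
    with (RtoC (Re h) * dx F z + RtoC (Im h) * dy F z)%C.
  - eapply Rle_trans; [apply Cmod_le_re_im|].
    replace (eps * Cmod h) with (eps / 2 * Cmod h + eps / 2 * Cmod h) by field.
    apply Rplus_le_compat.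
    + eapply Rle_trans; [|exact Hd1']. right. f_equal.
      unfold dx, dy. simpl. unfold Re, Im. simpl. ring.
    + eapply Rle_trans; [|exact Hd2']. right. f_equal.
      unfold dx, dy. simpl. unfold Re, Im. simpl. ring.
  - unfold dbar. generalize (dx F z), (dy F z). intros u v.
    rewrite <- RtoC_inv by lra. destruct h as [x y]; destruct u as [a b]; destruct v as [c d].
    unfold RtoC, Ci, Cconj, Cmult, Cplus, Cminus, Copp; simpl. f_equal; field.
Qed.

(** * Cauchy's formula and the power series of a holomorphic function *)

(** Differentiation under the integral sign, where [P] stands for the real or for
    the imaginary part. *)
Lemma velocity_cint (P : C -> R) (G G' : R -> R -> C) (x d : R) : 0 < d ->
  (forall a b, Rabs (P a - P b) <= Cmod (a - b)) ->
  (forall g t l, velocity g t l -> is_derive (fun s => P (g s)) t (P l)) ->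
  (forall t theta, Rabs (t - x) < d -> velocity (fun u => G u theta) t (G' t theta)) ->
  (forall t, Rabs (t - x) < d -> ccurve (G t)) ->
  (forall theta eps, 0 < eps -> exists delta, 0 < delta /\ forall u v,
     Rabs (u - x) < delta -> Rabs (v - theta) < delta ->
     Cmod (G' u v - G' x theta) < eps) ->
  is_derive (fun t => RInt (fun theta => P (G t theta)) 0 (2 * PI)) x
    (RInt (fun theta => P (G' x theta)) 0 (2 * PI)).
Proof.
  intros Hd HP HPv HG Hcurve Hcont.
  assert (Hloc : forall Q : R -> Prop, (forall t, Rabs (t - x) < d -> Q t) -> locally x Q).
  { intros Q HQ. exists (mkposreal d Hd). intros t Ht. apply HQ. exact Ht. }
  rewrite (RInt_ext (fun theta => P (G' x theta))
    (fun theta => Derive (fun u => P (G u theta)) x)).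
  2: { intros theta _. symmetry. apply is_derive_unique. apply HPv. apply HG.
       rewrite Rminus_diag, Rabs_R0. exact Hd. }
  apply (is_derive_RInt_param (fun t theta => P (G t theta))).
  - apply Hloc. intros t Ht theta _. eexists. apply HPv. apply HG. exact Ht.
  - intros theta _ eps. destruct (Hcont theta eps (cond_pos eps)) as [e [He He']].
    exists (mkposreal (Rmin e d) (Rmin_pos _ _ He Hd)). simpl. intros u v Hu Hv.
    apply Rmin_Rgt_l in Hu as [Hu1 Hu2]. apply Rmin_Rgt_l in Hv as [Hv1 _].
    assert (E1 : Derive (fun z => P (G z v)) u = P (G' u v)).
    { apply is_derive_unique. apply HPv, HG. exact Hu2. }
    assert (E2 : Derive (fun z => P (G z theta)) x = P (G' x theta)).
    { apply is_derive_unique. apply HPv, HG. rewrite Rminus_diag, Rabs_R0. exact Hd. }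
    rewrite E1, E2. eapply Rle_lt_trans; [apply HP|]. apply He'; assumption.
  - apply Hloc. intros t Ht.
    apply (ex_RInt_continuous (V := R_CompleteNormedModule)). intros s _ Q [e He].
    destruct (ccurve_eps (G t) (Hcurve t Ht) s e (cond_pos e)) as [e' [He1 He2]].
    exists (mkposreal e' He1). intros s' Hs'. apply He.
    eapply Rle_lt_trans; [apply HP|]. apply He2. exact Hs'.
Qed.

Lemma ccurve_inv (f : R -> C) : ccurve f -> (forall t, f t <> RtoC 0) ->
  ccurve (fun t => / f t)%C.
Proof.
  intros Hf H0 t. destruct (Hf t) as [H1 H2].
  assert (Hn : continuous (fun s => / (Re (f s) ^ 2 + Im (f s) ^ 2)) t).
  { apply continuous_Rinv_comp.
    - apply (continuous_plus (fun s => Re (f s) ^ 2) (fun s => Im (f s) ^ 2)).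
      + simpl. apply (continuous_mult (fun s => Re (f s)) (fun s => Re (f s) * 1)); [exact H1|].
        apply (continuous_mult (fun s => Re (f s)) (fun s => 1)); [exact H1|apply continuous_const].
      + simpl. apply (continuous_mult (fun s => Im (f s)) (fun s => Im (f s) * 1)); [exact H2|].
        apply (continuous_mult (fun s => Im (f s)) (fun s => 1)); [exact H2|apply continuous_const].
    - intros E. apply (H0 t). apply Cmod_eq_0. unfold Cmod.
      change (sqrt (Re (f t) ^ 2 + Im (f t) ^ 2) = 0). rewrite E. apply sqrt_0. }
  split.
  - apply (continuous_mult (fun s => Re (f s)) (fun s => / (Re (f s) ^ 2 + Im (f s) ^ 2))); assumption.
  - apply (continuous_mult (fun s => - Im (f s)) (fun s => / (Re (f s) ^ 2 + Im (f s) ^ 2))); [|exact Hn].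
    apply (continuous_opp (fun s => Im (f s))). exact H2.
Qed.

Lemma ccurve_pow (f : R -> C) (n : nat) : ccurve f -> ccurve (fun t => f t ^ n)%C.
Proof.
  intros Hf. induction n as [|n IH]; [exact (ccurve_const 1)|].
  apply (ccurve_mult f (fun t => f t ^ n)%C); assumption.
Qed.

Lemma ccurve_bounded (f : R -> C) : ccurve f ->
  exists M, 0 <= M /\ forall t, 0 <= t <= 2 * PI -> Cmod (f t) <= M.
Proof.
  intros Hf.
  destruct (bounded_continuity (fun t => Re (f t)) 0 (2 * PI)) as [M1 H1].
  { intros t _. apply (Hf t). }
  destruct (bounded_continuity (fun t => Im (f t)) 0 (2 * PI)) as [M2 H2].
  { intros t _. apply (Hf t). }
  exists (Rmax 0 (M1 + M2)). split; [apply Rmax_l|]. intros t Ht.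
  eapply Rle_trans; [|apply Rmax_r]. eapply Rle_trans; [apply Cmod_le_re_im|].
  assert (X1 := H1 t Ht). assert (X2 := H2 t Ht).
  change (Rabs (Re (f t)) < M1) in X1. change (Rabs (Im (f t)) < M2) in X2. lra.
Qed.

Section Cauchy.
Variables (H A : C -> C) (r : R) (w : C).
Hypothesis Hr : 0 < r < 1.
Hypothesis Hw : Cmod w < r.

(** The point of angle [t] on the circle of radius [r], and the Cauchy kernel. *)
Let zeta (t : R) : C := (RtoC r * circ t)%C.
Let kappa (t : R) : C := (zeta t / (zeta t - w))%C.

Lemma Cmod_zeta (t : R) : Cmod (zeta t) = r.
Proof. apply Cmod_scal_circ. lra. Qed.

Lemma zeta_minus_lower (t : R) : r - Cmod w <= Cmod (zeta t - w).
Proof. assert (X := Cmod_triangle_rev (zeta t) w). rewrite Cmod_zeta in X. lra. Qed.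

Lemma zeta_minus_neq_0 (t : R) : (zeta t - w)%C <> RtoC 0.
Proof. intros E. assert (X := zeta_minus_lower t). rewrite E, Cmod_0 in X. lra. Qed.

Lemma zeta_neq_0 (t : R) : zeta t <> RtoC 0.
Proof. intros E. assert (X := Cmod_zeta t). rewrite E, Cmod_0 in X. lra. Qed.

Lemma ccurve_zeta : ccurve zeta.
Proof. apply ccurve_mult; [apply ccurve_const|apply ccurve_circ1]. Qed.

Lemma ccurve_kappa : ccurve kappa.
Proof.
  apply ccurve_mult; [apply ccurve_zeta|]. apply ccurve_inv; [|apply zeta_minus_neq_0].
  apply ccurve_plus; [apply ccurve_zeta|apply ccurve_const].
Qed.

Lemma Cmod_kappa (t : R) : Cmod (kappa t) <= r / (r - Cmod w).
Proof.
  unfold kappa. rewrite Cmod_div by apply zeta_minus_neq_0. rewrite Cmod_zeta.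
  apply Rmult_le_compat_l; [lra|]. apply Rinv_le_contravar; [lra|apply zeta_minus_lower].
Qed.

Lemma kappa_expansion (t : R) (n : nat) :
  kappa t = (csum (fun j => (w * / zeta t) ^ j) n + (w * / zeta t) ^ n * kappa t)%C.
Proof.
  induction n as [|n IH]; [simpl; ring|].
  rewrite IH at 1. rewrite csum_S, Cpow_S.
  assert (E : kappa t = (1 + w * / zeta t * kappa t)%C).
  { unfold kappa. field. split; [apply zeta_minus_neq_0|apply zeta_neq_0]. }
  rewrite E at 1. ring.
Qed.

Lemma ccurve_inv_zeta : ccurve (fun t => / zeta t)%C.
Proof. apply ccurve_inv; [apply ccurve_zeta|apply zeta_neq_0]. Qed.

(** Expanding the kernel as a geometric series. *)
Lemma cint_kappa_expansion (f : R -> C) (M : R) (n : nat) : ccurve f ->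
  (forall t, 0 <= t <= 2 * PI -> Cmod (f t) <= M) ->
  Cmod (csum (fun j => (cint (fun t => f t * (/ zeta t) ^ j) * w ^ j)%C) n
        - cint (fun t => (f t * kappa t)%C))
    <= 4 * PI * (M * (r / (r - Cmod w))) * (Cmod w / r) ^ n.
Proof.
  intros Hf HM.
  assert (Hc1 : forall j, ccurve (fun t => (f t * (/ zeta t) ^ j)%C)).
  { intros j. apply ccurve_mult; [exact Hf|]. apply ccurve_pow, ccurve_inv_zeta. }
  assert (Hc2 : ccurve (fun t => (f t * ((w * / zeta t) ^ n * kappa t))%C)).
  { apply ccurve_mult; [exact Hf|]. apply ccurve_mult; [|apply ccurve_kappa].
    apply ccurve_pow. apply ccurve_mult; [apply ccurve_const|apply ccurve_inv_zeta]. }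
  rewrite (cint_ext (fun t => (f t * kappa t)%C)
     (fun t => (csum (fun j => w ^ j * (f t * (/ zeta t) ^ j)) n
               + f t * ((w * / zeta t) ^ n * kappa t))%C)).
  2: { intros t. rewrite (kappa_expansion t n) at 1.
       rewrite Cmult_plus_distr_l, <- csum_scal. f_equal. apply csum_ext. intros j _.
       rewrite Cpow_mult_l. ring. }
  rewrite cint_plus.
  2: { apply (ccurve_csum (fun j t => (w ^ j * (f t * (/ zeta t) ^ j))%C)). intros j.
       apply ccurve_mult; [apply ccurve_const|apply Hc1]. }
  2: exact Hc2.
  rewrite (cint_csum (fun j t => (w ^ j * (f t * (/ zeta t) ^ j))%C)).
  2: { intros j. apply ccurve_mult; [apply ccurve_const|apply Hc1]. }
  rewrite (csum_ext (fun j => cint (fun t => (w ^ j * (f t * (/ zeta t) ^ j))%C))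
    (fun j => (cint (fun t => f t * (/ zeta t) ^ j) * w ^ j)%C)).
  2: { intros j _. rewrite (cint_scal (w ^ j) (fun t => (f t * (/ zeta t) ^ j)%C)) by apply Hc1. ring. }
  match goal with |- Cmod (?a - (?a + ?b)) <= _ => replace (a - (a + b))%C with (- b)%C by ring end.
  rewrite Cmod_opp.
  replace (4 * PI * (M * (r / (r - Cmod w))) * (Cmod w / r) ^ n)
    with (4 * PI * (M * ((Cmod w / r) ^ n * (r / (r - Cmod w))))) by ring.
  apply cint_bound; [exact Hc2|]. intros t Ht.
  rewrite !Cmod_mult, Cmod_pow, Cmod_mult, Cmod_inv, Cmod_zeta by apply zeta_neq_0.
  assert (Hq : 0 <= (Cmod w * / r) ^ n).
  { apply pow_le, Rmult_le_pos; [apply Cmod_ge_0|left; apply Rinv_0_lt_compat; lra]. }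
  apply Rmult_le_compat; [apply Cmod_ge_0| |apply HM; exact Ht|].
  - apply Rmult_le_pos; [exact Hq|apply Cmod_ge_0].
  - apply Rmult_le_compat_l; [exact Hq|apply Cmod_kappa].
Qed.

Lemma ratio_lt_1 : 0 <= Cmod w / r < 1.
Proof.
  split.
  - apply Rmult_le_pos; [apply Cmod_ge_0|left; apply Rinv_0_lt_compat; lra].
  - apply Rmult_lt_reg_r with r; [lra|]. unfold Rdiv. rewrite Rmult_assoc, Rinv_l; lra.
Qed.

Lemma cint_kappa_clim (f : R -> C) : ccurve f ->
  clim (csum (fun j => (cint (fun t => f t * (/ zeta t) ^ j) * w ^ j)%C))
    (cint (fun t => (f t * kappa t)%C)).
Proof.
  intros Hf. destruct (ccurve_bounded f Hf) as [M [_ HM]].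
  eapply clim_of_bound; [intros n; apply (cint_kappa_expansion f M n Hf HM)|].
  apply is_lim_seq_geom_scal, ratio_lt_1.
Qed.

Lemma inv_zeta_pow (t : R) (j : nat) :
  ((/ zeta t) ^ j = (/ RtoC r) ^ j * circ ((INR 0 - INR j) * t))%C.
Proof.
  assert (Hrz : RtoC r <> RtoC 0) by (intros E; apply RtoC_inj in E; lra).
  assert (E : (/ zeta t = / RtoC r * circ (- t))%C).
  { assert (X : (circ t * circ (- t))%C = RtoC 1).
    { rewrite <- circ_plus. replace (t + - t) with 0 by ring. apply circ_0. }
    unfold zeta. assert (Hc := circ_neq_0 t).
    replace (circ (- t)) with (/ circ t)%C.
    - field. split; assumption.
    - transitivity (/ circ t * (circ t * circ (- t)))%C; [rewrite X; ring|field; exact Hc]. }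
  rewrite E, Cpow_mult_l, circ_pow. do 2 f_equal. simpl INR. ring.
Qed.

Lemma cint_kappa : cint kappa = RtoC (2 * PI).
Proof.
  assert (X := cint_kappa_clim (fun _ => RtoC 1) (ccurve_const 1)).
  cbv beta in X. rewrite (cint_ext (fun t => (1 * kappa t)%C) kappa) in X by (intros; ring).
  apply (clim_unique _ _ _ (clim_incr _ _ X)).
  apply clim_of_bound with (tau := fun _ => 0); [|apply is_lim_seq_const].
  intros n. rewrite (csum_single _ (S n) 0).
  - rewrite (cint_ext _ (fun _ => RtoC 1)) by (intros; simpl; ring).
    rewrite cint_const. simpl.
    replace (RtoC (2 * PI) * 1 * 1 - RtoC (2 * PI))%C with (RtoC 0) by ring.
    rewrite Cmod_0. lra.
  - lia.
  - intros j _ Hj.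
    rewrite (cint_ext _ (fun t => ((/ RtoC r) ^ j * circ ((INR 0 - INR j) * t))%C)).
    + rewrite (cint_scal ((/ RtoC r) ^ j) (fun t => circ ((INR 0 - INR j) * t)) (ccurve_circ _)).
      rewrite cint_circ. destruct (Nat.eqb_spec 0 j); [lia|]. ring.
    + intros t. rewrite inv_zeta_pow. ring.
Qed.

Hypothesis HA : forall z, disc z -> wirtinger H z (A z) 0.
Hypothesis HAc : continuous_on disc A.

(** The segment from [w] to the circle, slightly prolonged at both ends. *)
Let gam (t theta : R) : C := (w + RtoC t * (zeta theta - w))%C.
Let d0 : R := (1 - r) / 4.

Lemma gam_disc (t theta : R) : - d0 < t < 1 + d0 -> disc (gam t theta).
Proof.
  unfold d0. intros Ht. unfold disc, gam.
  assert (Hw0 := Cmod_ge_0 w).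
  replace (w + RtoC t * (zeta theta - w))%C with (RtoC (1 - t) * w + RtoC t * zeta theta)%C
    by (rewrite RtoC_minus; ring).
  eapply Rle_lt_trans; [apply Cmod_triangle|]. rewrite !Cmod_mult, !Cmod_R, Cmod_zeta.
  assert (X : Rabs (1 - t) * Cmod w <= Rabs (1 - t) * r)
    by (apply Rmult_le_compat_l; [apply Rabs_pos|lra]).
  assert (Y : Rabs (1 - t) + Rabs t < 1 + 3 * ((1 - r) / 4)).
  { unfold Rabs. destruct (Rcase_abs (1 - t)), (Rcase_abs t); lra. }
  assert (Z : (Rabs (1 - t) + Rabs t) * r < 1).
  { apply Rlt_trans with ((1 + 3 * ((1 - r) / 4)) * r); [apply Rmult_lt_compat_r; lra|nra]. }
  lra.
Qed.

Lemma velocity_zeta (t : R) : velocity zeta t (Ci * zeta t).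
Proof.
  assert (X := velocity_scal_r _ _ _ (RtoC r) (velocity_circ 1 t)).
  assert (E : (fun s => (circ (1 * s) * RtoC r)%C) = zeta).
  { apply functional_extensionality. intros s. unfold zeta. rewrite Rmult_1_l. ring. }
  cbv beta in X. rewrite E in X. rewrite Rmult_1_l in X.
  replace (Ci * zeta t)%C with (RtoC 1 * Ci * circ t * RtoC r)%C by (unfold zeta; ring).
  exact X.
Qed.

Lemma velocity_gam_theta (t theta : R) : velocity (gam t) theta (RtoC t * (Ci * zeta theta)).
Proof.
  assert (X := velocity_add_const _ _ _ (w - RtoC t * w)
     (velocity_scal_r _ _ _ (RtoC t) (velocity_zeta theta))).
  assert (E : (fun s => (w - RtoC t * w + zeta s * RtoC t)%C) = gam t).
  { apply functional_extensionality. intros s. unfold gam. ring. }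
  cbv beta in X. rewrite E in X. rewrite Cmult_comm. exact X.
Qed.

(** The angular derivative of [H] along the circle [gam t] is, up to the factor
    [i t], the radial derivative of the integrand, which therefore has zero mean. *)
Lemma cint_radial_derivative (t : R) : - d0 < t < 1 + d0 ->
  cint (fun theta => (A (gam t theta) * zeta theta)%C) = RtoC 0.
Proof.
  intros Ht.
  assert (HcA : ccurve (fun theta => A (gam t theta))).
  { apply (ccurve_comp A (gam t)).
    - eapply ccurve_velocity. intros s. apply velocity_gam_theta.
    - intros s eps Heps. apply (continuous_on_disc_at A _ HAc (gam_disc t s Ht) eps Heps). }
  destruct (Req_dec t 0) as [->|Ht0].
  (* At t = 0 the circle is reduced to w, and zeta itself has zero mean. *)
  - rewrite (cint_ext _ (fun theta => (A w * RtoC r * circ ((INR 1 - INR 0) * theta))%C)).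
    + rewrite (cint_scal (A w * RtoC r) (fun theta => circ ((INR 1 - INR 0) * theta)) (ccurve_circ _)).
      rewrite cint_circ. simpl. ring.
    + intros theta. unfold gam, zeta. simpl INR.
      replace ((1 - 0) * theta) with theta by ring.
      replace (w + RtoC 0 * (RtoC r * circ theta - w))%C with w by ring. ring.
  - assert (Hv : forall theta, velocity (fun s => H (gam t s)) theta
        (RtoC t * Ci * (A (gam t theta) * zeta theta))).
    { intros theta.
      assert (X := velocity_comp H (gam t) theta _ _ _ (HA _ (gam_disc t theta Ht))
                     (velocity_gam_theta t theta)).
      replace (RtoC t * Ci * (A (gam t theta) * zeta theta))%C
        with (A (gam t theta) * (RtoC t * (Ci * zeta theta))
              + 0 * Cconj (RtoC t * (Ci * zeta theta)))%C by ring.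
      exact X. }
    assert (HcAz : ccurve (fun theta => (A (gam t theta) * zeta theta)%C)).
    { apply ccurve_mult; [exact HcA|apply ccurve_zeta]. }
    assert (X := cint_velocity _ _ Hv (ccurve_mult _ _ (ccurve_const (RtoC t * Ci)) HcAz)).
    rewrite (cint_scal (RtoC t * Ci) (fun theta => (A (gam t theta) * zeta theta)%C) HcAz) in X.
    assert (E : gam t (2 * PI) = gam t 0).
    { unfold gam, zeta. do 4 f_equal.
      assert (Y := circ_period 1). simpl INR in Y. rewrite Rmult_1_l in Y. rewrite Y, circ_0. reflexivity. }
    rewrite E in X.
    replace (H (gam t 0) - H (gam t 0))%C with (RtoC 0) in X by ring.
    destruct (Ceq_dec (cint (fun theta => (A (gam t theta) * zeta theta)%C)) 0) as [Hz|Hz]; [exact Hz|].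
    exfalso. revert X. apply Cmult_neq_0; [|exact Hz]. apply Cmult_neq_0; [|apply Ci_nz].
    intros E0. apply RtoC_inj in E0. contradiction.
Qed.

(** The integral of [G t] below does not depend on [t]; the formula compares its
    values at [t = 0] and [t = 1]. *)
Lemma cauchy_formula : cint (fun theta => (H (zeta theta) * kappa theta)%C) = (RtoC (2 * PI) * H w)%C.
Proof.
  assert (Hd0 : 0 < d0) by (unfold d0; lra).
  set (G := fun t theta => (H (gam t theta) * kappa theta)%C).
  set (G' := fun t theta => (A (gam t theta) * zeta theta)%C).
  assert (HGv : forall t theta, - d0 < t < 1 + d0 -> velocity (fun u => G u theta) t (G' t theta)).
  { intros t theta Ht. unfold G, G'.
    assert (X := velocity_scal_r _ _ _ (kappa theta) (velocity_comp H (fun u => gam u theta) t _ _ _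
       (HA _ (gam_disc t theta Ht)) (velocity_affine w (zeta theta - w) t))).
    replace (A (gam t theta) * zeta theta)%C
      with ((A (gam t theta) * (zeta theta - w) + 0 * Cconj (zeta theta - w)) * kappa theta)%C.
    - exact X.
    - unfold kappa. generalize (A (gam t theta)), (Cconj (zeta theta - w)). intros u v.
      field. apply zeta_minus_neq_0. }
  assert (HGc : forall t, - d0 < t < 1 + d0 -> ccurve (G t)).
  { intros t Ht. apply ccurve_mult; [|apply ccurve_kappa].
    apply (ccurve_comp H (gam t)).
    - eapply ccurve_velocity. intros s. apply velocity_gam_theta.
    - intros s eps Heps. apply (wirtinger_cont H _ _ _ (HA _ (gam_disc t s Ht)) eps Heps). }
  assert (Hcont : forall x theta eps, - d0 < x < 1 + d0 -> 0 < eps ->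
     exists delta, 0 < delta /\ forall u v,
     Rabs (u - x) < delta -> Rabs (v - theta) < delta -> Cmod (G' u v - G' x theta) < eps).
  { intros x theta eps Hx Heps.
    set (a0 := Cmod (A (gam x theta))). assert (Ha0 : 0 <= a0) by apply Cmod_ge_0.
    destruct (continuous_on_disc_at A _ HAc (gam_disc x theta Hx) (eps / 2) ltac:(lra)) as [d1 [Hd1 Hd1']].
    set (e := Rmin (d1 / 8) (eps / (2 * (a0 + 1)))).
    assert (He : 0 < e) by (apply Rmin_pos; [lra|apply Rdiv_lt_0_compat; lra]).
    destruct (ccurve_eps zeta ccurve_zeta theta e He) as [d2 [Hd2 Hd2']].
    exists (Rmin (Rmin 1 (d1 / 8)) d2). split; [repeat apply Rmin_pos; lra|]. intros u v Hu Hv.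
    apply Rmin_Rgt_l in Hu as [Hu _]. apply Rmin_Rgt_l in Hu as [Hu1 Hu2].
    apply Rmin_Rgt_l in Hv as [_ Hv]. apply Rgt_lt in Hu1, Hu2, Hv. specialize (Hd2' v Hv).
    assert (He1 := Rmin_l (d1 / 8) (eps / (2 * (a0 + 1)))).
    assert (He2 := Rmin_r (d1 / 8) (eps / (2 * (a0 + 1)))). fold e in He1, He2.
    assert (Hg : Cmod (gam u v - gam x theta) < d1).
    { unfold gam.
      replace (w + RtoC u * (zeta v - w) - (w + RtoC x * (zeta theta - w)))%C
        with (RtoC u * (zeta v - zeta theta) + RtoC (u - x) * (zeta theta - w))%C
        by (rewrite RtoC_minus; ring).
      eapply Rle_lt_trans; [apply Cmod_triangle|]. rewrite !Cmod_mult, !Cmod_R.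
      assert (X1 : Rabs u <= 3).
      { unfold d0 in Hx. revert Hu1. unfold Rabs.
        destruct (Rcase_abs (u - x)), (Rcase_abs u); lra. }
      assert (X2 : Cmod (zeta theta - w) <= 2).
      { eapply Rle_trans; [apply Cmod_triangle|]. rewrite Cmod_opp, Cmod_zeta. lra. }
      assert (X3 : Rabs u * Cmod (zeta v - zeta theta) <= 3 * (d1 / 8)).
      { apply Rmult_le_compat; try apply Rabs_pos; try apply Cmod_ge_0; lra. }
      assert (X4 : Rabs (u - x) * Cmod (zeta theta - w) <= d1 / 8 * 2).
      { apply Rmult_le_compat; try apply Rabs_pos; try apply Cmod_ge_0; lra. }
      lra. }
    specialize (Hd1' _ Hg). unfold G'.
    replace (A (gam u v) * zeta v - A (gam x theta) * zeta theta)%C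
      with ((A (gam u v) - A (gam x theta)) * zeta v
            + A (gam x theta) * (zeta v - zeta theta))%C by ring.
    eapply Rle_lt_trans; [apply Cmod_triangle|]. rewrite !Cmod_mult, Cmod_zeta. fold a0.
    assert (X5 : Cmod (A (gam u v) - A (gam x theta)) * r <= Cmod (A (gam u v) - A (gam x theta)) * 1)
      by (apply Rmult_le_compat_l; [apply Cmod_ge_0|lra]).
    assert (X6 : a0 * Cmod (zeta v - zeta theta) <= (a0 + 1) * (eps / (2 * (a0 + 1)))).
    { apply Rmult_le_compat; try apply Cmod_ge_0; lra. }
    replace ((a0 + 1) * (eps / (2 * (a0 + 1)))) with (eps / 2) in X6 by (field; lra).
    lra. }
  assert (Hpart : forall P : C -> R,
    (forall a b, Rabs (P a - P b) <= Cmod (a - b)) ->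
    (forall g t l, velocity g t l -> is_derive (fun s => P (g s)) t (P l)) ->
    (forall t, - d0 < t < 1 + d0 -> RInt (fun theta => P (G' t theta)) 0 (2 * PI) = 0) ->
    RInt (fun theta => P (G 0 theta)) 0 (2 * PI) = RInt (fun theta => P (G 1 theta)) 0 (2 * PI)).
  { intros P HP1 HP2 HP3.
    apply (eq_is_derive (fun t => RInt (fun theta => P (G t theta)) 0 (2 * PI)) 0 1); [|lra].
    intros t Ht. assert (Ht' : - d0 < t < 1 + d0) by lra.
    assert (HX : is_derive (fun t => RInt (fun theta => P (G t theta)) 0 (2 * PI)) t
       (RInt (fun theta => P (G' t theta)) 0 (2 * PI))).
    { assert (Hnear : forall s, Rabs (s - t) < Rmin (t + d0) (1 + d0 - t) -> - d0 < s < 1 + d0).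
      { intros s Hs. apply Rmin_Rgt_l in Hs as [Hs1 Hs2].
        apply Rgt_lt, Rabs_def2 in Hs1. apply Rgt_lt, Rabs_def2 in Hs2. lra. }
      apply (velocity_cint P G G' t (Rmin (t + d0) (1 + d0 - t)));
        [apply Rmin_pos; lra|exact HP1|exact HP2| | |].
      - intros s theta Hs. apply HGv, Hnear, Hs.
      - intros s Hs. apply HGc, Hnear, Hs.
      - intros theta eps Heps. apply Hcont; assumption. }
    rewrite (HP3 t Ht') in HX. exact HX. }
  assert (H01 : cint (G 0) = cint (G 1)).
  { apply injective_projections.
    - apply (Hpart Re).
      + intros a b. exact (re_le_Cmod (a - b)).
      + exact velocity_re.
      + intros t Ht. exact (f_equal fst (cint_radial_derivative t Ht)).
    - apply (Hpart Im).
      + intros a b. exact (im_le_Cmod (a - b)).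
      + exact velocity_im.
      + intros t Ht. exact (f_equal snd (cint_radial_derivative t Ht)). }
  rewrite (cint_ext _ (G 1)).
  - rewrite <- H01. rewrite (cint_ext (G 0) (fun theta => (H w * kappa theta)%C)).
    + rewrite (cint_scal (H w) kappa ccurve_kappa), cint_kappa. ring.
    + intros theta. unfold G, gam. do 2 f_equal. ring.
  - intros theta. unfold G, gam. do 2 f_equal. ring.
Qed.
End Cauchy.

Lemma PS_rescale (b : nat -> C) (c z : C) :
  PS (fun j => (b j * c ^ j)%C) z = PS b (c * z)%C.
Proof.
  unfold PS. rewrite (functional_extensionality (fun j => (b j * c ^ j * z ^ j)%C)
    (fun j => (b j * (c * z) ^ j)%C)); [reflexivity|].
  intros j. rewrite Cpow_mult_l. ring.
Qed.

Lemma PS_coef_zero (b : nat -> C) : rad1 b -> (forall z, disc z -> PS b z = RtoC 0) ->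
  forall j, b j = RtoC 0.
Proof.
  intros Hb H j. apply Cmod_eq_0. apply Rle_antisym; [|apply Cmod_ge_0].
  assert (X := PS_coef_bound b (/ 2) 0 j Hb ltac:(lra)).
  apply Rmult_le_reg_r with ((/ 2) ^ j); [apply pow_lt; lra|].
  replace (0 * (/ 2) ^ j) with (2 * 0) by ring. apply X.
  intros z Hz. rewrite H by (unfold disc; lra). rewrite Cmod_0. lra.
Qed.

(** A power series expansion in a smaller disc determines its coefficients. *)
Lemma PS_coef_unique (b c : nat -> C) (r M L : R) : 0 < r < 1 ->
  (forall j, Cmod (b j) * r ^ j <= M) -> (forall j, Cmod (c j) * r ^ j <= L) ->
  (forall w, Cmod w < r -> PS b w = PS c w) -> b = c.
Proof.
  intros Hr Hb Hc H. apply functional_extensionality. intros j.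
  assert (Hrz : forall n, Cmod (RtoC r ^ n) = r ^ n).
  { intros n. rewrite Cmod_pow, Cmod_R, Rabs_pos_eq; lra. }
  assert (Rb : rad1 (fun j => (b j * RtoC r ^ j)%C)).
  { apply rad1_bounded with M. intros n. rewrite Cmod_mult, Hrz. apply Hb. }
  assert (Rc : rad1 (fun j => (-1 * (c j * RtoC r ^ j))%C)).
  { apply rad1_scal, rad1_bounded with L. intros n. rewrite Cmod_mult, Hrz. apply Hc. }
  assert (Z := PS_coef_zero _ (rad1_plus _ _ Rb Rc)).
  assert (Z' : (b j * RtoC r ^ j + -1 * (c j * RtoC r ^ j))%C = RtoC 0).
  { apply Z. intros z Hz. rewrite (PS_plus _ _ z Rb Rc Hz).
    rewrite (PS_scal (-1) (fun j => (c j * RtoC r ^ j)%C)); [|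
      apply rad1_bounded with L; intros n; rewrite Cmod_mult, Hrz; apply Hc|exact Hz].
    rewrite !PS_rescale, H; [rewrite RtoC_m1; ring|].
    rewrite Cmod_mult, Cmod_R, Rabs_pos_eq by lra. unfold disc in Hz.
    apply Rlt_le_trans with (r * 1); [apply Rmult_lt_compat_l; lra|lra]. }
  rewrite RtoC_m1 in Z'.
  assert (Hp : (RtoC r ^ j)%C <> RtoC 0).
  { apply Cpow_nz. intros E. apply RtoC_inj in E. lra. }
  apply Ceq_minus.
  destruct (Ceq_dec (b j - c j) 0) as [E|E]; [exact E|].
  exfalso. apply (Cmult_neq_0 _ _ E Hp). rewrite <- Z'. ring.
Qed.

Section Holomorphic.
Variables H A : C -> C.
Hypothesis HA : forall z, disc z -> wirtinger H z (A z) 0.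
Hypothesis HAc : continuous_on disc A.

Lemma holomorphic_series_on (r : R) : 0 < r < 1 -> exists h M,
  (forall j, Cmod (h j) * r ^ j <= M) /\ forall w, Cmod w < r -> H w = PS h w.
Proof.
  intros Hr. assert (HPI := PI_RGT_0).
  assert (HH : ccurve (fun t => H (RtoC r * circ t)%C)).
  { apply (ccurve_comp H (fun t => (RtoC r * circ t)%C)).
    - apply ccurve_mult; [apply ccurve_const|apply ccurve_circ1].
    - intros t eps Heps. apply (wirtinger_cont H _ _ _ (HA _ (disc_scal_circ r t ltac:(lra))) eps Heps). }
  destruct (ccurve_bounded _ HH) as [M [HM HM']].
  assert (H2PI : RtoC (2 * PI) <> RtoC 0) by (intros E; apply RtoC_inj in E; lra).
  exists (fun j => (/ RtoC (2 * PI) * cint (fun t => H (RtoC r * circ t) * (/ (RtoC r * circ t)) ^ j))%C), (2 * M).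
  split.
  - intros j.
    assert (Hrc : forall t, (RtoC r * circ t)%C <> RtoC 0).
    { intros t E. assert (X := Cmod_scal_circ r t ltac:(lra)). rewrite E, Cmod_0 in X. lra. }
    assert (B : Cmod (cint (fun t => H (RtoC r * circ t) * (/ (RtoC r * circ t)) ^ j)%C) <= 4 * PI * (M * / r ^ j)).
    { apply cint_bound.
      - apply ccurve_mult; [exact HH|]. apply ccurve_pow, ccurve_inv; [|exact Hrc].
        apply ccurve_mult; [apply ccurve_const|apply ccurve_circ1].
      - intros t Ht. rewrite Cmod_mult, Cmod_pow, Cmod_inv, Cmod_scal_circ, pow_inv; [|lra|apply Hrc].
        apply Rmult_le_compat_r; [left; apply Rinv_0_lt_compat, pow_lt; lra|apply HM', Ht]. }
    assert (Hrj : 0 < r ^ j) by (apply pow_lt; lra).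
    rewrite Cmod_mult, Cmod_inv, Cmod_R, (Rabs_pos_eq (2 * PI)) by (try exact H2PI; lra).
    apply Rle_trans with (/ (2 * PI) * (4 * PI * (M * / r ^ j)) * r ^ j).
    + apply Rmult_le_compat_r; [lra|]. apply Rmult_le_compat_l; [|exact B].
      left; apply Rinv_0_lt_compat; lra.
    + right. field. split; lra.
  - intros w Hw. symmetry. apply PS_unique.
    assert (X := cint_kappa_clim r w Hr Hw (fun t => H (RtoC r * circ t)%C) HH).
    assert (Y := cauchy_formula H A r w Hr Hw HA HAc). cbv beta zeta in X, Y. rewrite Y in X.
    apply (clim_scal (/ RtoC (2 * PI))) in X.
    replace (/ RtoC (2 * PI) * (RtoC (2 * PI) * H w))%C with (H w) in X by (field; exact H2PI).
    eapply is_lim_seq_ext; [|exact X]. intros n. cbv beta. rewrite <- csum_scal. do 2 f_equal.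
    apply csum_ext. intros j _. ring.
Qed.

Lemma holomorphic_series : exists h, rad1 h /\ forall z, disc z -> H z = PS h z.
Proof.
  destruct (holomorphic_series_on (/ 2) ltac:(lra)) as [h [M [Hh Hh']]].
  assert (X : forall r, / 2 <= r < 1 -> exists L,
    (forall j, Cmod (h j) * r ^ j <= L) /\ forall w, Cmod w < r -> H w = PS h w).
  { intros r Hr. destruct (holomorphic_series_on r ltac:(lra)) as [g [L [Hg Hg']]].
    assert (E : h = g).
    { apply (PS_coef_unique h g (/ 2) M L); [lra|exact Hh| |].
      - intros j. apply Rle_trans with (2 := Hg j).
        apply Rmult_le_compat_l; [apply Cmod_ge_0|]. apply pow_incr. lra.
      - intros w Hw. rewrite <- Hh', <- Hg' by lra. reflexivity. }
    subst g. exists L. split; assumption. }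
  exists h. split.
  - intros r Hr. destruct (X (Rmax r (/ 2))) as [L [HL _]].
    { split; [apply Rmax_r|apply Rmax_lub_lt; lra]. }
    exists L. split.
    + eapply Rle_trans; [|apply (HL O)]. simpl. rewrite Rmult_1_r. apply Cmod_ge_0.
    + intros j. apply Rle_trans with (2 := HL j). apply Rmult_le_compat_l; [apply Cmod_ge_0|].
      apply pow_incr. split; [lra|apply Rmax_l].
  - intros z Hz. unfold disc in Hz. assert (Hz0 := Cmod_ge_0 z).
    destruct (X ((1 + Cmod z) / 2)) as [L [_ HL]]; [lra|]. apply HL. lra.
Qed.
End Holomorphic.

(** * Polyanalytic functions are sums of polyanalytic series *)

Lemma continuous_on_lin (D : C -> Prop) (c d : C) (F G : C -> C) :
  continuous_on D F -> continuous_on D G -> continuous_on D (fun z => (c * F z + d * G z)%C).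
Proof.
  rewrite !continuous_on_Cmod. intros HF HG z Hz eps Heps.
  assert (Hc := Cmod_ge_0 c). assert (Hd := Cmod_ge_0 d).
  destruct (HF z Hz (eps / (2 * (Cmod c + 1)))) as [d1 [Hd1 Hd1']]; [apply Rdiv_lt_0_compat; lra|].
  destruct (HG z Hz (eps / (2 * (Cmod d + 1)))) as [d2 [Hd2 Hd2']]; [apply Rdiv_lt_0_compat; lra|].
  exists (Rmin d1 d2). split; [apply Rmin_pos; assumption|]. intros w Hw Hwz.
  apply Rmin_Rgt_l in Hwz as [Ha Hb]. specialize (Hd1' w Hw Ha). specialize (Hd2' w Hw Hb).
  replace (c * F w + d * G w - (c * F z + d * G z))%C
    with (c * (F w - F z) + d * (G w - G z))%C by ring.
  eapply Rle_lt_trans; [apply Cmod_triangle|]. rewrite !Cmod_mult.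
  assert (X : forall k u, 0 <= k -> 0 <= u -> u < eps / (2 * (k + 1)) -> k * u < eps / 2).
  { intros k u Hk Hu Hlt. apply Rle_lt_trans with ((k + 1) * u); [apply Rmult_le_compat_r; lra|].
    replace (eps / 2) with ((k + 1) * (eps / (2 * (k + 1)))) by (field; lra).
    apply Rmult_lt_compat_l; lra. }
  assert (X1 := X (Cmod c) _ Hc (Cmod_ge_0 _) Hd1').
  assert (X2 := X (Cmod d) _ Hd (Cmod_ge_0 _) Hd2'). lra.
Qed.

Lemma is_derive_lin (c d : C) (f g : R -> C) (t : R) :
  ex_derive (fun s => Re (f s)) t -> ex_derive (fun s => Im (f s)) t ->
  ex_derive (fun s => Re (g s)) t -> ex_derive (fun s => Im (g s)) t ->
  is_derive (fun s => Re (c * f s + d * g s)%C) t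
    (Re (c * (Derive (fun s => Re (f s)) t, Derive (fun s => Im (f s)) t)
       + d * (Derive (fun s => Re (g s)) t, Derive (fun s => Im (g s)) t))%C) /\
  is_derive (fun s => Im (c * f s + d * g s)%C) t
    (Im (c * (Derive (fun s => Re (f s)) t, Derive (fun s => Im (f s)) t)
       + d * (Derive (fun s => Re (g s)) t, Derive (fun s => Im (g s)) t))%C).
Proof.
  intros H1 H2 H3 H4.
  apply Derive_correct in H1. apply Derive_correct in H2.
  apply Derive_correct in H3. apply Derive_correct in H4.
  assert (S : forall (u : R -> R) l k, is_derive u t l -> is_derive (fun s => k * u s) t (k * l)).
  { intros u l k Hu. apply (is_derive_scal u t k l Hu). }
  split.
  - apply (is_derive_plus (fun s => fst c * Re (f s) - snd c * Im (f s))
      (fun s => fst d * Re (g s) - snd d * Im (g s)));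
    [apply (is_derive_minus (fun s => fst c * Re (f s)) (fun s => snd c * Im (f s)))
    |apply (is_derive_minus (fun s => fst d * Re (g s)) (fun s => snd d * Im (g s)))];
    apply S; assumption.
  - apply (is_derive_plus (fun s => fst c * Im (f s) + snd c * Re (f s))
      (fun s => fst d * Im (g s) + snd d * Re (g s)));
    [apply (is_derive_plus (fun s => fst c * Im (f s)) (fun s => snd c * Re (f s)))
    |apply (is_derive_plus (fun s => fst d * Im (g s)) (fun s => snd d * Re (g s)))];
    apply S; assumption.
Qed.

Lemma class_C_lin (n : nat) (c d : C) : forall F G, class_C n F -> class_C n G ->
  class_C n (fun z => (c * F z + d * G z)%C).
Proof.
  induction n as [|n IH]; intros F G [HFc HF] [HGc HG].
  - split; [apply continuous_on_lin; assumption|exact I].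
  - destruct HF as [HF1 [HF2 HF3]]. destruct HG as [HG1 [HG2 HG3]].
    split; [apply continuous_on_lin; assumption|].
    assert (Dx : forall z, disc z ->
      is_derive (fun t => Re (c * F (t, Im z) + d * G (t, Im z))%C) (Re z) (Re (c * dx F z + d * dx G z)%C) /\
      is_derive (fun t => Im (c * F (t, Im z) + d * G (t, Im z))%C) (Re z) (Im (c * dx F z + d * dx G z)%C)).
    { intros z Hz. destruct (HF1 z Hz) as [[A1 A2] _]. destruct (HG1 z Hz) as [[B1 B2] _].
      apply (is_derive_lin c d (fun t => F (t, Im z)) (fun t => G (t, Im z))); assumption. }
    assert (Dy : forall z, disc z ->
      is_derive (fun t => Re (c * F (Re z, t) + d * G (Re z, t))%C) (Im z) (Re (c * dy F z + d * dy G z)%C) /\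
      is_derive (fun t => Im (c * F (Re z, t) + d * G (Re z, t))%C) (Im z) (Im (c * dy F z + d * dy G z)%C)).
    { intros z Hz. destruct (HF1 z Hz) as [_ [A1 A2]]. destruct (HG1 z Hz) as [_ [B1 B2]].
      apply (is_derive_lin c d (fun t => F (Re z, t)) (fun t => G (Re z, t))); assumption. }
    split; [|split].
    + intros z Hz. destruct (Dx z Hz). destruct (Dy z Hz).
      split; split; eexists; eassumption.
    + apply (class_C_ext_disc n (fun z => (c * dx F z + d * dx G z)%C)).
      * intros z Hz. destruct (Dx z Hz) as [X1 X2]. symmetry. apply injective_projections.
        -- exact (is_derive_unique _ _ _ X1).
        -- exact (is_derive_unique _ _ _ X2).
      * apply IH; assumption.
    + apply (class_C_ext_disc n (fun z => (c * dy F z + d * dy G z)%C)).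
      * intros z Hz. destruct (Dy z Hz) as [X1 X2]. symmetry. apply injective_projections.
        -- exact (is_derive_unique _ _ _ X1).
        -- exact (is_derive_unique _ _ _ X2).
      * apply IH; assumption.
Qed.

Lemma class_C_dbar (n : nat) (F : C -> C) : class_C (S n) F -> class_C n (dbar F).
Proof.
  intros [_ [_ [Hx Hy]]].
  apply (class_C_ext_disc n (fun z => (RtoC (1 / 2) * dx F z + (RtoC (1 / 2) * Ci) * dy F z)%C)).
  - intros z _. unfold dbar. ring.
  - apply class_C_lin; assumption.
Qed.

Lemma class_C_continuous (n : nat) (F : C -> C) : class_C n F -> continuous_on disc F.
Proof. destruct n; intros [H _]; exact H. Qed.

(** By induction, [dbar F] is a polyanalytic series; subtracting from [F] the
    primitive of that series in the conjugate variable leaves a holomorphic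
    function, whose power series becomes the first row. *)
Lemma polyanalytic_series (K n : nat) : (n <= S K)%nat -> forall F, class_C n F ->
  (forall z, disc z -> Nat.iter n dbar F z = RtoC 0) ->
  exists a, admissible K a /\ (forall p j, (n <= p)%nat -> a p j = RtoC 0) /\
    forall z, disc z -> F z = polyseries K a z.
Proof.
  induction n as [|n IH]; intros Hn F HF H0.
  - exists (fun _ _ => RtoC 0). split; [|split].
    + split; [intros p; apply rad1_zero|reflexivity].
    + reflexivity.
    + intros z Hz. rewrite polyseries_zero. apply (H0 z Hz).
  - destruct (IH ltac:(lia) (dbar F) (class_C_dbar n F HF)) as [g [Hg [Hg0 HG]]].
    { intros z Hz. rewrite <- (H0 z Hz). symmetry.
      exact (f_equal (fun op => op z) (Nat.iter_succ_r n _ dbar F)). }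
    set (a := fun p j => match p with O => RtoC 0 | S p' => (/ RtoC (INR (S p')) * g p' j)%C end).
    assert (Ha : admissible K a).
    { split.
      - intros [|p]; [apply rad1_zero|]. apply (rad1_scal _ (g p)), Hg.
      - intros [|p] j Hp; [reflexivity|]. unfold a. rewrite Hg0 by lia. ring. }
    assert (Ea : arr_dzbar a = g).
    { apply arr_ext. intros p j. unfold arr_dzbar, a. field. intros E. apply RtoC_inj in E.
      revert E. apply not_0_INR. lia. }
    destruct HF as [HFc [HF1 [HF2 HF3]]].
    set (A := fun z => (/ 2 * (dx F z - Ci * dy F z) + -1 * polyseries K (arr_dz a) z)%C).
    set (H := fun z => (F z + -1 * polyseries K a z)%C).
    assert (HA : forall z, disc z -> wirtinger H z (A z) 0).
    { intros z Hz.
      assert (X := wirtinger_plus _ _ _ _ _ _ _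
        (wirtinger_of_partials F z HF1 (class_C_continuous n _ HF2) Hz)
        (wirtinger_scal (-1) _ _ _ _ (wirtinger_polyseries K a z Ha Hz))).
      rewrite Ea, <- (HG z Hz) in X.
      replace (RtoC 0) with (dbar F z + -1 * dbar F z)%C by (rewrite RtoC_m1; ring). exact X. }
    assert (HAc : continuous_on disc A).
    { unfold A.
      apply (continuous_on_ext_disc (fun z => (1 * (/ 2 * dx F z + (- / 2 * Ci) * dy F z)
         + -1 * polyseries K (arr_dz a) z)%C)); [intros; ring|].
      apply continuous_on_lin.
      - apply continuous_on_lin; eapply class_C_continuous; eassumption.
      - apply (class_C_continuous 0), class_C_polyseries, admissible_dz, Ha. }
    destruct (holomorphic_series H A HA HAc) as [h [Hh HH]].
    set (a0 := fun p j => match p with O => h j | S _ => RtoC 0 end).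
    assert (Ha0 : admissible K a0).
    { split; [intros [|p]; [exact Hh|apply rad1_zero]|]. intros [|p] j Hp; [lia|reflexivity]. }
    exists (arr_add a a0). split; [apply admissible_add; assumption|split].
    + intros [|p] j Hp; [lia|]. unfold arr_add, a, a0. rewrite Hg0 by lia. ring.
    + intros z Hz. rewrite (polyseries_add K a a0 z Ha Ha0 Hz).
      replace (polyseries K a0 z) with (PS h z).
      * rewrite <- (HH z Hz). unfold H. rewrite RtoC_m1. ring.
      * unfold polyseries. rewrite (csum_single _ (S K) 0).
        -- unfold a0. simpl. replace (fun j => h j) with h by reflexivity. ring.
        -- lia.
        -- intros [|p] _ Hp; [lia|]. unfold a0. rewrite PS_zero. ring.
Qed.

(** * Stretched exponentials *)

Lemma ln_le_linear (u d : R) : 0 < u -> 0 < d -> ln u <= d * u - 1 - ln d.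
Proof.
  intros Hu Hd. assert (H := exp_ineq1_le (ln (d * u))).
  rewrite exp_ln in H by (apply Rmult_lt_0_compat; lra).
  rewrite ln_mult in H by lra. lra.
Qed.

Lemma rpow_pos (x a : R) : 0 < x -> rpow x a = Rpower x a.
Proof. intros H. unfold rpow. destruct (Req_EM_T x 0); [lra|reflexivity]. Qed.

Lemma rpow_0_0 : rpow 0 0 = 1.
Proof. unfold rpow. destruct (Req_EM_T 0 0); [reflexivity|lra]. Qed.

Lemma rpow_0_pos (a : R) : a <> 0 -> rpow 0 a = 0.
Proof.
  intros H. unfold rpow. destruct (Req_EM_T 0 0); [|lra].
  destruct (Req_EM_T a 0); [contradiction|reflexivity].
Qed.

Lemma rpow_ge_0 (x a : R) : 0 <= rpow x a.
Proof.
  unfold rpow. destruct (Req_EM_T x 0); [destruct (Req_EM_T a 0); lra|].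
  left. apply exp_pos.
Qed.

Lemma exp_le (x y : R) : x <= y -> exp x <= exp y.
Proof. intros [H|H]; [left; apply exp_increasing; exact H|rewrite H; lra]. Qed.

Lemma Rpower_mono (x y a : R) : 0 < x <= y -> 0 <= a -> Rpower x a <= Rpower y a.
Proof.
  intros [Hx Hxy] Ha. unfold Rpower. apply exp_le. apply Rmult_le_compat_l; [exact Ha|].
  destruct Hxy as [H|H]; [left; apply ln_increasing; assumption|rewrite H; lra].
Qed.

(** The maximum over [x] of [x ^ M * exp (- b * x ^ g)] grows like
    [M ^ (M / g)], up to a geometric factor. *)
Lemma pow_exp_bound (s g b : R) : 0 < s -> s * g = 1 -> 0 < b ->
  exists Cst, 0 < Cst /\ forall (M : nat) (x : R), 0 < x ->
    x ^ M * exp (- b * Rpower x g) <= Cst ^ M * rpow (INR M) (s * INR M).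
Proof.
  intros Hs Hsg Hb. exists (exp (s * (ln s - ln b - 1))). split; [apply exp_pos|].
  intros M x Hx. set (u := Rpower x g). assert (Hu : 0 < u) by apply exp_pos.
  destruct M as [|M].
  - simpl INR. rewrite Rmult_0_r, rpow_0_0. simpl. rewrite !Rmult_1_l.
    rewrite <- exp_0. apply exp_le. assert (0 < b * u) by (apply Rmult_lt_0_compat; lra). lra.
  - set (m := INR (S M)). assert (Hm : 0 < m) by (apply lt_0_INR; lia).
    rewrite rpow_pos by exact Hm. rewrite <- !Rpower_pow by (try apply exp_pos; exact Hx).
    fold m. unfold Rpower. rewrite <- !exp_plus, ln_exp. apply exp_le.
    assert (Hlx : ln x = s * ln u).
    { unfold u, Rpower. rewrite ln_exp. rewrite <- Rmult_assoc, Hsg. ring. }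
    rewrite Hlx. fold u.
    assert (Hd : 0 < b / (s * m)) by (apply Rdiv_lt_0_compat; [lra|apply Rmult_lt_0_compat; lra]).
    assert (L := ln_le_linear u (b / (s * m)) Hu Hd).
    assert (Hsm : 0 < s * m) by (apply Rmult_lt_0_compat; lra).
    unfold Rdiv in L at 2. rewrite ln_mult, ln_Rinv, ln_mult in L;
      [|lra|lra|lra|lra|apply Rinv_0_lt_compat; lra].
    assert (L2 : s * m * ln u <= s * m * (b / (s * m) * u - 1 - (ln b + - (ln s + ln m))))
      by (apply Rmult_le_compat_l; lra).
    replace (s * m * (b / (s * m) * u - 1 - (ln b + - (ln s + ln m))))
      with (b * u + s * m * (-1 - ln b + ln s + ln m)) in L2 by (field; lra).
    lra.
Qed.

(** The weight [exp (- b * (j + 1) ^ g)]. *)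
Definition weight (g b : R) (j : nat) : R := exp (- b * Rpower (INR (S j)) g).

Lemma weight_pos (g b : R) (j : nat) : 0 < weight g b j.
Proof. apply exp_pos. Qed.

Lemma weight_half (g b : R) (j : nat) : weight g b j = weight g (b / 2) j * weight g (b / 2) j.
Proof. unfold weight. rewrite <- exp_plus. f_equal. field. Qed.

Lemma INR_S_ge_1 (j : nat) : 1 <= INR (S j).
Proof. rewrite S_INR. assert (H := pos_INR j). lra. Qed.

Lemma weight_decr (g b : R) (j : nat) : 0 < g -> 0 < b -> weight g b (S j) <= weight g b j.
Proof.
  intros Hg Hb. unfold weight. apply exp_le.
  assert (X : Rpower (INR (S j)) g <= Rpower (INR (S (S j))) g).
  { apply Rpower_mono; [|lra]. split; [apply lt_0_INR; lia|apply le_INR; lia]. }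
  assert (b * Rpower (INR (S j)) g <= b * Rpower (INR (S (S j))) g)
    by (apply Rmult_le_compat_l; lra). lra.
Qed.

Lemma pow_weight_bound (g b : R) (c : nat) : 0 < g -> 0 < b -> exists L, 0 < L /\
  forall j, INR (S j) ^ c * weight g b j <= L * weight g (b / 2) j.
Proof.
  intros Hg Hb.
  destruct (pow_exp_bound (/ g) g (b / 2) ltac:(apply Rinv_0_lt_compat; lra)
    ltac:(field; lra) ltac:(lra)) as [C0 [HC0 HC]].
  exists (C0 ^ c * rpow (INR c) (/ g * INR c) + 1).
  assert (Hp : 0 <= C0 ^ c * rpow (INR c) (/ g * INR c))
    by (apply Rmult_le_pos; [apply pow_le; lra|apply rpow_ge_0]).
  split; [lra|].
  intros j. rewrite weight_half, <- Rmult_assoc.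
  apply Rmult_le_compat_r; [left; apply weight_pos|].
  eapply Rle_trans; [apply (HC c (INR (S j))); apply lt_0_INR; lia|]. lra.
Qed.

(** The weight divided by [j + 1]. Up to a constant factor, and with [b / 2] in
    place of [b], the decrements of this sequence dominate the weights, so that it
    bounds the remainders of their series. *)
Definition wtail (g b : R) (j : nat) : R := weight g b j / INR (S j).

Lemma weight_telescope (g b : R) : 0 < g -> 0 < b -> exists L, 0 < L /\
  forall j, weight g b j <= L * wtail g (b / 2) j - L * wtail g (b / 2) (S j).
Proof.
  intros Hg Hb. destruct (pow_weight_bound g b 2 Hg Hb) as [L [HL HL']].
  exists (2 * L). split; [lra|]. intros j. unfold wtail.
  assert (Hj := INR_S_ge_1 j). assert (Ejj : INR (S (S j)) = INR (S j) + 1) by apply S_INR.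
  set (x := INR (S j)) in *. rewrite Ejj.
  assert (W := weight_decr g (b / 2) j Hg ltac:(lra)).
  set (w := weight g (b / 2) j) in *. set (w' := weight g (b / 2) (S j)) in *.
  assert (Hw : 0 < w) by apply weight_pos.
  apply Rle_trans with (2 * L * w * (/ x - / (x + 1))).
  - assert (X : x ^ 2 * weight g b j <= L * w) by apply HL'.
    assert (Y : / x - / (x + 1) = / (x * (x + 1))) by (field; lra).
    rewrite Y.
    apply Rmult_le_reg_r with (x * (x + 1)); [apply Rmult_lt_0_compat; lra|].
    rewrite Rmult_assoc, Rinv_l, Rmult_1_r by (apply Rgt_not_eq, Rmult_lt_0_compat; lra).
    apply Rle_trans with (2 * (x ^ 2 * weight g b j)); [|lra].
    assert (Hwb := weight_pos g b j).
    replace (2 * (x ^ 2 * weight g b j)) with (weight g b j * (2 * x ^ 2)) by ring.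
    apply Rmult_le_compat_l; [lra|]. nra.
  - assert (X : w' * / (x + 1) <= w * / (x + 1)).
    { apply Rmult_le_compat_r; [|exact W]. left; apply Rinv_0_lt_compat; lra. }
    assert (Y : L * (w' * / (x + 1)) <= L * (w * / (x + 1))) by (apply Rmult_le_compat_l; lra).
    unfold Rdiv. lra.
Qed.

Lemma wtail_pos (g b : R) (j : nat) : 0 < wtail g b j.
Proof. apply Rdiv_lt_0_compat; [apply weight_pos|apply lt_0_INR; lia]. Qed.

Lemma wtail_le_weight (g b : R) (j : nat) : wtail g b j <= weight g b j.
Proof.
  unfold wtail. assert (Hj := INR_S_ge_1 j). assert (Hw := weight_pos g b j).
  rewrite <- (Rmult_1_r (weight g b j)) at 2. apply Rmult_le_compat_l; [lra|].
  rewrite <- Rinv_1. apply Rinv_le_contravar; lra.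
Qed.

Lemma is_lim_seq_inv_INR (L : R) : is_lim_seq (fun n => L / INR (S n)) 0.
Proof.
  replace (Finite 0) with (Rbar_mult L 0) by (simpl; f_equal; ring).
  apply is_lim_seq_scal_l. apply (is_lim_seq_incr_1 (fun n => / INR n)).
  replace (Finite 0) with (Rbar_inv p_infty) by reflexivity.
  apply is_lim_seq_inv; [apply is_lim_seq_INR|discriminate].
Qed.

Lemma weight_le_1 (g b : R) (j : nat) : 0 < b -> weight g b j <= 1.
Proof.
  intros Hb. unfold weight. rewrite <- exp_0. apply exp_le.
  assert (H : 0 < b * Rpower (INR (S j)) g) by (apply Rmult_lt_0_compat; [lra|apply exp_pos]). lra.
Qed.

Lemma wtail_lim (g b L : R) : 0 < b -> 0 <= L -> is_lim_seq (fun n => L * wtail g b n) 0.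
Proof.
  intros Hb HL. apply is_lim_seq_le_le with (u := fun _ => 0) (w := fun n => L / INR (S n)).
  - intros n. assert (H1 := wtail_pos g b n). split; [apply Rmult_le_pos; lra|].
    unfold wtail, Rdiv. apply Rmult_le_compat_l; [exact HL|].
    assert (H2 := weight_le_1 g b n Hb).
    rewrite <- (Rmult_1_l (/ INR (S n))) at 2. apply Rmult_le_compat_r; [|exact H2].
    left. apply Rinv_0_lt_compat, lt_0_INR. lia.
  - apply is_lim_seq_const.
  - apply is_lim_seq_inv_INR.
Qed.

Lemma weight_lim (g b L : R) : 0 < g -> 0 < b -> 0 <= L -> is_lim_seq (fun n => L * weight g b n) 0.
Proof.
  intros Hg Hb HL. destruct (pow_weight_bound g b 1 Hg Hb) as [M [HM HM']].
  apply is_lim_seq_le_le with (u := fun _ => 0) (w := fun n => (L * M) / INR (S n)).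
  - intros n. assert (H1 := weight_pos g b n). split; [apply Rmult_le_pos; lra|].
    assert (Hn := INR_S_ge_1 n). unfold Rdiv. rewrite Rmult_assoc. apply Rmult_le_compat_l; [exact HL|].
    apply Rmult_le_reg_r with (INR (S n)); [lra|].
    rewrite Rmult_assoc, Rinv_l, Rmult_1_r by lra.
    specialize (HM' n). rewrite pow_1 in HM'. assert (H2 := weight_le_1 g (b / 2) n ltac:(lra)).
    assert (M * weight g (b / 2) n <= M * 1) by (apply Rmult_le_compat_l; lra). lra.
  - apply is_lim_seq_const.
  - apply is_lim_seq_inv_INR.
Qed.

(** The coefficients of the array decay like a stretched exponential. *)
Definition decays (g : R) (a : nat -> nat -> C) : Prop :=
  exists A b, 0 < A /\ 0 < b /\ forall p j, Cmod (a p j) <= A * weight g b j.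

(** * Decay of the coefficients of a Gevrey polyanalytic function *)

Lemma sup_norm_elem (E : C -> Prop) (h : C -> C) (M : R) (u : C) :
  Rbar_le (sup_norm E h) M -> E u -> Cmod (h u) <= M.
Proof.
  intros H Hu. unfold sup_norm in H.
  destruct (Lub_Rbar_correct (fun r => exists u, E u /\ r = Cmod (h u))) as [H1 _].
  assert (X := Rbar_le_trans _ _ _ (H1 (Cmod (h u)) (ex_intro _ u (conj Hu eq_refl))) H). exact X.
Qed.

Lemma sup_norm_le (E : C -> Prop) (h : C -> C) (M : R) :
  (forall u, E u -> Cmod (h u) <= M) -> Rbar_le (sup_norm E h) M.
Proof.
  intros H. unfold sup_norm.
  destruct (Lub_Rbar_correct (fun r => exists u, E u /\ r = Cmod (h u))) as [_ H1].
  apply H1. intros r [u [Hu ->]]. apply H, Hu.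
Qed.

Lemma arr_dz_add (a b : nat -> nat -> C) : arr_dz (arr_add a b) = arr_add (arr_dz a) (arr_dz b).
Proof. apply arr_ext. intros p j. unfold arr_dz, arr_add, dcoef. ring. Qed.

Lemma arr_dz_scal (c : C) (a : nat -> nat -> C) : arr_dz (arr_scal c a) = arr_scal c (arr_dz a).
Proof. apply arr_ext. intros p j. unfold arr_dz, arr_scal, dcoef. ring. Qed.

Lemma arr_dx_dy (a : nat -> nat -> C) : arr_dx (arr_dy a) = arr_dy (arr_dx a).
Proof.
  apply arr_ext. intros p j.
  unfold arr_dx, arr_dy, arr_dz, arr_dzbar, arr_add, arr_scal, dcoef. ring.
Qed.

(** The derivative with respect to z in terms of the partial derivatives. *)
Lemma arr_dz_dx_dy (a : nat -> nat -> C) :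
  arr_dz a = arr_add (arr_scal (/ 2) (arr_dx a)) (arr_scal (- (Ci / 2)) (arr_dy a)).
Proof.
  apply arr_ext. intros p j. unfold arr_dy, arr_dx, arr_add, arr_scal.
  replace (- (Ci / 2) * (Ci * (arr_dz a p j + -1 * arr_dzbar a p j)))%C
    with (- (Ci * Ci) / 2 * (arr_dz a p j + -1 * arr_dzbar a p j))%C by field.
  rewrite Ci_sqr, RtoC_m1. field.
Qed.

Lemma iter_arr_dz_bound (K : nat) (a : nat -> nat -> C) (Bd : nat -> R) : admissible K a ->
  (forall a1 a2 z, disc z ->
     Cmod (polyseries K (Nat.iter a1 arr_dx (Nat.iter a2 arr_dy a)) z) <= Bd (a1 + a2)%nat) ->
  forall m a1 a2 z, disc z ->
  Cmod (polyseries K (Nat.iter m arr_dz (Nat.iter a1 arr_dx (Nat.iter a2 arr_dy a))) z)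
    <= Bd (m + a1 + a2)%nat.
Proof.
  intros Ha H m. induction m as [|m IH]; intros a1 a2 z Hz; [apply H; exact Hz|].
  set (b := Nat.iter a1 arr_dx (Nat.iter a2 arr_dy a)).
  assert (Hb : admissible K b).
  { apply admissible_iter; [apply admissible_dx|]. apply admissible_iter; [apply admissible_dy|exact Ha]. }
  assert (E1 : arr_dx b = Nat.iter (S a1) arr_dx (Nat.iter a2 arr_dy a)) by reflexivity.
  assert (E2 : arr_dy b = Nat.iter a1 arr_dx (Nat.iter (S a2) arr_dy a)).
  { unfold b. simpl. clear. induction a1 as [|n IHn]; [reflexivity|]. simpl.
    rewrite <- arr_dx_dy, IHn. reflexivity. }
  assert (Em : forall m, Nat.iter (S m) arr_dz b =
     arr_add (arr_scal (/ 2) (Nat.iter m arr_dz (arr_dx b)))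
             (arr_scal (- (Ci / 2)) (Nat.iter m arr_dz (arr_dy b)))).
  { clear. intros m. induction m as [|m IHm].
    - apply arr_dz_dx_dy.
    - change (Nat.iter (S (S m)) arr_dz b) with (arr_dz (Nat.iter (S m) arr_dz b)).
      rewrite IHm, arr_dz_add, !arr_dz_scal. reflexivity. }
  rewrite Em.
  assert (Hx : admissible K (Nat.iter m arr_dz (arr_dx b))).
  { apply admissible_iter; [apply admissible_dz|apply admissible_dx, Hb]. }
  assert (Hy : admissible K (Nat.iter m arr_dz (arr_dy b))).
  { apply admissible_iter; [apply admissible_dz|apply admissible_dy, Hb]. }
  rewrite polyseries_add, !polyseries_scal; auto using admissible_scal.
  assert (X1 := IH (S a1) a2 z Hz). assert (X2 := IH a1 (S a2) z Hz).
  rewrite <- E1 in X1. rewrite <- E2 in X2.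
  replace (m + S a1 + a2)%nat with (S m + a1 + a2)%nat in X1 by lia.
  replace (m + a1 + S a2)%nat with (S m + a1 + a2)%nat in X2 by lia.
  eapply Rle_trans; [apply Cmod_triangle|]. rewrite !Cmod_mult, Cmod_opp.
  assert (H2 : RtoC 2 <> RtoC 0) by (intros E; apply RtoC_inj in E; lra).
  rewrite Cmod_div, Cmod_Ci, Cmod_inv, Cmod_R, Rabs_pos_eq by (try exact H2; lra). lra.
Qed.

Lemma iter_arr_dz_lower (a : nat -> nat -> C) (m p : nat) : forall j,
  INR (S j) ^ m * Cmod (a p (j + m)%nat) <= Cmod (Nat.iter m arr_dz a p j).
Proof.
  induction m as [|m IH]; intros j.
  - rewrite Nat.add_0_r. simpl. lra.
  - change (Nat.iter (S m) arr_dz a p j)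
      with (RtoC (INR (S j)) * Nat.iter m arr_dz a p (S j))%C.
    rewrite Cmod_mult, Cmod_R, Rabs_pos_eq by apply pos_INR.
    rewrite <- tech_pow_Rmult, Rmult_assoc. apply Rmult_le_compat_l; [apply pos_INR|].
    eapply Rle_trans; [|apply (IH (S j))].
    replace (S j + m)%nat with (j + S m)%nat by lia.
    apply Rmult_le_compat_r; [apply Cmod_ge_0|]. apply pow_incr.
    split; [apply pos_INR|apply le_INR; lia].
Qed.

Lemma rpow_INR_le (s x y : R) (m : nat) : 0 < s -> 0 < x -> INR m <= y ->
  Rpower y s = x -> rpow (INR m) (s * INR m) <= x ^ m.
Proof.
  intros Hs Hx Hm Hy. destruct m as [|m].
  - simpl INR. rewrite Rmult_0_r, rpow_0_0. simpl. lra.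
  - assert (Hm0 : 0 < INR (S m)) by (apply lt_0_INR; lia).
    rewrite rpow_pos by exact Hm0. rewrite <- Rpower_mult, Rpower_pow by apply exp_pos.
    apply pow_incr. split; [left; apply exp_pos|]. rewrite <- Hy. apply Rpower_mono; lra.
Qed.

(** The coefficient of index [J] is estimated through the derivative of order [m]
    with respect to z, where [m] is the integral part of [((J + 1) / D) ^ g]. The
    constant [D] is proportional to [max B 1], and large enough for [m] to be at
    most [(J + 1) / 4] and for the bound to contain a factor [exp (- m)]. *)
Lemma gevrey_decays (K : nat) (s g B : R) (a : nat -> nat -> C) :
  1 <= s -> s * g = 1 -> 0 < B -> admissible K a ->
  (forall a1 a2 z, disc z ->
     Cmod (polyseries K (Nat.iter a1 arr_dx (Nat.iter a2 arr_dy a)) z)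
       <= B ^ (a1 + a2 + 1) * rpow (INR (a1 + a2)) (s * INR (a1 + a2))) ->
  decays g a.
Proof.
  intros Hs Hsg HB Ha H.
  assert (Hg : 0 < g) by nra. assert (Hg1 : g <= 1) by nra.
  destruct (polyseries_coef_bound K) as [Cst [HCst HC]].
  set (B1 := Rmax B 1). assert (HB1 : B <= B1 /\ 1 <= B1) by (split; [apply Rmax_l|apply Rmax_r]).
  set (e := exp 1). assert (He : 1 < e) by (unfold e; assert (X := exp_ineq1 1); lra).
  set (D := 4 * B1 * e).
  assert (HD : 4 <= D).
  { unfold D. assert (1 * 1 <= B1 * e) by (apply Rmult_le_compat; lra). lra. }
  set (b0 := Rpower (/ D) g). assert (Hb0 : 0 < b0) by apply exp_pos.
  destruct (pow_weight_bound g b0 (S K) Hg Hb0) as [L [HL HL']].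
  exists (Cst * B1 * e * L), (b0 / 2).
  assert (HA : 0 < Cst * B1 * e) by (repeat apply Rmult_lt_0_compat; lra).
  split; [apply Rmult_lt_0_compat; lra|split; [lra|]].
  intros p J. set (x := INR (S J)). assert (Hx : 1 <= x) by apply INR_S_ge_1.
  assert (Hxd : 0 < x / D) by (apply Rdiv_lt_0_compat; lra).
  set (y := Rpower (x / D) g). assert (Hy : 0 < y) by apply exp_pos.
  assert (Ey : y = b0 * Rpower x g).
  { unfold y, b0, Rdiv. rewrite Rmult_comm, Rpower_mult_distr; [reflexivity| |lra].
    apply Rinv_0_lt_compat; lra. }
  assert (Eys : Rpower y s = x / D).
  { unfold y. rewrite Rpower_mult, Rmult_comm, Hsg. apply Rpower_1. exact Hxd. }
  destruct (nfloor_ex y (Rlt_le _ _ Hy)) as [m [Hm1 Hm2]].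
  assert (Hmx : INR m <= x / 4).
  { destruct m as [|m]; [simpl; lra|].
    assert (Hy1 : 1 <= y) by (assert (X := INR_S_ge_1 m); lra).
    assert (Hxd1 : 1 <= x / D).
    { destruct (Rle_lt_dec 1 (x / D)) as [X|X]; [exact X|exfalso].
      assert (Y : y < 1).
      { unfold y, Rpower. rewrite <- exp_0. apply exp_increasing.
        assert (Z : ln (x / D) < 0) by (rewrite <- ln_1; apply ln_increasing; lra). nra. }
      lra. }
    assert (Y : y <= x / D).
    { rewrite <- (Rpower_1 (x / D)) at 1 by exact Hxd. unfold y. apply Rle_Rpower; lra. }
    assert (Z : x / D <= x / 4).
    { apply Rmult_le_compat_l; [lra|]. apply Rinv_le_contravar; lra. }
    lra. }
  assert (HmJ : (m <= J)%nat).
  { apply INR_le. unfold x in Hmx. rewrite S_INR in Hmx. assert (X := pos_INR J).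
    assert (INR m < INR J + 1) by lra. rewrite <- S_INR in H0. apply INR_lt in H0.
    apply le_INR. lia. }
  set (j := (J - m)%nat). assert (EJ : J = (j + m)%nat) by (unfold j; lia).
  assert (Hj : x / 2 <= INR (S j)).
  { assert (Ex : x = INR J + 1) by apply S_INR.
    assert (Ej : INR J = INR j + INR m) by (rewrite EJ at 1; apply plus_INR).
    rewrite S_INR. lra. }
  assert (U := HC (Nat.iter m arr_dz a) _ (admissible_iter K arr_dz m a (admissible_dz K) Ha)
    (fun z Hz => iter_arr_dz_bound K a
      (fun M => B ^ (M + 1) * rpow (INR M) (s * INR M)) Ha H m 0 0 z Hz) p j).
  rewrite !Nat.add_0_r in U.
  assert (V := iter_arr_dz_lower a m p j). rewrite <- EJ in V.
  assert (HaJ := Cmod_ge_0 (a p J)).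
  assert (R1 := rpow_INR_le s (x / D) y m ltac:(lra) Hxd Hm1 Eys).
  assert (HBm : B ^ (m + 1) <= B1 * B1 ^ m).
  { rewrite Nat.add_1_r, tech_pow_Rmult. apply pow_incr. lra. }
  assert (Hx2 : 0 < (x / 2) ^ m) by (apply pow_lt; lra).
  assert (Hjx : INR (S j) ^ S K <= x ^ S K).
  { apply pow_incr. split; [apply pos_INR|]. unfold x. apply le_INR. lia. }
  assert (HxK : 0 < x ^ S K) by (apply pow_lt; lra).
  assert (W : (x / 2) ^ m * Cmod (a p J) <= Cst * x ^ S K * (B1 * B1 ^ m * (x / D) ^ m)).
  { apply Rle_trans with (INR (S j) ^ m * Cmod (a p J)).
    - apply Rmult_le_compat_r; [exact HaJ|]. apply pow_incr. lra.
    - apply Rle_trans with (1 := V). apply Rle_trans with (1 := U).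
      assert (P1 : 0 <= B ^ (m + 1)) by (apply pow_le; lra).
      assert (P2 := rpow_ge_0 (INR m) (s * INR m)).
      apply Rmult_le_compat.
      + apply Rmult_le_pos; [lra|apply pow_le, pos_INR].
      + apply Rmult_le_pos; assumption.
      + apply Rmult_le_compat_l; [lra|exact Hjx].
      + apply Rmult_le_compat; assumption. }
  assert (Eq : B1 ^ m * (x / D) ^ m = (x / 2) ^ m * (/ (2 * e)) ^ m).
  { rewrite <- !Rpow_mult_distr. f_equal. unfold D. field. lra. }
  assert (W2 : Cmod (a p J) <= Cst * B1 * x ^ S K * (/ (2 * e)) ^ m).
  { apply Rmult_le_reg_l with ((x / 2) ^ m); [exact Hx2|]. apply Rle_trans with (1 := W).
    right. rewrite Rmult_assoc with (r1 := B1), Eq. ring. }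
  assert (W3 : (/ (2 * e)) ^ m <= e * exp (- y)).
  { apply Rle_trans with ((/ e) ^ m).
    - apply pow_incr. split; [left; apply Rinv_0_lt_compat; lra|].
      apply Rinv_le_contravar; lra.
    - unfold e. rewrite <- exp_Ropp, <- (Rpower_pow m (exp (- (1)))) by apply exp_pos.
      unfold Rpower. rewrite ln_exp, <- exp_plus. apply exp_le. lra. }
  assert (HCB : 0 <= Cst * B1 * x ^ S K).
  { apply Rmult_le_pos; [|lra]. apply Rlt_le, Rmult_lt_0_compat; lra. }
  apply Rle_trans with (Cst * B1 * x ^ S K * (e * exp (- y))).
  { apply Rle_trans with (1 := W2). apply Rmult_le_compat_l; assumption. }
  specialize (HL' J). fold x in HL'.
  replace (exp (- y)) with (weight g b0 J) by (unfold weight; fold x; f_equal; rewrite Ey; ring).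
  replace (Cst * B1 * x ^ S K * (e * weight g b0 J))
    with (Cst * B1 * e * (x ^ S K * weight g b0 J)) by ring.
  rewrite (Rmult_assoc (Cst * B1 * e)). apply Rmult_le_compat_l; lra.
Qed.

(** * Gevrey bounds from the decay of the coefficients *)

Lemma decays_admissible (g : R) (K : nat) (a : nat -> nat -> C) : 
  decays g a -> (forall p j, (K < p)%nat -> a p j = RtoC 0) -> admissible K a.
Proof.
  intros [A [b [HA [Hb H]]]] H0. split; [|exact H0].
  intros p. apply rad1_bounded with A. intros j. apply Rle_trans with (1 := H p j).
  assert (X := weight_le_1 g b j Hb).
  apply Rle_trans with (A * 1); [apply Rmult_le_compat_l; lra|lra].
Qed.

(** The moments of the array are bounded by [mu]. The exponent is shifted by two,
    so that the moment of index zero already controls the sum of the moduli of the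
    coefficients in a row. *)
Definition moments (a : nat -> nat -> C) (mu : nat -> R) : Prop :=
  forall i p j, Cmod (a p j) * INR (S j) ^ (i + 2) <= mu i.

Lemma moments_op (K : nat) (a b : nat -> nat -> C) (mu : nat -> R) :
  (forall p j, (K < p)%nat -> a p j = RtoC 0) ->
  (forall p j, Cmod (b p j) <= Cmod (arr_dz a p j) + Cmod (arr_dzbar a p j)) ->
  moments a mu -> moments b (fun i => INR (K + 2) * mu (S i)).
Proof.
  intros H0 Hb H i p j.
  assert (Hp : 0 <= INR (S j) ^ (i + 2)) by apply pow_le, pos_INR.
  assert (X1 : Cmod (arr_dz a p j) * INR (S j) ^ (i + 2) <= mu (S i)).
  { unfold arr_dz, dcoef. rewrite Cmod_mult, Cmod_R, Rabs_pos_eq by apply pos_INR.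
    eapply Rle_trans; [|apply (H (S i) p (S j))].
    replace (INR (S j) * Cmod (a p (S j)) * INR (S j) ^ (i + 2))
      with (Cmod (a p (S j)) * INR (S j) ^ (S i + 2)) by (simpl; ring).
    apply Rmult_le_compat_l; [apply Cmod_ge_0|]. apply pow_incr.
    split; [apply pos_INR|apply le_INR; lia]. }
  assert (Hmu : 0 <= mu (S i)).
  { eapply Rle_trans; [|exact X1]. apply Rmult_le_pos; [apply Cmod_ge_0|exact Hp]. }
  assert (X2 : Cmod (arr_dzbar a p j) * INR (S j) ^ (i + 2) <= INR (S K) * mu (S i)).
  { unfold arr_dzbar. rewrite Cmod_mult, Cmod_R, Rabs_pos_eq by apply pos_INR.
    destruct (Nat.lt_ge_cases K (S p)) as [Hk|Hk].
    - rewrite H0, Cmod_0 by exact Hk. rewrite Rmult_0_r, Rmult_0_l.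
      apply Rmult_le_pos; [apply pos_INR|exact Hmu].
    - rewrite Rmult_assoc. apply Rmult_le_compat; [apply pos_INR| |apply le_INR; lia|].
      + apply Rmult_le_pos; [apply Cmod_ge_0|exact Hp].
      + eapply Rle_trans; [|apply (H (S i) (S p) j)].
        apply Rmult_le_compat_l; [apply Cmod_ge_0|]. apply Rle_pow; [apply INR_S_ge_1|lia]. }
  replace (INR (K + 2)) with (1 + INR (S K)) by (rewrite plus_INR, S_INR; simpl; ring).
  apply Rle_trans with ((Cmod (arr_dz a p j) + Cmod (arr_dzbar a p j)) * INR (S j) ^ (i + 2)).
  - apply Rmult_le_compat_r; [exact Hp|apply Hb].
  - lra.
Qed.

Lemma moments_dx (K : nat) (a : nat -> nat -> C) (mu : nat -> R) :
  admissible K a -> moments a mu -> moments (arr_dx a) (fun i => INR (K + 2) * mu (S i)).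
Proof.
  intros [_ H0]. apply moments_op; [exact H0|]. intros p j. apply Cmod_triangle.
Qed.

Lemma moments_dy (K : nat) (a : nat -> nat -> C) (mu : nat -> R) :
  admissible K a -> moments a mu -> moments (arr_dy a) (fun i => INR (K + 2) * mu (S i)).
Proof.
  intros [_ H0]. apply moments_op; [exact H0|]. intros p j.
  unfold arr_dy, arr_scal, arr_add. rewrite Cmod_mult, Cmod_Ci, Rmult_1_l.
  eapply Rle_trans; [apply Cmod_triangle|]. rewrite (Cmod_mult (-1)), Cmod_R.
  replace (Rabs (-1)) with 1 by (rewrite Rabs_left; lra). lra.
Qed.

Lemma moments_iter (K : nat) (o : (nat -> nat -> C) -> nat -> nat -> C) (n : nat)
  (a : nat -> nat -> C) (mu : nat -> R) :
  (forall b, admissible K b -> admissible K (o b)) ->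
  (forall b nu, admissible K b -> moments b nu -> moments (o b) (fun i => INR (K + 2) * nu (S i))) ->
  admissible K a -> moments a mu ->
  moments (Nat.iter n o a) (fun i => INR (K + 2) ^ n * mu (i + n)%nat).
Proof.
  intros Ho Hm Ha H. induction n as [|n IH].
  - intros i p j. simpl. rewrite Nat.add_0_r, Rmult_1_l. apply H.
  - intros i p j. assert (X := Hm _ _ (admissible_iter K o n a Ho Ha) IH i p j).
    replace (i + S n)%nat with (S i + n)%nat by lia.
    rewrite <- (tech_pow_Rmult (INR (K + 2))), Rmult_assoc. exact X.
Qed.

Lemma PS_moment_bound (b : nat -> C) (z : C) (L : R) : Cmod z <= 1 ->
  (forall j, Cmod (b j) * INR (S j) ^ 2 <= L) -> Cmod (PS b z) <= 2 * L.
Proof.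
  intros Hz Hb.
  assert (HL : 0 <= L).
  { eapply Rle_trans; [|apply (Hb O)]. apply Rmult_le_pos; [apply Cmod_ge_0|apply pow_le, pos_INR]. }
  destruct (csum_clim (fun j => (b j * z ^ j)%C) (fun n => 2 * L / INR (S n))) as [l [Hl Hn]].
  - apply is_lim_seq_inv_INR.
  - intros j. specialize (Hb j). assert (Hj := INR_S_ge_1 j). rewrite (S_INR (S j)).
    set (x := INR (S j)) in *. rewrite Cmod_mult, Cmod_pow.
    assert (Hzj := pow_le_one (Cmod z) j (conj (Cmod_ge_0 z) Hz)).
    assert (Hb0 := Cmod_ge_0 (b j)).
    apply Rle_trans with (Cmod (b j) * 1); [apply Rmult_le_compat_l; lra|].
    replace (2 * L / x - 2 * L / (x + 1)) with (2 * L * / (x * (x + 1))) by (field; lra).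
    apply Rmult_le_reg_r with (x * (x + 1)); [apply Rmult_lt_0_compat; lra|].
    rewrite (Rmult_assoc (2 * L)), Rinv_l, !Rmult_1_r by (apply Rgt_not_eq, Rmult_lt_0_compat; lra).
    apply Rle_trans with (2 * (Cmod (b j) * x ^ 2)); [|lra].
    replace (2 * (Cmod (b j) * x ^ 2)) with (Cmod (b j) * (2 * x ^ 2)) by ring.
    apply Rmult_le_compat_l; [exact Hb0|nra].
  - rewrite (PS_unique b z l Hl). specialize (Hn O). simpl in Hn.
    rewrite Cmod_minus_sym in Hn. replace (l - 0)%C with l in Hn by ring. lra.
Qed.

Lemma decays_gevrey (K : nat) (k : R) (a : nat -> nat -> C) (f : C -> C) : 0 < k ->
  decays (k / (k + 1)) a -> (forall p j, (K < p)%nat -> a p j = RtoC 0) ->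
  (forall z, disc z -> f z = polyseries K a z) -> gevrey_polyanalytic (S K) k f.
Proof.
  intros Hk Hdec H0 Hf. assert (Ha := decays_admissible _ K a Hdec H0).
  split; [apply (polyanalytic_polyseries K a f Ha Hf)|].
  destruct Hdec as [A [b [HA [Hb H]]]].
  set (g := k / (k + 1)) in *. assert (Hg : 0 < g) by (apply Rdiv_lt_0_compat; lra).
  set (s := 1 + 1 / k). assert (Hs : 0 < s) by (unfold s; assert (0 < 1 / k) by (apply Rdiv_lt_0_compat; lra); lra).
  assert (Hsg : s * g = 1) by (unfold s, g; field; lra).
  destruct (pow_weight_bound g b 2 Hg Hb) as [L [HL HL']].
  destruct (pow_exp_bound s g (b / 2) Hs Hsg ltac:(lra)) as [C0 [HC0 HC]].
  set (mu := fun i => A * L * (C0 ^ i * rpow (INR i) (s * INR i))).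
  assert (Hmu : moments a mu).
  { intros i p j. assert (Hx := INR_S_ge_1 j).
    apply Rle_trans with (A * weight g b j * INR (S j) ^ (i + 2)).
    - apply Rmult_le_compat_r; [apply pow_le; lra|apply H].
    - rewrite pow_add.
      replace (A * weight g b j * (INR (S j) ^ i * INR (S j) ^ 2))
        with (A * (INR (S j) ^ 2 * weight g b j) * INR (S j) ^ i) by ring.
      apply Rle_trans with (A * (L * weight g (b / 2) j) * INR (S j) ^ i).
      + apply Rmult_le_compat_r; [apply pow_le; lra|]. apply Rmult_le_compat_l; [lra|apply HL'].
      + unfold mu.
        replace (A * (L * weight g (b / 2) j) * INR (S j) ^ i)
          with (A * L * (INR (S j) ^ i * weight g (b / 2) j)) by ring.
        apply Rmult_le_compat_l; [apply Rlt_le, Rmult_lt_0_compat; lra|].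
        apply HC. lra. }
  set (n1 := INR (S K)). assert (Hn1 : 1 <= n1) by apply INR_S_ge_1.
  set (n2 := INR (K + 2)). assert (Hn2 : 0 <= n2) by apply pos_INR.
  set (B := 2 * n1 * A * L + n2 * C0 + 1).
  assert (Hc1 : 0 < 2 * n1 * A * L) by (repeat apply Rmult_lt_0_compat; lra).
  assert (Hc2 : 0 <= n2 * C0) by (apply Rmult_le_pos; lra).
  exists B. split; [unfold B; lra|]. intros a1 a2. set (M := (a1 + a2)%nat).
  apply sup_norm_le. intros z Hz.
  rewrite (Dpart_polyseries K a1 a2 a f Ha Hf z Hz).
  assert (Hy := moments_iter K arr_dy a2 a mu (admissible_dy K) (moments_dy K) Ha Hmu).
  assert (Hx := moments_iter K arr_dx a1 _ _ (admissible_dx K) (moments_dx K)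
    (admissible_iter K arr_dy a2 a (admissible_dy K) Ha) Hy).
  assert (X : Cmod (polyseries K (Nat.iter a1 arr_dx (Nat.iter a2 arr_dy a)) z)
     <= n1 * (2 * (n2 ^ a1 * (n2 ^ a2 * mu M)))).
  { apply csum_le_const. intros p _. rewrite Cmod_mult, Cmod_pow, Cmod_conj.
    unfold disc in Hz.
    assert (Hzp := pow_le_one (Cmod z) p (conj (Cmod_ge_0 z) (Rlt_le _ _ Hz))).
    assert (Hps := PS_moment_bound (Nat.iter a1 arr_dx (Nat.iter a2 arr_dy a) p) z
       (n2 ^ a1 * (n2 ^ a2 * mu M)) (Rlt_le _ _ Hz) (fun j => Hx O p j)).
    eapply Rle_trans; [|exact Hps].
    rewrite <- (Rmult_1_l (Cmod (PS _ _))) at 2. apply Rmult_le_compat_r; [apply Cmod_ge_0|exact Hzp]. }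
  apply Rle_trans with (1 := X). unfold mu.
  replace (n1 * (2 * (n2 ^ a1 * (n2 ^ a2 * (A * L * (C0 ^ M * rpow (INR M) (s * INR M)))))))
    with (2 * n1 * A * L * ((n2 * C0) ^ M) * rpow (INR M) (s * INR M)).
  - apply Rmult_le_compat_r; [apply rpow_ge_0|].
    rewrite Nat.add_1_r, <- tech_pow_Rmult. apply Rmult_le_compat.
    + lra.
    + apply pow_le; exact Hc2.
    + unfold B; lra.
    + apply pow_incr. unfold B; lra.
  - rewrite Rpow_mult_distr. unfold M. rewrite (pow_add n2). ring.
Qed.

(** * Spaces of N-analytic polynomials *)

Lemma poly_eval_PS (a : nat -> C) (m : nat) (z : C) :
  poly_eval a m z = PS (fun j => if Nat.leb j m then a j else RtoC 0) z.
Proof.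
  rewrite (PS_finite _ z (S m)).
  - unfold poly_eval. rewrite sum_n_csum. apply csum_ext. intros j Hj.
    rewrite leb_correct by lia. reflexivity.
  - intros j Hj. rewrite leb_correct_conv by lia.
    reflexivity.
Qed.

Lemma PS_finite_unique (b c : nat -> C) (m n : nat) :
  (forall j, (m <= j)%nat -> b j = RtoC 0) -> (forall j, (n <= j)%nat -> c j = RtoC 0) ->
  (forall z, PS b z = PS c z) -> b = c.
Proof.
  intros Hb Hc H.
  destruct (rad1_finite b m Hb (/ 2) ltac:(lra)) as [M [_ HM]].
  destruct (rad1_finite c n Hc (/ 2) ltac:(lra)) as [L [_ HL]].
  apply (PS_coef_unique b c (/ 2) M L); auto. lra.
Qed.

Lemma Pi_space_polyseries (K n : nat) (c : nat -> nat -> C) :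
  (forall p j, (n < j)%nat -> c p j = RtoC 0) -> Pi_space (S K) n (polyseries K c).
Proof.
  intros Hc. exists (fun p => PS (c p)).
  assert (E : forall p z, PS (c p) z = poly_eval (c p) n z).
  { intros p z. rewrite (PS_finite _ z (S n)) by (intros; apply Hc; lia).
    unfold poly_eval. rewrite sum_n_csum. reflexivity. }
  split; [split|].
  - intros p _. exists n, (c p). apply E.
  - intros z. simpl. rewrite Nat.sub_0_r, sum_n_csum. apply csum_ext. intros p _. ring.
  - intros p d _ [a [Had Ha]]. destruct (Nat.le_gt_cases d n) as [Hd|Hd]; [exact Hd|exfalso].
    assert (Eq : c p = (fun j => if Nat.leb j d then a j else RtoC 0)).
    { apply (PS_finite_unique _ _ (S n) (S d)).
      - intros j Hj. apply Hc. lia.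
      - intros j Hj. rewrite leb_correct_conv by lia.
        reflexivity.
      - intros z. rewrite Ha. apply poly_eval_PS. }
    apply Had. rewrite <- (Hc p d Hd), Eq, Nat.leb_refl. reflexivity.
Qed.

Lemma poly_coefs (Q : C -> C) (n : nat) : is_poly Q ->
  (forall d, has_degree Q d -> (d <= n)%nat) ->
  exists c, (forall j, (n < j)%nat -> c j = RtoC 0) /\ forall z, Q z = PS c z.
Proof.
  intros [m [a Ha]] Hd. induction m as [|m IH].
  - exists (fun j => if Nat.leb j 0 then a j else RtoC 0). split.
    + intros j Hj. rewrite leb_correct_conv by lia.
      reflexivity.
    + intros z. rewrite Ha. apply poly_eval_PS.
  - destruct (Nat.le_gt_cases (S m) n) as [Hm|Hm].
    + exists (fun j => if Nat.leb j (S m) then a j else RtoC 0). split.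
      * intros j Hj. rewrite leb_correct_conv by lia.
        reflexivity.
      * intros z. rewrite Ha. apply poly_eval_PS.
    + apply IH. intros z. rewrite Ha. unfold poly_eval. rewrite !sum_n_csum, (csum_S _ (S m)).
      destruct (Ceq_dec (a (S m)) 0) as [E|E]; [rewrite E; ring|exfalso].
      assert (X := Hd (S m) (ex_intro _ a (conj E Ha))). lia.
Qed.

Lemma Pi_space_coefs (K n : nat) (P : C -> C) : Pi_space (S K) n P ->
  exists c, (forall p j, (K < p)%nat -> c p j = RtoC 0) /\
    (forall p j, (n < j)%nat -> c p j = RtoC 0) /\ forall z, P z = polyseries K c z.
Proof.
  intros [Q [[HQ HP] Hd]].
  destruct (functional_choice (fun p (c : nat -> C) =>
     ((K < p)%nat -> forall j, c j = RtoC 0) /\ (forall j, (n < j)%nat -> c j = RtoC 0) /\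
     ((p <= K)%nat -> forall z, Q p z = PS c z))) as [c Hc].
  - intros p. destruct (Nat.lt_ge_cases K p) as [Hp|Hp].
    + exists (fun _ => RtoC 0). repeat split; intros; try reflexivity; lia.
    + destruct (poly_coefs (Q p) n (HQ p ltac:(lia)) (fun d => Hd p d ltac:(lia))) as [c [Hc1 Hc2]].
      exists c. repeat split; auto. intros; lia.
  - exists c. split; [|split].
    + intros p j Hp. exact (proj1 (Hc p) Hp j).
    + intros p j Hj. exact (proj1 (proj2 (Hc p)) j Hj).
    + intros z. rewrite HP. simpl. rewrite Nat.sub_0_r, sum_n_csum. apply csum_ext.
      intros p Hp. rewrite (proj2 (proj2 (Hc p))) by lia. ring.
Qed.

(** * Continuity up to the boundary *)

(** Real differentiability at a point. *)
Definition smooth (F : C -> C) (z : C) : Prop := exists A B, wirtinger F z A B.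

Lemma smooth_mult (F G : C -> C) (z : C) : smooth F z -> smooth G z ->
  smooth (fun w => (F w * G w)%C) z.
Proof.
  intros [A [B H]] [A' [B' H']]. eexists _, _. apply (wirtinger_mult _ _ _ _ _ _ _ H H').
Qed.

Lemma smooth_const (c z : C) : smooth (fun _ => c) z.
Proof. eexists _, _. apply wirtinger_const. Qed.

Lemma smooth_pow (F : C -> C) (z : C) (n : nat) : smooth F z -> smooth (fun w => (F w ^ n)%C) z.
Proof.
  intros H. induction n as [|n IH]; [exact (smooth_const 1 z)|].
  apply (smooth_mult F (fun w => (F w ^ n)%C)); assumption.
Qed.

Lemma smooth_csum (F : nat -> C -> C) (n : nat) (z : C) : (forall p, smooth (F p) z) ->
  smooth (fun w => csum (fun p => F p w) n) z.
Proof.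
  intros H. induction n as [|n IH]; [exact (smooth_const 0 z)|].
  destruct IH as [A [B IH]]. destruct (H n) as [A' [B' H']].
  eexists _, _. apply (wirtinger_plus _ _ _ _ _ _ _ IH H').
Qed.

Lemma smooth_id (z : C) : smooth (fun w => w) z.
Proof.
  exists (RtoC 1), (RtoC 0). intros eps Heps. exists 1. split; [lra|]. intros h _.
  replace (z + h - z - (1 * h + 0 * Cconj h))%C with (RtoC 0) by ring.
  rewrite Cmod_0. apply Rmult_le_pos; [lra|apply Cmod_ge_0].
Qed.

Lemma continuous_on_polyseries_finite (D : C -> Prop) (K n : nat) (c : nat -> nat -> C) :
  (forall p j, (n < j)%nat -> c p j = RtoC 0) -> continuous_on D (polyseries K c).
Proof.
  intros Hc. apply continuous_on_Cmod. intros z _ eps Heps.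
  assert (H : smooth (polyseries K c) z).
  { rewrite (functional_extensionality (polyseries K c) (fun w => csum (fun p =>
       (Cconj w ^ p * csum (fun j => c p j * w ^ j) (S n))%C) (S K))).
    - apply (smooth_csum (fun p w => (Cconj w ^ p * csum (fun j => c p j * w ^ j) (S n))%C)).
      intros p. apply smooth_mult.
      + apply smooth_pow. eexists _, _. apply wirtinger_conj.
      + apply (smooth_csum (fun j w => (c p j * w ^ j)%C)). intros j.
        apply smooth_mult; [apply smooth_const|]. apply (smooth_pow (fun w => w)), smooth_id.
    - intros w. apply csum_ext. intros p _. rewrite (PS_finite _ w (S n)); [reflexivity|].
      intros; apply Hc; lia. }
  destruct H as [A [B H]]. destruct (wirtinger_cont _ _ _ _ H eps Heps) as [d [Hd Hd']].
  exists d. split; [exact Hd|]. intros w _ Hw. apply Hd', Hw.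
Qed.

(** A bound in the open disc extends to the closed disc. *)
Lemma cdisc_bound (F : C -> C) (M : R) : continuous_on cdisc F ->
  (forall z, disc z -> Cmod (F z) <= M) -> forall z, cdisc z -> Cmod (F z) <= M.
Proof.
  intros HF H z Hz. unfold cdisc in Hz. assert (Hz0 := Cmod_ge_0 z).
  apply le_epsilon. intros eps Heps.
  destruct (proj1 (continuous_on_Cmod cdisc F) HF z Hz eps Heps) as [d [Hd Hd']].
  set (t := Rmin (d / 2) (/ 2)).
  assert (Ht : 0 < t) by (apply Rmin_pos; lra).
  assert (Ht1 : t <= d / 2) by apply Rmin_l. assert (Ht2 : t <= / 2) by apply Rmin_r.
  set (w := (RtoC (1 - t) * z)%C).
  assert (Hw : Cmod w < 1).
  { unfold w. rewrite Cmod_mult, Cmod_R, Rabs_pos_eq by lra.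
    apply Rle_lt_trans with ((1 - t) * 1); [apply Rmult_le_compat_l; lra|lra]. }
  assert (Hwz : Cmod (w - z) < d).
  { replace (w - z)%C with (RtoC (- t) * z)%C
      by (unfold w; rewrite RtoC_minus, RtoC_opp; ring).
    rewrite Cmod_mult, Cmod_R, Rabs_Ropp, Rabs_pos_eq by lra.
    apply Rle_lt_trans with (t * 1); [apply Rmult_le_compat_l; lra|lra]. }
  assert (X := Hd' w (Rlt_le _ _ Hw) Hwz). assert (Y := H w Hw).
  assert (Z := Cmod_triangle_rev (F z) (F w)). rewrite Cmod_minus_sym in Z. lra.
Qed.

(** * Best approximation *)

Lemma best_approx_le (N n : nat) (f P : C -> C) (M : R) : Pi_space N n P ->
  (forall z, cdisc z -> Cmod (f z - P z) <= M) -> Rbar_le (best_approx N n f) M.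
Proof.
  intros HP HM. set (h := fun z => (f z - P z)%C).
  assert (H1 := sup_norm_le cdisc h M HM).
  assert (H0 : cdisc 0) by (unfold cdisc; rewrite Cmod_0; lra).
  assert (H2 : Rbar_le (Cmod (h 0)) (sup_norm cdisc h)).
  { unfold sup_norm. destruct (Lub_Rbar_correct (fun r => exists u, cdisc u /\ r = Cmod (h u))) as [X _].
    apply X. exists 0. split; [exact H0|reflexivity]. }
  destruct (sup_norm cdisc h) as [r| |] eqn:E; try contradiction.
  unfold best_approx.
  destruct (Glb_Rbar_correct (fun r => exists P, Pi_space N n P /\
    Finite r = sup_norm cdisc (fun z => (f z - P z)%C))) as [X _].
  eapply Rbar_le_trans; [apply (X r)|exact H1].
  exists P. split; [exact HP|symmetry; exact E].
Qed.

(** The infimum need not be attained; twice a positive upper bound is reached. *)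
Lemma best_approx_near (N n : nat) (f : C -> C) (m : R) : 0 < m ->
  Rbar_le (best_approx N n f) m ->
  exists P, Pi_space N n P /\ forall z, cdisc z -> Cmod (f z - P z) <= 2 * m.
Proof.
  intros Hm H. apply NNPP. intros Hn.
  assert (X : Rbar_le (2 * m) (best_approx N n f)).
  { unfold best_approx.
    destruct (Glb_Rbar_correct (fun r => exists P, Pi_space N n P /\
      Finite r = sup_norm cdisc (fun z => (f z - P z)%C))) as [_ Y].
    apply Y. intros r [P [HP Hr]]. simpl.
    destruct (Rle_lt_dec (2 * m) r) as [L|L]; [exact L|exfalso].
    apply Hn. exists P. split; [exact HP|]. intros z Hz.
    apply Rle_trans with r; [|lra].
    apply (sup_norm_elem cdisc (fun z => (f z - P z)%C) r z); [|exact Hz].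
    rewrite <- Hr. apply Rbar_le_refl. }
  assert (Y := Rbar_le_trans _ _ _ X H). simpl in Y. lra.
Qed.

(** The array with the coefficients of index [j > n] removed. *)
Definition truncate (n : nat) (a : nat -> nat -> C) : nat -> nat -> C :=
  fun p j => if Nat.leb j n then a p j else RtoC 0.

Lemma best_approx_decay (K : nat) (g : R) (a : nat -> nat -> C) (f : C -> C) : 0 < g ->
  decays g a -> (forall p j, (K < p)%nat -> a p j = RtoC 0) ->
  continuous_on cdisc f -> (forall z, disc z -> f z = polyseries K a z) ->
  exists alpha beta, 0 < alpha /\ 0 < beta /\
    forall n, Rbar_le (best_approx (S K) n f) (alpha * exp (- beta * rpow (INR n) g)).
Proof.
  intros Hg [A [b [HA [Hb H]]]] H0 Hfc Hf.
  destruct (weight_telescope g b Hg Hb) as [L [HL HL']].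
  assert (HSK : 0 < INR (S K)) by (apply lt_0_INR; lia).
  exists (INR (S K) * (A * L)), (b / 2).
  split; [repeat apply Rmult_lt_0_compat; lra|split; [lra|]]. intros n.
  assert (Htr : forall p j, (n < j)%nat -> truncate n a p j = RtoC 0).
  { intros p j Hj. unfold truncate.
    rewrite leb_correct_conv by lia. reflexivity. }
  apply Rbar_le_trans with (INR (S K) * (A * (L * wtail g (b / 2) (S n)))).
  - apply (best_approx_le (S K) n f (polyseries K (truncate n a))).
    + apply Pi_space_polyseries. exact Htr.
    + apply (cdisc_bound (fun z => (f z - polyseries K (truncate n a) z)%C)).
      * rewrite (functional_extensionality _ (fun z => (1 * f z + -1 * polyseries K (truncate n a) z)%C))
          by (intros; rewrite RtoC_m1; ring).
        apply continuous_on_lin; [exact Hfc|apply (continuous_on_polyseries_finite cdisc K n _ Htr)].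
      * intros z Hz. rewrite (Hf z Hz).
        replace (polyseries K a z - polyseries K (truncate n a) z)%C
          with (csum (fun p => (Cconj z ^ p * (PS (a p) z - PS (truncate n a p) z))%C) (S K)).
        2: { unfold polyseries. rewrite (csum_ext _ (fun p =>
               (Cconj z ^ p * PS (a p) z + -1 * (Cconj z ^ p * PS (truncate n a p) z))%C))
               by (intros; rewrite RtoC_m1; ring).
             rewrite csum_plus, csum_scal, RtoC_m1. ring. }
        apply csum_le_const. intros p _. rewrite Cmod_mult, Cmod_pow, Cmod_conj.
        unfold disc in Hz. assert (Hz0 := Cmod_ge_0 z).
        assert (Hzp := pow_le_one (Cmod z) p ltac:(lra)).
        destruct (csum_clim (fun j => (a p j * z ^ j)%C) (fun j => (A * L) * wtail g (b / 2) j))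
          as [l [Hl Hln]].
        -- apply wtail_lim; [lra|]. apply Rlt_le, Rmult_lt_0_compat; lra.
        -- intros j. rewrite Cmod_mult, Cmod_pow.
           assert (Hzj := pow_le_one (Cmod z) j ltac:(lra)).
           specialize (H p j). specialize (HL' j). assert (Haj := Cmod_ge_0 (a p j)).
           apply Rle_trans with (Cmod (a p j) * 1); [apply Rmult_le_compat_l; lra|].
           assert (A * weight g b j <= A * (L * wtail g (b / 2) j - L * wtail g (b / 2) (S j)))
             by (apply Rmult_le_compat_l; lra). lra.
        -- rewrite (PS_unique (a p) z l Hl). specialize (Hln (S n)).
           rewrite (PS_finite (truncate n a p) z (S n)) by (intros; apply Htr; lia).
           rewrite (csum_ext _ (fun j => (a p j * z ^ j)%C)).
           2: { intros j Hj. unfold truncate.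
                rewrite leb_correct by lia. reflexivity. }
           rewrite Cmod_minus_sym.
           set (X := Cmod (csum _ (S n) - l)) in *.
           assert (HX : 0 <= X) by apply Cmod_ge_0.
           apply Rle_trans with (1 * X); [apply Rmult_le_compat_r; lra|lra].
  - unfold Rbar_le. rewrite !Rmult_assoc. apply Rmult_le_compat_l; [lra|].
    do 2 (apply Rmult_le_compat_l; [lra|]).
    apply Rle_trans with (1 := wtail_le_weight g (b / 2) (S n)).
    unfold weight. apply exp_le.
    assert (X : rpow (INR n) g <= Rpower (INR (S (S n))) g).
    { destruct n as [|n].
      - simpl (INR 0). rewrite rpow_0_pos by lra. left; apply exp_pos.
      - rewrite rpow_pos by (apply lt_0_INR; lia). apply Rpower_mono; [|lra].
        split; [apply lt_0_INR; lia|apply le_INR; lia]. }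
    assert (b / 2 * rpow (INR n) g <= b / 2 * Rpower (INR (S (S n))) g)
      by (apply Rmult_le_compat_l; lra). lra.
Qed.

(** * Recovering the function from its best approximations *)

(** The shift from [n] to the index [n + 1] of the weight, that is to the power
    [(n + 2) ^ g], costs a third of the exponent and a constant. *)
Lemma exp_rpow_weight (g beta : R) (n : nat) : 0 < g <= 1 -> 0 < beta ->
  exp (- beta * rpow (INR n) g) <= exp beta * weight g (beta / 3) (S n).
Proof.
  intros Hg Hb. unfold weight. rewrite <- exp_plus. apply exp_le.
  assert (X : Rpower (INR (S (S n))) g <= 3 * rpow (INR n) g + 3).
  { destruct n as [|n].
    - simpl (INR 0). rewrite rpow_0_pos by lra.
      replace (INR 2) with 2 by (simpl; ring).
      assert (Y := Rle_Rpower 2 g 1 ltac:(lra) ltac:(lra)). rewrite Rpower_1 in Y by lra. lra.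
    - assert (Hn := INR_S_ge_1 n). rewrite rpow_pos by lra.
      assert (Y1 : Rpower (INR (S (S (S n)))) g <= Rpower (3 * INR (S n)) g).
      { apply Rpower_mono; [|lra]. split; [apply lt_0_INR; lia|].
        rewrite (S_INR (S (S n))), (S_INR (S n)). lra. }
      rewrite <- Rpower_mult_distr in Y1 by lra.
      assert (Y2 := Rle_Rpower 3 g 1 ltac:(lra) ltac:(lra)). rewrite Rpower_1 in Y2 by lra.
      assert (Y3 : 0 < Rpower (INR (S n)) g) by apply exp_pos.
      assert (Y4 : Rpower 3 g * Rpower (INR (S n)) g <= 3 * Rpower (INR (S n)) g)
        by (apply Rmult_le_compat_r; lra).
      lra. }
  assert (beta / 3 * Rpower (INR (S (S n))) g <= beta / 3 * (3 * rpow (INR n) g + 3))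
    by (apply Rmult_le_compat_l; lra). lra.
Qed.

Lemma rad1_pow_INR (c : nat) : rad1 (fun j => RtoC (INR (S j) ^ c)).
Proof.
  induction c as [|c IH].
  - apply rad1_bounded with 1. intros j. simpl. rewrite Cmod_1. lra.
  - assert (X := rad1_plus _ _ (rad1_mul_INR _ IH) IH).
    rewrite (functional_extensionality (fun j => RtoC (INR (S j) ^ S c))
      (fun j => (RtoC (INR j) * RtoC (INR (S j) ^ c) + RtoC (INR (S j) ^ c))%C)); [exact X|].
    intros j. rewrite <- RtoC_mult, <- RtoC_plus. f_equal. rewrite S_INR. simpl. ring.
Qed.

Lemma limit_array (b : nat -> nat -> nat -> C) (c : nat) (tau : nat -> R) :
  (forall p j, b O p j = RtoC 0) -> is_lim_seq tau 0 ->
  (forall n p j, Cmod (b (S n) p j - b n p j) <= INR (S j) ^ c * (tau n - tau (S n))) ->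
  exists a, forall n p j, Cmod (b n p j - a p j) <= INR (S j) ^ c * tau n.
Proof.
  intros Hb0 Htau Hb.
  destruct (functional_choice (fun (pj : nat * nat) l => forall n,
     Cmod (b n (fst pj) (snd pj) - l) <= INR (S (snd pj)) ^ c * tau n)) as [a Ha].
  - intros [p j]. unfold fst, snd.
    destruct (csum_clim (fun n => (b (S n) p j - b n p j)%C) (fun n => INR (S j) ^ c * tau n))
      as [l [_ Hl]].
    + replace (Finite 0) with (Rbar_mult (INR (S j) ^ c) 0) by (simpl; f_equal; ring).
      apply is_lim_seq_scal_l. exact Htau.
    + intros n. rewrite <- Rmult_minus_distr_l. apply Hb.
    + exists l. intros n. specialize (Hl n).
      replace (csum (fun n => (b (S n) p j - b n p j)%C) n) with (b n p j) in Hl; [exact Hl|].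
      clear Hl. induction n as [|n IH]; [apply Hb0|]. rewrite csum_S, <- IH. ring.
  - exists (fun p j => a (p, j)). intros n p j. apply (Ha (p, j)).
Qed.

(** The coefficients of near-best approximants converge at a stretched
    exponential rate; the limit array decays because the approximants of degree
    less than [j] have no coefficient of index [j]. *)
Lemma decays_of_best_approx (K : nat) (g alpha beta : R) (f : C -> C) :
  0 < g <= 1 -> 0 < alpha -> 0 < beta ->
  (forall n, Rbar_le (best_approx (S K) n f) (alpha * exp (- beta * rpow (INR n) g))) ->
  exists a, decays g a /\ (forall p j, (K < p)%nat -> a p j = RtoC 0) /\
    forall z, disc z -> f z = polyseries K a z.
Proof.
  intros Hg Halpha Hbeta H.
  set (b3 := beta / 3). assert (Hb3 : 0 < b3) by (unfold b3; lra).
  set (A3 := alpha * exp beta). assert (HA3 : 0 < A3) by (apply Rmult_lt_0_compat; [lra|apply exp_pos]).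
  destruct (functional_choice (fun n (c : nat -> nat -> C) =>
     (forall p j, (K < p)%nat -> c p j = RtoC 0) /\ (forall p j, (n < j)%nat -> c p j = RtoC 0) /\
     forall z, cdisc z -> Cmod (f z - polyseries K c z) <= 2 * (A3 * weight g b3 (S n)))) as [c Hc].
  { intros n.
    assert (Hw : 0 < A3 * weight g b3 (S n)) by (apply Rmult_lt_0_compat; [lra|apply weight_pos]).
    destruct (best_approx_near (S K) n f (A3 * weight g b3 (S n)) Hw) as [P [HP HP']].
    - eapply Rbar_le_trans; [apply (H n)|]. simpl. unfold A3. rewrite Rmult_assoc.
      apply Rmult_le_compat_l; [lra|]. apply exp_rpow_weight; assumption.
    - destruct (Pi_space_coefs K n P HP) as [c [Hc1 [Hc2 Hc3]]]. exists c.
      split; [exact Hc1|split; [exact Hc2|]]. intros z Hz. rewrite <- Hc3. apply HP', Hz. }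
  (* The sequence is started at zero, so that its n-th array has no coefficient of
     index j as soon as n <= j. *)
  set (b := fun n => match n with O => fun _ _ => RtoC 0 | S m => c m end).
  assert (Hbrow : forall n p j, (K < p)%nat -> b n p j = RtoC 0).
  { intros [|n] p j Hp; [reflexivity|]. exact (proj1 (Hc n) p j Hp). }
  assert (Hbdeg : forall n p j, (n <= j)%nat -> b n p j = RtoC 0).
  { intros [|n] p j Hj; [reflexivity|]. apply (proj1 (proj2 (Hc n))). lia. }
  assert (Hbadm : forall n, admissible K (b n)).
  { intros n. split; [|apply Hbrow]. intros p. apply (rad1_finite _ n). intros j. apply Hbdeg. }
  destruct (polyseries_coef_bound K) as [C0 [HC0 HC]].
  assert (HD : exists D, 0 <= D /\ forall p, Cmod (c O p O) <= D).
  { assert (X : forall m, exists D, 0 <= D /\ forall p, (p < m)%nat -> Cmod (c O p O) <= D).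
    { induction m as [|m [D [HD IH]]]; [exists 0; split; [lra|intros; lia]|].
      exists (Rmax D (Cmod (c O m O))). split; [eapply Rle_trans; [exact HD|apply Rmax_l]|].
      intros p Hp. destruct (Nat.eq_dec p m) as [->|Hne]; [apply Rmax_r|].
      eapply Rle_trans; [apply IH; lia|apply Rmax_l]. }
    destruct (X (S K)) as [D [HD HD']]. exists D. split; [exact HD|]. intros p.
    destruct (Nat.lt_ge_cases K p) as [Hp|Hp]; [|apply HD'; lia].
    rewrite (proj1 (Hc O)) by exact Hp. rewrite Cmod_0. exact HD. }
  destruct HD as [D [HD HD']].
  set (A0 := C0 * (4 * A3) + D / weight g b3 0).
  assert (HD0 : 0 <= D / weight g b3 0).
  { apply Rmult_le_pos; [exact HD|]. left. apply Rinv_0_lt_compat, weight_pos. }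
  assert (HCA : 0 < C0 * (4 * A3)) by (apply Rmult_lt_0_compat; lra).
  assert (HA0 : 0 < A0) by (unfold A0; lra).
  assert (Hdiff : forall n p j,
     Cmod (b (S n) p j - b n p j) <= INR (S j) ^ S K * (A0 * weight g b3 n)).
  { intros n p j. assert (Hj : 1 <= INR (S j) ^ S K) by (apply pow_R1_Rle, INR_S_ge_1).
    assert (Hw := weight_pos g b3 n).
    destruct n as [|n].
    - simpl b. replace (c O p j - 0)%C with (c O p j) by ring.
      assert (X : Cmod (c O p j) <= D).
      { destruct j as [|j]; [apply HD'|]. rewrite (proj1 (proj2 (Hc O))) by lia.
        rewrite Cmod_0. exact HD. }
      assert (Y : D <= A0 * weight g b3 0).
      { unfold A0. rewrite Rmult_plus_distr_r. unfold Rdiv.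
        rewrite (Rmult_assoc D), Rinv_l, Rmult_1_r by lra.
        assert (0 < C0 * (4 * A3) * weight g b3 0) by (apply Rmult_lt_0_compat; lra). lra. }
      apply Rle_trans with (1 * (A0 * weight g b3 0)); [lra|].
      apply Rmult_le_compat_r; [lra|exact Hj].
    - assert (Hadm : admissible K (arr_add (b (S (S n))) (arr_scal (-1) (b (S n))))).
      { apply admissible_add; [apply Hbadm|apply admissible_scal, Hbadm]. }
      assert (X := HC _ (4 * (A3 * weight g b3 (S n))) Hadm).
      replace (b (S (S n)) p j - b (S n) p j)%C
        with (arr_add (b (S (S n))) (arr_scal (-1) (b (S n))) p j)
        by (unfold arr_add, arr_scal; rewrite RtoC_m1; ring).
      eapply Rle_trans; [apply X|].
      + intros z Hz.
        rewrite polyseries_add, polyseries_scal; auto using admissible_scal.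
        assert (Hzc : cdisc z) by (apply Rlt_le, Hz).
        assert (Y1 := proj2 (proj2 (Hc (S n))) z Hzc).
        assert (Y2 := proj2 (proj2 (Hc n)) z Hzc).
        change (b (S (S n))) with (c (S n)). change (b (S n)) with (c n).
        replace (polyseries K (c (S n)) z + -1 * polyseries K (c n) z)%C
          with ((f z - polyseries K (c n) z) + - (f z - polyseries K (c (S n)) z))%C
          by (rewrite RtoC_m1; ring).
        eapply Rle_trans; [apply Cmod_triangle|]. rewrite Cmod_opp.
        assert (W := weight_decr g b3 (S n) (proj1 Hg) Hb3).
        assert (A3 * weight g b3 (S (S n)) <= A3 * weight g b3 (S n))
          by (apply Rmult_le_compat_l; lra). lra.
      + replace (C0 * INR (S j) ^ S K * (4 * (A3 * weight g b3 (S n))))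
          with (INR (S j) ^ S K * (C0 * (4 * A3) * weight g b3 (S n))) by ring.
        apply Rmult_le_compat_l; [lra|]. apply Rmult_le_compat_r; [lra|]. unfold A0; lra. }
  destruct (weight_telescope g b3 (proj1 Hg) Hb3) as [L [HL HL']].
  set (tau := fun n => A0 * L * wtail g (b3 / 2) n).
  assert (HAL : 0 < A0 * L) by (apply Rmult_lt_0_compat; lra).
  assert (Htau : is_lim_seq tau 0) by (apply wtail_lim; lra).
  destruct (limit_array b (S K) tau (fun p j => eq_refl) Htau) as [a Ha].
  { intros n p j. eapply Rle_trans; [apply Hdiff|].
    apply Rmult_le_compat_l; [apply pow_le, pos_INR|]. unfold tau. specialize (HL' n).
    assert (A0 * weight g b3 n <= A0 * (L * wtail g (b3 / 2) n - L * wtail g (b3 / 2) (S n)))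
      by (apply Rmult_le_compat_l; lra). lra. }
  assert (Harow : forall p j, (K < p)%nat -> a p j = RtoC 0).
  { intros p j Hp. apply (clim_unique (fun n => b n p j)).
    - eapply clim_of_bound; [intros n; apply Ha|].
      replace (Finite 0) with (Rbar_mult (INR (S j) ^ S K) 0) by (simpl; f_equal; ring).
      apply is_lim_seq_scal_l. exact Htau.
    - apply clim_of_bound with (tau := fun _ => 0); [|apply is_lim_seq_const].
      intros n. rewrite Hbrow by exact Hp. replace (0 - 0)%C with (RtoC 0) by ring.
      rewrite Cmod_0. lra. }
  assert (Hadec : decays g a).
  { destruct (pow_weight_bound g (b3 / 2) (S K) (proj1 Hg) ltac:(lra)) as [M [HM HM']].
    exists (A0 * L * M), (b3 / 2 / 2).
    split; [apply Rmult_lt_0_compat; lra|split; [lra|]]. intros p j.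
    assert (X := Ha j p j). rewrite Hbdeg, Cmod_minus_sym in X by lia.
    replace (a p j - 0)%C with (a p j) in X by ring.
    apply Rle_trans with (1 := X). unfold tau.
    apply Rle_trans with (A0 * L * (INR (S j) ^ S K * weight g (b3 / 2) j)).
    - replace (INR (S j) ^ S K * (A0 * L * wtail g (b3 / 2) j))
        with (A0 * L * (INR (S j) ^ S K * wtail g (b3 / 2) j)) by ring.
      apply Rmult_le_compat_l; [lra|]. apply Rmult_le_compat_l; [apply pow_le, pos_INR|].
      apply wtail_le_weight.
    - rewrite (Rmult_assoc (A0 * L)). apply Rmult_le_compat_l; [lra|apply HM']. }
  exists a. split; [exact Hadec|split; [exact Harow|]].
  assert (Haadm := decays_admissible g K a Hadec Harow).
  intros z Hz. assert (Hzc : cdisc z) by (apply Rlt_le, Hz).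
  assert (Hz0 := Cmod_ge_0 z). assert (Hz1 : Cmod z < 1) by exact Hz.
  set (r := (1 + Cmod z) / 2).
  destruct (rad1_pow_INR (S K) r ltac:(unfold r; lra)) as [G [HG HG']].
  assert (Hq : 0 < 1 - Cmod z / r).
  { apply Rmult_lt_reg_r with r; [unfold r; lra|].
    replace ((1 - Cmod z / r) * r) with (r - Cmod z) by (field; unfold r; lra). unfold r; lra. }
  apply (clim_unique (fun n => polyseries K (c n) z)).
  - eapply clim_of_bound.
    + intros n. rewrite Cmod_minus_sym. apply (proj2 (proj2 (Hc n))), Hzc.
    + apply (is_lim_seq_ext (fun n => 2 * A3 * weight g b3 (S n))); [intros; ring|].
      apply (is_lim_seq_incr_1 (fun n => 2 * A3 * weight g b3 n)).
      apply weight_lim; lra.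
  - apply clim_of_bound with (tau := fun n => INR (S K) * (G * tau (S n) / (1 - Cmod z / r))).
    + intros n.
      replace (polyseries K (c n) z - polyseries K a z)%C
        with (polyseries K (arr_add (b (S n)) (arr_scal (-1) a)) z).
      2: { rewrite polyseries_add, polyseries_scal; auto using admissible_scal.
           change (b (S n)) with (c n). rewrite RtoC_m1. ring. }
      apply polyseries_bound; [exact Hz|unfold r; lra|unfold r; lra|].
      intros p j. specialize (HG' j).
      rewrite Cmod_R, Rabs_pos_eq in HG' by apply pow_le, pos_INR.
      replace (arr_add (b (S n)) (arr_scal (-1) a) p j) with (b (S n) p j - a p j)%C
        by (unfold arr_add, arr_scal; rewrite RtoC_m1; ring).
      assert (Hrj : 0 <= r ^ j) by (apply pow_le; unfold r; lra).
      assert (Ht : 0 <= tau (S n)).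
      { unfold tau. apply Rmult_le_pos; [lra|left; apply wtail_pos]. }
      apply Rle_trans with (INR (S j) ^ S K * tau (S n) * r ^ j).
      * apply Rmult_le_compat_r; [exact Hrj|apply Ha].
      * replace (INR (S j) ^ S K * tau (S n) * r ^ j)
          with (INR (S j) ^ S K * r ^ j * tau (S n)) by ring.
        apply Rmult_le_compat_r; [exact Ht|exact HG'].
    + apply (is_lim_seq_ext (fun n => INR (S K) * G / (1 - Cmod z / r) * tau (S n)));
        [intros; unfold Rdiv; ring|].
      replace (Finite 0) with (Rbar_mult (INR (S K) * G / (1 - Cmod z / r)) 0)
        by (simpl; f_equal; ring).
      apply is_lim_seq_scal_l. apply (is_lim_seq_incr_1 tau). exact Htau.
Qed.

Lemma gevrey_series (K : nat) (k : R) (f : C -> C) : 0 < k -> gevrey_polyanalytic (S K) k f ->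
  exists a, decays (k / (k + 1)) a /\ (forall p j, (K < p)%nat -> a p j = RtoC 0) /\
    forall z, disc z -> f z = polyseries K a z.
Proof.
  intros Hk [[HC H0] [B [HB H]]].
  destruct (polyanalytic_series K (S K) (Nat.le_refl _) f HC H0) as [a [Ha [_ Hf]]].
  exists a. split; [|split; [apply Ha|exact Hf]].
  assert (Hk1 : 0 < 1 / k) by (apply Rdiv_lt_0_compat; lra).
  apply (gevrey_decays K (1 + 1 / k) (k / (k + 1)) B a); [lra|field; lra|exact HB|exact Ha|].
  intros a1 a2 z Hz. rewrite <- (Dpart_polyseries K a1 a2 a f Ha Hf z Hz).
  apply (sup_norm_elem disc _ _ z (H a1 a2) Hz).
Qed.

Lemma continuous_on_zero (D : C -> Prop) : continuous_on D (fun _ : C => RtoC 0).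
Proof.
  apply continuous_on_Cmod. intros z _ eps Heps. exists 1. split; [lra|]. intros w _ _.
  replace (0 - 0)%C with (RtoC 0) by ring. rewrite Cmod_0. exact Heps.
Qed.

Theorem corollary7p2 (N : nat) (hN : (1 <= N)%nat) (k : R) (hk : 0 < k) :
  degree_of_best_approx N (gevrey_cdisc N k)
    (fun m => exists alpha beta, 0 < alpha /\ 0 < beta /\ m = Theta k alpha beta).
Proof.
  destruct N as [|K]; [lia|].
  assert (Hg : 0 < k / (k + 1) <= 1).
  { split; [apply Rdiv_lt_0_compat; lra|]. apply Rmult_le_reg_r with (k + 1); [lra|].
    unfold Rdiv. rewrite Rmult_assoc, Rinv_l; lra. }
  split; [|split; [|split; [|split]]].
  - exists (fun _ => RtoC 0). split; [apply continuous_on_zero|].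
    apply (decays_gevrey K k (fun _ _ => RtoC 0)); [exact hk| |reflexivity|].
    + exists 1, 1. split; [lra|split; [lra|]]. intros p j. rewrite Cmod_0.
      assert (X := weight_pos (k / (k + 1)) 1 j). lra.
    + intros z _. symmetry. apply polyseries_zero.
  - intros f [Hf _]. exact Hf.
  - exists (Theta k 1 1), 1, 1. split; [lra|split; [lra|reflexivity]].
  - intros m [alpha [beta [Ha [_ ->]]]] t _. unfold Theta.
    apply Rmult_le_pos; [lra|left; apply exp_pos].
  - intros f Hfc. split.
    + intros [_ Hf]. destruct (gevrey_series K k f hk Hf) as [a [Ha [Ha0 Haf]]].
      destruct (best_approx_decay K _ a f (proj1 Hg) Ha Ha0 Hfc Haf)
        as [alpha [beta [Halpha [Hbeta H]]]].
      exists (Theta k alpha beta). split; [exists alpha, beta; auto|exact H].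
    + intros [m [[alpha [beta [Halpha [Hbeta ->]]]] H]]. split; [exact Hfc|].
      destruct (decays_of_best_approx K _ alpha beta f Hg Halpha Hbeta H) as [a [Ha [Ha0 Haf]]].
      apply (decays_gevrey K k a f hk Ha Ha0 Haf).
Qed.
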